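(* Let $k$ be an algebraically closed field of characteristic $2$, $S=\mathbf{V}(f)\subset\mathbb{A}^3$ with $f = x^2+y^2z+yz^2$, and $m\ge 5$. Let $R_m = k[x_0,\dots,x_m,y_0,\dots,y_m,z_0,\dots,z_m]$, $(\mathbb{A}^3)_m=\mathrm{Spec}\,R_m$, and define $f^{(j)}\in R_m$ by $f(\sum_{i=0}^m x_it^i,\sum_{i=0}^m y_it^i,\sum_{i=0}^m z_it^i) = \sum_{j=0}^m f^{(j)}t^j$ in $R_m[t]/\langle t^{m+1}\rangle$. The $m$-th jet scheme of $S$ is $S_m = \mathrm{Spec}\, R_m/\langle f^{(0)},\dots,f^{(m)}\rangle$, and its singular fiber is $S_m^0 = \mathbf{V}(x_0,y_0,z_0,f^{(0)},\dots,f^{(m)})$ (the fiber of the truncation $S_m\to S$, $(x_i,y_i,z_i)_i\mapsto (x_0,y_0,z_0)$, over the singular point $0$). Define $I_m^0 = \langle x_0,x_1,x_2,y_0,y_1,z_0,z_1\rangle + \langle f^{(0)},\dots,f^{(m)}\rangle$, $I_m^1 = J_m^1 (R_m)_{z_1}\cap R_m$, $I_m^2 = J_m^2 (R_m)_{y_1}\cap R_m$, $I_m^3 = J_m^3 (R_m)_{y_1}\cap R_m$, where $J_m^1 = \langle x_0,x_1,y_0,y_1,z_0\rangle + \langle f^{(0)},\dots,f^{(m)}\rangle$, $J_m^2 = \langle x_0,x_1,y_0,z_0,z_1\rangle + \langle f^{(0)},\dots,f^{(m)}\rangle$, $J_m^3 = \langle x_0,x_1,y_0,z_0,y_1+z_1\rangle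 + \langle f^{(0)},\dots,f^{(m)}\rangle$, and $Z_m^i = \mathbf{V}(I_m^i)$ for $i=0,1,2,3$. Then each $Z_m^i$ ($0\le i\le 3$) is irreducible of dimension $2m+1$, and the irreducible decomposition of $S_m^0$ is $$S_m^0 = Z_m^0\cup Z_m^1\cup Z_m^2\cup Z_m^3.$$ Furthermore, for $m\ge 6$, $Z_m^0\cong \mathbb{A}^{11}\times S_{m-6}$, where $S_{m-6}$ is the $(m-6)$-th jet scheme of $S$.
   Context: $(R_m)_h$ is the localization of $R_m$ at powers of $h$. $\mathbf{V}(\cdot)$ denotes zero sets in $(\mathbb{A}^3)_m\cong\mathbb{A}^{3(m+1)}$. $S$ has a rational double point of type $D_4^0$ at the origin. *)

(* Defs.v *)
From HB Require Import structures.
From mathcomp Require Import all_boot all_order all_algebra.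
From mathcomp Require Import mpoly.

Import GRing.Theory.
Local Open Scope ring_scope.

(* R_m = k[x_0..x_m, y_0..y_m, z_0..z_m] is {mpoly k[(3*m).+3]};               *)
(* variable x_i has index i, y_i index m+1+i, z_i index 2(m+1)+i.             *)

Section Jets.
Variable k : fieldType.

Definition nv (m : nat) : nat := (3 * m).+3.
Definition Rm (m : nat) := {mpoly k[nv m]}.

Definition xv m i : Rm m := 'X_(inord i).
Definition yv m i : Rm m := 'X_(inord (m.+1 + i)).
Definition zv m i : Rm m := 'X_(inord (m.+1 + m.+1 + i)).

Definition Xt m : {poly Rm m} := \sum_(i < m.+1) (xv m i)%:P * 'X^i.
Definition Yt m : {poly Rm m} := \sum_(i < m.+1) (yv m i)%:P * 'X^i.
Definition Zt m : {poly Rm m} := \sum_(i < m.+1) (zv m i)%:P * 'X^i.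

(* f = x^2 + y^2 z + y z^2 ; f^(j) = coefficient of t^j of f(X(t),Y(t),Z(t)),
   which for j <= m agrees with the coefficient in R_m[t]/<t^(m+1)> *)
Definition fjet m (j : nat) : Rm m :=
  (Xt m ^+ 2 + Yt m ^+ 2 * Zt m + Yt m * Zt m ^+ 2)`_j.

Definition fjets m : seq (Rm m) := [seq fjet m j | j <- iota 0 m.+1].

Definition in_ideal {n} (gs : seq {mpoly k[n]}) (p : {mpoly k[n]}) : Prop :=
  exists c : 'I_(size gs) -> {mpoly k[n]}, p = \sum_(i < size gs) c i * gs`_i.

(* contraction of the localization: J (R)_h \cap R *)
Definition saturate {n} (J : {mpoly k[n]} -> Prop) (h : {mpoly k[n]}) (p : {mpoly k[n]}) : Prop :=
  exists e : nat, J (h ^+ e * p).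

Definition I0 m : Rm m -> Prop :=
  in_ideal ([:: xv m 0; xv m 1; xv m 2; yv m 0; yv m 1; zv m 0; zv m 1] ++ fjets m).
Definition J1 m : Rm m -> Prop :=
  in_ideal ([:: xv m 0; xv m 1; yv m 0; yv m 1; zv m 0] ++ fjets m).
Definition J2 m : Rm m -> Prop :=
  in_ideal ([:: xv m 0; xv m 1; yv m 0; zv m 0; zv m 1] ++ fjets m).
Definition J3 m : Rm m -> Prop :=
  in_ideal ([:: xv m 0; xv m 1; yv m 0; zv m 0; yv m 1 + zv m 1] ++ fjets m).
Definition I1 (m : nat) : Rm m -> Prop := saturate (J1 m) (zv m 1).
Definition I2 (m : nat) : Rm m -> Prop := saturate (J2 m) (yv m 1).
Definition I3 (m : nat) : Rm m -> Prop := saturate (J3 m) (yv m 1).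

Definition Im m (i : nat) : Rm m -> Prop :=
  match i with 0 => I0 m | 1 => I1 m | 2 => I2 m | _ => I3 m end.

Definition Ifib m : Rm m -> Prop :=
  in_ideal ([:: xv m 0; yv m 0; zv m 0] ++ fjets m).

Definition Ijet m : Rm m -> Prop := in_ideal (fjets m).

Definition pt n := 'I_n -> k.

Definition zeroset {n} (T : {mpoly k[n]} -> Prop) : pt n -> Prop :=
  fun v => forall p, T p -> p.@[v] = 0.

Definition zclosed {n} (A : pt n -> Prop) : Prop :=
  exists T : {mpoly k[n]} -> Prop, forall v, A v <-> zeroset T v.

Definition zsubset {n} (A B : pt n -> Prop) : Prop := forall v, A v -> B v.

Definition irreducible {n} (A : pt n -> Prop) : Prop :=
  (exists v, A v) /\
  forall B C : pt n -> Prop, zclosed B -> zclosed C ->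
    zsubset A (fun v => B v \/ C v) -> zsubset A B \/ zsubset A C.

Definition has_chain {n} (A : pt n -> Prop) (e : nat) : Prop :=
  exists c : nat -> (pt n -> Prop),
    (forall i, (i <= e)%N -> [/\ zclosed (c i), irreducible (c i) & zsubset (c i) A]) /\
    (forall i, (i < e)%N -> zsubset (c i) (c i.+1) /\ ~ zsubset (c i.+1) (c i)).

Definition dim_eq {n} (A : pt n -> Prop) (d : nat) : Prop :=
  has_chain A d /\ forall e, has_chain A e -> (e <= d)%N.

(* isomorphism of k-algebras {mpoly k[n1]}/I1 ~= {mpoly k[n2]}/I2 (I1, I2 ideals),
   i.e. isomorphism of the affine schemes Spec of these quotients *)
Definition quot_iso {n1 n2} (I1 : {mpoly k[n1]} -> Prop) (I2 : {mpoly k[n2]} -> Prop) : Prop :=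
  exists (phi : n1.-tuple {mpoly k[n2]}) (psi : n2.-tuple {mpoly k[n1]}),
    [/\ forall p, I1 p -> I2 (p \mPo phi),
        forall q, I2 q -> I1 (q \mPo psi),
        forall p, I1 ((p \mPo phi) \mPo psi - p)
      & forall q, I2 ((q \mPo psi) \mPo phi - q)].

(* ideal of A^a x S_m' inside k[vars of R_m', u_1..u_a]:
   generated by the jet equations f^(0..m') of R_m', viewed in the bigger ring *)
Definition Iprod (a m' : nat) : {mpoly k[nv m' + a]} -> Prop :=
  in_ideal [seq f \mPo [tuple ('X_(lshift a i) : {mpoly k[nv m' + a]}) | i < nv m']
           | f <- fjets m'].

End Jets.

(* Main.v *)
(** In characteristic 2 the coefficients of a square are squares, so the even jet
equations read [x_i^2 = g_{2i}(y, z)] and determine the [x_i] up to Frobenius, while the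
odd ones [G_j(y, z) = 0] involve only [y] and [z].  Where [y_s] is the first nonzero
coefficient of [y], and [z] also vanishes below order [s], the equation [G_{j+s}] is
triangular in [z_{2j+1}]; this parametrizes a dense open subset of the second component
([s = 1]) and of the component over [y_1 = z_1 = 0] ([s = 2]).  The remaining two
components follow from the symmetry of the equation under permutations of [y], [z], [y + z].

The charts are dense for the following reason.  If [P] vanishes on all jets with
[y_0 z_0 (y_0 + z_0) <> 0], then some [y_0^N P^2] and [z_0^N P^2] lie in the ideal of the
[G_j].  At a jet where [P <> 0] this makes [y_0] and [z_0] locally nilpotent, and a suitable
slice through the jet then has it as an isolated zero of fewer equations than variables,
contrary to Krull's height theorem.  The latter is proved by counting: modulo a power of
the maximal ideal there would be too few products of monomials and equations.

A chain of irreducible closed sets of length [e] yields [e] algebraically independent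
functions, which bounds the dimension from above; coordinate flags of a parametrization
bound it from below. *)

Require Import Defs.
From HB Require Import structures.
From mathcomp Require Import all_boot all_order all_algebra.
From mathcomp Require Import mpoly.
From mathcomp Require Import zify ring.
From Stdlib Require Import Classical FunctionalExtensionality.
Set Implicit Arguments. Unset Strict Implicit. Unset Printing Implicit Defensive.
Import GRing.Theory.
Local Open Scope ring_scope.

(** Everything reduces to the cubic [y z (y + z)], whose homogeneity serves twice. In a chart,
    writing [y = h U], [z = h V] with [U_s = 1] allows the triangular system to be solved over the
    polynomial ring, without denominators. And a common factor [t ^ 2] of [y] and [z] comes out as
    [t ^ 6], which means three odd equations fewer: density is an induction on their number [q] with
    step 3. With weight 3 given to [x], the same shift identifies [I0] with the equations of order
    [m - 6]. Parametrizing by square roots [eta], [zeta] of [y], [z] makes the even equations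
    solvable by polynomials, [x_i = g_{2i}(eta, zeta)]. Each component is thus the closure of the
    image of an affine space, and no ideal has to be proved prime or radical. The hard component is
    that of [I0]: its ideal is not defined as a saturation, so every jet with
    [y_0 = y_1 = z_0 = z_1 = 0] must be shown to lie in the closure of the jets with [y_2 <> 0]. For
    the other components the saturation discards what lies outside the closure of the chart. *)

Definition is_ideal (R : comNzRingType) (I : R -> Prop) : Prop :=
  [/\ I 0, forall x y, I x -> I y -> I (x + y) & forall a x, I x -> I (a * x)].

(** * Ideals as predicates, and congruences modulo them *)

Section IdealTheory.
Variables (R : comNzRingType) (I : R -> Prop).
Hypothesis idI : is_ideal I.

Lemma ideal0 : I 0. Proof. by case: idI. Qed.
Lemma idealD x y : I x -> I y -> I (x + y). Proof. by case: idI => _ + _; apply. Qed.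
Lemma idealMl a x : I x -> I (a * x). Proof. by case: idI => _ _; apply. Qed.
Lemma idealMr a x : I x -> I (x * a). Proof. by rewrite mulrC; apply: idealMl. Qed.
Lemma idealN x : I x -> I (- x). Proof. by rewrite -mulN1r; apply: idealMl. Qed.
Lemma idealB x y : I x -> I y -> I (x - y).
Proof. by move=> Ix Iy; apply: idealD => //; apply: idealN. Qed.
Lemma idealX x n : I x -> I (x ^+ n.+1). Proof. by rewrite exprS; apply: idealMr. Qed.
Lemma ideal_sum (T : Type) (r : seq T) (P : pred T) (F : T -> R) :
  (forall i, P i -> I (F i)) -> I (\sum_(i <- r | P i) F i).
Proof. by move=> IF; apply: (big_ind I) => //; [apply: ideal0 | apply: idealD]. Qed.
Lemma idealBD x y : I (x - y) -> I y -> I x.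
Proof. by move=> Ixy Iy; rewrite -(subrK y x); apply: idealD. Qed.
Lemma idealDK x y : I (x + y) -> I y -> I x.
Proof. by move=> Ixy Iy; rewrite -(addrK y x); apply: idealB. Qed.
Lemma idealBC x y : I (x - y) -> I (y - x).
Proof. by rewrite -(opprB x y); apply: idealN. Qed.
Lemma ideal_congD x x' y y' : I (x - x') -> I (y - y') -> I (x + y - (x' + y')).
Proof. by move=> h1 h2; rewrite opprD addrACA; apply: idealD. Qed.
Lemma ideal_congM x x' y y' : I (x - x') -> I (y - y') -> I (x * y - x' * y').
Proof.
move=> h1 h2; have -> : x * y - x' * y' = x * (y - y') + (x - x') * y' by ring.
by apply: idealD; [apply: idealMl | apply: idealMr].
Qed.
Lemma ideal_congX x x' n : I (x - x') -> I (x ^+ n - x' ^+ n).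
Proof.
move=> h; elim: n => [|n IHn]; first by rewrite !expr0 subrr; apply: ideal0.
by rewrite !exprS; apply: ideal_congM.
Qed.

End IdealTheory.

Section InIdeal.
Variable k : fieldType.

Lemma in_ideal_is_ideal n (gs : seq {mpoly k[n]}) : is_ideal (in_ideal k gs).
Proof.
split.
- by exists (fun=> 0); rewrite big1 // => i _; rewrite mul0r.
- move=> x y [c ->] [c' ->]; exists (fun i => c i + c' i).
  by rewrite -big_split; apply: eq_bigr => i _; rewrite mulrDl.
- move=> a x [c ->]; exists (fun i => a * c i).
  by rewrite mulr_sumr; apply: eq_bigr => i _; rewrite mulrA.
Qed.

Lemma in_ideal_gen n (gs : seq {mpoly k[n]}) g : g \in gs -> in_ideal k gs g.
Proof.
move=> /[dup] gin; rewrite -index_mem => lt_g.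
exists (fun i => (i == Ordinal lt_g)%:R).
rewrite (bigD1 (Ordinal lt_g)) //= eqxx mul1r nth_index // big1 ?addr0 //.
by move=> i /negbTE ->; rewrite mul0r.
Qed.

Lemma in_ideal_min n (gs : seq {mpoly k[n]}) (I : {mpoly k[n]} -> Prop) :
  is_ideal I -> (forall g, g \in gs -> I g) -> forall p, in_ideal k gs p -> I p.
Proof.
move=> idI Igs p [c ->]; apply: ideal_sum => // i _.
by apply: idealMl => //; apply: Igs; apply: mem_nth.
Qed.

Lemma preim_ideal (A B : comNzRingType) (f : {rmorphism A -> B}) (I : B -> Prop) :
  is_ideal I -> is_ideal (fun x => I (f x)).
Proof.
move=> idI; split.
- by rewrite rmorph0; apply: ideal0.
- by move=> x y; rewrite rmorphD; apply: idealD.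
- by move=> a x; rewrite rmorphM; apply: idealMl.
Qed.

Lemma eq0_is_ideal (A : comNzRingType) : is_ideal (fun x : A => x = 0).
Proof. by split=> // [x y -> ->|a x ->]; rewrite ?addr0 ?mulr0. Qed.

Lemma in_ideal_eval n (gs : seq {mpoly k[n]}) (v : 'I_n -> k) :
  (forall g, g \in gs -> g.@[v] = 0) -> forall p, in_ideal k gs p -> p.@[v] = 0.
Proof.
apply: (@in_ideal_min _ _ (fun p => p.@[v] = 0)).
exact: (preim_ideal (meval v) (eq0_is_ideal k)).
Qed.

Lemma mpoly_subring_ind n (P : {mpoly k[n]} -> Prop) :
  (forall c, P c%:MP) -> (forall i, P 'X_i) ->
  (forall p q, P p -> P q -> P (p + q)) -> (forall p q, P p -> P q -> P (p * q)) ->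
  forall p, P p.
Proof.
move=> PC PX PD PM p; rewrite (mpolyE p).
apply: (big_ind P) => //; first by rewrite -(mpolyC0 n k).
move=> m _; rewrite -mul_mpolyC; apply: (PM) => //.
rewrite mpolyXE_id; apply: (big_ind P) => [||i _]; [by rewrite -(mpolyC1 n k) | exact: PM |].
elim: (m i) => [|e IHe]; first by rewrite expr0 -(mpolyC1 n k).
by rewrite exprS; apply: (PM).
Qed.

End InIdeal.

(** * Polynomials vanishing at every point over an algebraically closed field *)

Section Vanishing.

(** Euclid's argument: [p] takes the value 1 on [s], so its roots lie outside [s]. The factor ['X]
    keeps [p] nonconstant when [s] is empty. *)
Lemma closed_field_fresh (k : closedFieldType) (s : seq k) : exists x, x \notin s.
Proof.
pose p : {poly k} := \prod_(a <- s) ('X - a%:P) * 'X + 1.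
have /closed_rootP [x /rootP px] : size p != 1.
  rewrite size_polyDl size_mulX ?size_prod_XsubC // ?monic_neq0 ?monic_prod_XsubC //.
  by rewrite size_poly1.
exists x; apply/negP => xs.
have := px; rewrite /p !hornerE horner_prod (big_rem x) //= !hornerE subrr !mul0r add0r.
by move/eqP; rewrite oner_eq0.
Qed.

Lemma poly_vanish (k : closedFieldType) (p : {poly k}) : (forall x, p.[x] = 0) -> p = 0.
Proof.
move=> p0; apply/eqP/negPn/negP => p_neq0.
have fresh n : exists s : seq k, uniq s /\ size s = n.
  elim: n => [|n [s [us <-]]]; first by exists [::].
  have [x xs] := closed_field_fresh s; exists (x :: s) => /=; by rewrite xs.
have [s [us ss]] := fresh (size p).
have /(max_poly_roots p_neq0)/(_ us) : all (root p) s.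
  by apply/allP => x _; apply/rootP.
by rewrite ss ltnn.
Qed.

Lemma meval_muni (k : comNzRingType) n (p : {mpoly k[n.+1]}) (v : 'I_n.+1 -> k) :
  p.@[v] = (map_poly (meval (fun i => v (widen_ord (leqnSn n) i))) (muni p)).[v ord_max].
Proof.
rewrite mevalE muniE raddf_sum horner_sum; apply: eq_bigr => m _ /=.
rewrite map_polyZ map_polyXn !hornerE /= mevalZ mevalX -mulrA.
rewrite big_ord_recr /=; congr (_ * (_ * _)).
by apply: eq_bigr => i _; rewrite mnmE.
Qed.

Lemma muni_eq0 (k : fieldType) n (p : {mpoly k[n.+1]}) : muni p = 0 -> p = 0.
Proof.
move=> mp0; apply/mpolyP => m0; rewrite mcoeff0; apply/eqP/negPn/negP => pm0.
pose r (m : 'X_{1..n.+1}) := [multinom (m (widen_ord (leqnSn n) i)) | i < n].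
have : ((muni p)`_(m0 ord_max))@_(r m0) = 0 by rewrite mp0 coef0 mcoeff0.
rewrite muniE coef_sum raddf_sum (bigD1_seq m0) ?msupp_uniq ?mcoeff_msupp //=.
rewrite coefZ coefXn eqxx mulr1 mcoeffZ mcoeffX eqxx mulr1 big1 ?addr0.
  by move=> p0; rewrite p0 eqxx in pm0.
move=> m m_neq; rewrite coefZ coefXn; have [e|] := eqVneq; last by rewrite mulr0 mcoeff0.
rewrite mulr1 mcoeffZ mcoeffX; have [e'|] := eqVneq; last by rewrite mulr0.
case/eqP: m_neq; apply/mnmP => i; have [->//|i_neq] := eqVneq i ord_max.
have lt_i : (i < n)%N.
  by rewrite ltn_neqAle -ltnS ltn_ord andbT; apply: contraNneq i_neq => ei; apply/eqP/val_inj.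
have -> : i = widen_ord (leqnSn n) (Ordinal lt_i) by apply: val_inj.
by move/(congr1 (fun m : 'X_{1..n} => m (Ordinal lt_i))): e'; rewrite !mnmE.
Qed.

Lemma mpoly_vanish (k : closedFieldType) n (p : {mpoly k[n]}) :
  (forall v, p.@[v] = 0) -> p = 0.
Proof.
elim: n p => [|n IHn] p p0.
  have := p0 (fun=> 0); rewrite (nvar0_mpolyC p) mevalC => ->; exact: mpolyC0.
apply: muni_eq0; apply/polyP => j; rewrite coef0; apply: IHn => v.
set q := map_poly (meval v) (muni p).
have -> : ((muni p)`_j).@[v] = q`_j by rewrite coef_map.
suff -> : q = 0 by rewrite coef0.
apply: poly_vanish => x.
pose w (i : 'I_n.+1) := if unlift ord_max i is Some i' then v i' else x.
have := p0 w; rewrite meval_muni /w unlift_none.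
rewrite (_ : map_poly _ _ = q) //; apply: eq_map_poly => r; apply: meval_eq => i.
have -> : widen_ord (leqnSn n) i = lift ord_max i by apply: val_inj; rewrite /= /bump leqNgt ltn_ord.
by rewrite liftK.
Qed.

End Vanishing.

(** * Counting arguments: linear and algebraic dependence *)

Lemma linear_dependence (k : fieldType) (I J : finType) (F : I -> J -> k) :
  (#|J| < #|I|)%N ->
  exists u : I -> k, (exists i, u i != 0) /\ forall j, \sum_i u i * F i j = 0.
Proof.
move=> ltJI.
pose A : 'M[k]_(#|I|, #|J|) := \matrix_(i, j) F (enum_val i) (enum_val j).
have : kermx A != 0.
  rewrite kermx_eq0 /row_free; apply/eqP => rA.
  by have := rank_leq_col A; rewrite rA leqNgt ltJI.
case/rowV0Pn => v /sub_kermxP vA v_neq0.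
exists (fun i => v 0 (enum_rank i)); split.
  have [i vi] : exists i, v 0 i != 0.
    apply/existsP; rewrite -negb_forall; apply: contra v_neq0 => /forallP v0.
    by apply/eqP/rowP => i; rewrite mxE; apply/eqP/negPn; rewrite v0.
  by exists (enum_val i); rewrite enum_valK.
move=> j; have /rowP/(_ (enum_rank j)) := vA; rewrite !mxE => vAj; rewrite -[RHS]vAj.
rewrite (reindex (@enum_val I predT)) /=; last first.
  by exists enum_rank => x _; rewrite ?enum_valK ?enum_rankK.
apply: eq_big => [i|i _]; rewrite ?mxE ?enum_valK ?enum_rankK //.
Qed.

(** Monomials are counted in boxes rather than by total degree: a box has exactly [D ^ n] of them,
    so that both counting arguments come down to comparing powers. *)
Definition box_mnm n D (a : {ffun 'I_n -> 'I_D}) : 'X_{1..n} := [multinom (a i : nat) | i < n].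

Lemma box_mnm_inj n D : injective (@box_mnm n D).
Proof.
move=> a b /mnmP ab; apply/ffunP => i; apply: val_inj.
by have := ab i; rewrite !mnmE.
Qed.

Lemma box_mnmP n D (m : 'X_{1..n}) :
  (forall i, m i < D)%N -> exists a : {ffun 'I_n -> 'I_D}, m = box_mnm a.
Proof.
move=> ltm; exists [ffun i => Ordinal (ltm i)].
by apply/mnmP => i; rewrite mnmE ffunE.
Qed.

Lemma mnm_le_mdeg n (m : 'X_{1..n}) i : (m i <= mdeg m)%N.
Proof. by rewrite mdegE (bigD1 i) //= leq_addr. Qed.

Lemma mdeg_box n D (a : {ffun 'I_n -> 'I_D}) : (mdeg (box_mnm a) <= n * D.-1)%N.
Proof.
rewrite mdegE -[n in (n * _)%N]card_ord -sum_nat_const; apply: leq_sum => i _.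
by rewrite mnmE; case: (a i) => j /=; case: D {a} => // D; rewrite ltnS.
Qed.

Lemma mcoeff_box_sum (k : fieldType) n D (u : {ffun 'I_n -> 'I_D} -> k) a :
  (\sum_b u b *: 'X_[box_mnm b])@_(box_mnm a) = u a.
Proof.
rewrite raddf_sum (bigD1 a) //= mcoeffZ mcoeffX eqxx mulr1 big1 ?addr0 // => b b_neq.
by rewrite mcoeffZ mcoeffX (inj_eq (@box_mnm_inj n D)) (negbTE b_neq) mulr0.
Qed.

Section AlgebraicDependence.
Variable k : fieldType.

Lemma msizeM_leD n (p q : {mpoly k[n]}) a b :
  (msize p <= a.+1)%N -> (msize q <= b.+1)%N -> (msize (p * q) <= (a + b).+1)%N.
Proof.
have [->|p0] := eqVneq p 0; first by rewrite mul0r msize0.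
have [->|q0] := eqVneq q 0; first by rewrite mulr0 msize0.
by rewrite msizeM //; move: (msize p) (msize q) => x y; lia.
Qed.

Lemma msize_prodX n e (f : 'I_e -> {mpoly k[n]}) c (a : 'I_e -> nat) :
  (forall i, msize (f i) <= c.+1)%N ->
  (msize (\prod_i f i ^+ a i) <= (\sum_i a i * c).+1)%N.
Proof.
move=> fc; elim/big_rec2: _ => [|i s p _ ps]; first by rewrite msize1.
apply: msizeM_leD => //; elim: (a i) => [|b IHb]; first by rewrite expr0 msize1.
by rewrite exprS mulSn; apply: msizeM_leD.
Qed.

Lemma algebraic_dependence d e (f : 'I_e -> {mpoly k[d]}) : (d < e)%N ->
  exists Q : {mpoly k[e]}, Q != 0 /\ Q \mPo [tuple f i | i < e] = 0.
Proof.
move=> ltde; pose c := (\max_i msize (f i))%N.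
have fc i : (msize (f i) <= c.+1)%N by apply: leqW; apply: leq_bigmax.
(* The [D ^ e] products [F a] have degree below [B], and [B <= D * (e * c + 1)]. As [D] exceeds
   [(e * c + 1) ^ d], this gives [B ^ d < D ^ (d + 1) <= D ^ e]: more products than monomials that
   can occur in them. *)
pose D := (((e * c).+1 ^ d).+1)%N; pose B := (e * (D * c)).+1.
pose F (a : {ffun 'I_e -> 'I_D}) : {mpoly k[d]} := \prod_i f i ^+ a i.
have ltBD : (B ^ d < D ^ e)%N.
  have leB : (B <= D * (e * c).+1)%N.
    by rewrite /B mulnS mulnCA -add1n leq_add2r.
  apply: leq_ltn_trans (_ : (D * (e * c).+1) ^ d < _)%N; first by case: (d) => // ?; rewrite leq_exp2r.
  apply: leq_trans (_ : D ^ d.+1 <= _)%N; last by rewrite leq_exp2l // /D ltnS expn_gt0.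
  by rewrite expnMn expnS mulnC ltn_mul2r expn_gt0 /= /D ltnS leqnn.
have Fdeg a m : (B <= mdeg m)%N -> (F a)@_m = 0.
  move=> leBm; apply: memN_msupp_eq0; apply: msize_mdeg_ge; apply: leq_trans leBm.
  apply: leq_trans (msize_prodX _ fc) _; rewrite ltnS.
  rewrite -[e in (e * _)%N]card_ord -sum_nat_const; apply: leq_sum => i _.
  by rewrite leq_mul2r ltnW ?orbT.
have [u [[a0 ua0] uF]] : exists u : {ffun 'I_e -> 'I_D} -> k, (exists a, u a != 0) /\
    forall b : {ffun 'I_d -> 'I_B}, \sum_a u a * (F a)@_(box_mnm b) = 0.
  by apply: linear_dependence; rewrite !card_ffun !card_ord.
exists (\sum_a u a *: 'X_[box_mnm a]); split.
  apply/eqP => /(congr1 (mcoeff (box_mnm a0))); rewrite mcoeff_box_sum mcoeff0.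
  by move/eqP; rewrite (negbTE ua0).
have -> : (\sum_a u a *: 'X_[box_mnm a]) \mPo [tuple f i | i < e] = \sum_a u a *: F a.
  rewrite raddf_sum; apply: eq_bigr => a _ /=.
  rewrite comp_mpolyZ comp_mpolyX; congr (_ *: _).
  by apply: eq_bigr => i _; rewrite tnth_mktuple mnmE.
apply/mpolyP => m; rewrite mcoeff0 raddf_sum /=.
under eq_bigr do rewrite mcoeffZ.
have [/forallP ltm|] := boolP [forall i, m i < B]%N.
  by have [b ->] := box_mnmP ltm; apply: uF.
rewrite negb_forall => /existsP [i]; rewrite -leqNgt => leBm.
by rewrite big1 // => a _; rewrite Fdeg ?mulr0 // (leq_trans leBm) ?mnm_le_mdeg.
Qed.

End AlgebraicDependence.

(** * Krull's height theorem at a point *)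

Section LocalParameters.
Variable k : fieldType.

(** This is membership in the [D]-th power of the maximal ideal at the origin. *)
Definition order_ge n D (p : {mpoly k[n]}) : Prop := forall m, (mdeg m < D)%N -> p@_m = 0.

Lemma order_geM n a b (p q : {mpoly k[n]}) :
  order_ge a p -> order_ge b q -> order_ge (a + b) (p * q).
Proof.
move=> pa qb m ltm; rewrite mcoeffM big1 // => -[m1 m2] /= /eqP em.
have [lt1|le1] := ltnP (mdeg m1) a; first by rewrite pa ?mul0r.
rewrite (qb m2) ?mulr0 //; move/(congr1 (@mdeg n)): em; rewrite mdegD; lia.
Qed.

Lemma order_ge_ideal n D : is_ideal (@order_ge n D).
Proof.
split=> [m _|p q p0 q0 m ltm|a p p0]; first by rewrite mcoeff0.
  by rewrite mcoeffD p0 // q0 // addr0.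
by rewrite -[D]add0n; apply: order_geM.
Qed.

Lemma order_geX n a (p : {mpoly k[n]}) e : order_ge a p -> order_ge (a * e) (p ^+ e).
Proof.
move=> pa; elim: e => [|e IHe]; first by rewrite muln0.
by rewrite mulnS exprS; apply: order_geM.
Qed.

Lemma order_ge_prod n r (g : 'I_r -> {mpoly k[n]}) (m : 'X_{1..r}) :
  (forall j, order_ge 1 (g j)) -> order_ge (mdeg m) (\prod_j g j ^+ m j).
Proof.
move=> g1; rewrite mdegE; elim/big_rec2: _ => // j s p _ ps.
by apply: order_geM => //; have := order_geX (e := m j) (g1 j); rewrite mul1n.
Qed.

Lemma order_ge1 n (p : {mpoly k[n]}) : p@_0 = 0 -> order_ge 1 p.
Proof. by move=> p0 m; rewrite ltnS leqn0 mdeg_eq0 => /eqP ->. Qed.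

(** Truncated geometric series. Units of the local ring at the origin become invertible modulo each
    power of the maximal ideal, so the local ring itself need not be constructed. *)
Lemma order_ge_inv n (U : {mpoly k[n]}) D : U@_0 != 0 ->
  exists V, order_ge D (V * U - 1).
Proof.
move=> U0; pose w := 1 - (U@_0)^-1 *: U.
have w1 : order_ge 1 w by apply: order_ge1; rewrite mcoeffB mcoeffZ mcoeff1 eqxx mulVf ?subrr.
exists ((\sum_(i < D) w ^+ i) * ((U@_0)^-1)%:MP).
rewrite -mulrA mul_mpolyC (_ : _ *: U = 1 - w); last by rewrite /w opprB addrC subrK.
have -> : (\sum_(i < D) w ^+ i) * (1 - w) - 1 = - w ^+ D.
  by rewrite mulrC -(opprB w 1) mulNr -subrX1 opprB addrC addKr.
apply: (idealN (order_ge_ideal n D)); rewrite -[D in order_ge D]mul1n; exact: order_geX.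
Qed.

(* If the maximal ideal at the origin were nilpotent modulo fewer than [n] of its
   elements [g], then [k[x]/m^D] would be spanned by the products [x^a g^b] with [a]
   bounded and [b < D], which are too few when [D] is large. *)
Lemma origin_not_isolated n r (g : 'I_r -> {mpoly k[n]}) : (r < n)%N ->
  (forall j, (g j)@_0 = 0) ->
  (forall i : 'I_n, exists e U (c : 'I_r -> {mpoly k[n]}),
     U@_0 != 0 /\ U * 'X_i ^+ e = \sum_j c j * g j) -> False.
Proof.
move=> ltrn g0 nilp.
have g1 j : order_ge 1 (g j) by apply: order_ge1.
have [e0 /= he0] := fin_all_exists nilp.
pose e := (\max_i e0 i)%N.
(* A common exponent [e] for all variables, the unit [U] being inverted modulo the [D]-th power. *)
have nilD D i : exists c : 'I_r -> {mpoly k[n]}, order_ge D ('X_i ^+ e - \sum_j c j * g j).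
  have [U [c [U0 Uc]]] := he0 i; have [V VU] := order_ge_inv D U0.
  exists (fun j => 'X_i ^+ (e - e0 i) * V * c j).
  have -> : \sum_j 'X_i ^+ (e - e0 i) * V * c j * g j = 'X_i ^+ e * (V * U).
    under eq_bigr do rewrite -mulrA.
    rewrite -mulr_sumr -Uc; have {2}-> : e = (e - e0 i + e0 i)%N by rewrite subnK // leq_bigmax.
    by rewrite exprD; ring.
  rewrite -{1}(mulr1 ('X_i ^+ e)) -mulrBr -opprB mulrN.
  by apply: (idealN (order_ge_ideal n D)); apply: (idealMl (order_ge_ideal n D)).
pose S D (p : {mpoly k[n]}) := exists K : {ffun 'I_n -> 'I_e} -> {ffun 'I_r -> 'I_D} -> k,
  order_ge D (p - \sum_a \sum_b K a b *: ('X_[box_mnm a] * \prod_j g j ^+ b j)).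
have SD D p q : S D p -> S D q -> S D (p + q).
  move=> [K pK] [K' qK]; exists (fun a b => K a b + K' a b).
  under eq_bigr do (under eq_bigr do rewrite scalerDl; rewrite big_split /=).
  by rewrite big_split /=; apply: (ideal_congD (order_ge_ideal n D)).
have SZ D c p : S D p -> S D (c *: p).
  move=> [K pK]; exists (fun a b => c * K a b).
  have -> : \sum_a \sum_b (c * K a b) *: ('X_[box_mnm a] * \prod_j g j ^+ b j)
    = c *: \sum_a \sum_b K a b *: ('X_[box_mnm a] * \prod_j g j ^+ b j).
    rewrite scaler_sumr; apply: eq_bigr => a _; rewrite scaler_sumr.
    by apply: eq_bigr => b _; rewrite scalerA.
  by rewrite -scalerBr -mul_mpolyC; apply: (idealMl (order_ge_ideal n D)).
have S0 D p : order_ge D p -> S D p.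
  move=> p0; exists (fun _ _ => 0); rewrite big1 ?subr0 // => a _.
  by rewrite big1 // => b _; rewrite scale0r.
have Ssum D (T : Type) (s : seq T) (F : T -> {mpoly k[n]}) :
    (forall i, S D (F i)) -> S D (\sum_(i <- s) F i).
  move=> SF; apply: (big_ind (S D)) => //; last by move=> ? ?; apply: (SD).
  by apply: (S0); apply: (ideal0 (order_ge_ideal n D)).
(* Here [s] bounds the degree in [g] still missing. At degree [D] in [g] the product is negligible;
   below it, a factor ['X_i ^+ e] of a monomial is traded for one more factor [g j]. *)
have span D s (m : 'X_{1..r}) p : (D <= mdeg m + s)%N -> S D (\prod_j g j ^+ m j * p).
  elim: s m p => [|s IHs] m p ltD.
    apply: (S0); apply: (idealMr (order_ge_ideal n D)) => m' ltm'.
    by apply: (order_ge_prod g1); apply: leq_trans ltm' _; rewrite addn0 in ltD.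
  rewrite (mpolyE p) mulr_sumr; apply: (Ssum) => mu; rewrite -scalerAr; apply: (SZ).
  have [leDm|ltmD] := leqP D (mdeg m).
    by apply: (IHs); rewrite (leq_trans leDm) ?leq_addr.
  have [/forallP ltmu|] := boolP [forall i, mu i < e]%N.
    have [a ->] := box_mnmP ltmu.
    have [b ->] : exists b : {ffun 'I_r -> 'I_D}, m = box_mnm b.
      by apply: box_mnmP => j; apply: leq_ltn_trans ltmD; apply: mnm_le_mdeg.
    exists (fun a' b' => ((a' == a) && (b' == b))%:R).
    rewrite (bigD1 a) //= [X in _ - (_ + X)]big1 ?addr0; last first.
      by move=> a' /negbTE ->; rewrite big1 // => b' _; rewrite scale0r.
    rewrite (bigD1 b) //= [X in _ - (_ + X)]big1 ?addr0; last first.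
      by move=> b' /negbTE ->; rewrite andbF scale0r.
    rewrite !eqxx scale1r mulrC.
    under eq_bigr do rewrite mnmE.
    by rewrite subrr; apply: (ideal0 (order_ge_ideal n D)).
  rewrite negb_forall => /existsP [i]; rewrite -leqNgt => leemu.
  have [c hc] := nilD D i.
  have emu : 'X_[mu] = 'X_i ^+ e * 'X_[mu - U_(i) *+ e] :> {mpoly k[n]}.
    rewrite mpolyXn -mpolyXD addmC submK //; apply/mnm_lepP => j.
    by rewrite mulmnE mnm1E; case: eqP => [<-|]; rewrite ?mul1n.
  set mu' := (mu - _)%MM in emu; set G := \prod_j _.
  rewrite emu (_ : G * _ = G * 'X_[mu'] * ('X_i ^+ e - \sum_j c j * g j)
     + \sum_j \prod_l g l ^+ (m + U_(j))%MM l * (c j * 'X_[mu'])); last first.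
    rewrite mulrBr [X in _ - X + _](_ : _ =
       \sum_j \prod_l g l ^+ (m + U_(j))%MM l * (c j * 'X_[mu'])) ?subrK; first by ring.
    rewrite mulr_sumr; apply: eq_bigr => j _.
    have -> : \prod_l g l ^+ (m + U_(j))%MM l = G * g j.
      under eq_bigr do rewrite mnmDE exprD; rewrite big_split /=; congr (_ * _).
      rewrite (bigD1 j) //= mnm1E eqxx expr1 big1 ?mulr1 // => l l_neq.
      by rewrite mnm1E eq_sym (negbTE l_neq).
    by ring.
  apply: (SD); first by apply: (S0); apply: (idealMl (order_ge_ideal n D)).
  by apply: (Ssum) => j; apply: (IHs); rewrite mdegD mdeg1 addn1 addSn -addnS.
(* There are [e ^ n * D ^ r = e ^ n * n ^ r * D' ^ r < D' ^ (r + 1) <= D' ^ n] spanning products,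
   fewer than the monomials with exponents below [D']. These monomials have degree at most
   [n * (D' - 1) < D], so no nontrivial combination of them is negligible. *)
pose D' := (e ^ n * n ^ r).+1; pose D := (n * D')%N.
have D_gt0 : (0 < D)%N by rewrite muln_gt0 (leq_ltn_trans _ ltrn).
have Sall (a : {ffun 'I_n -> 'I_D'}) : S D 'X_[box_mnm a].
  have := @span D D 0%MM 'X_[box_mnm a]; rewrite mdeg0 add0n => /(_ (leqnn _)).
  by rewrite big1 ?mul1r // => j _; rewrite mnm0E.
have [K /= hK] := fin_all_exists Sall.
have [u [[a0 ua0] uK]] : exists u : {ffun 'I_n -> 'I_D'} -> k, (exists a, u a != 0) /\
    forall ab : {ffun 'I_n -> 'I_e} * {ffun 'I_r -> 'I_D}, \sum_a u a * K a ab.1 ab.2 = 0.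
  apply: linear_dependence; rewrite card_prod !card_ffun !card_ord.
  rewrite /D expnMn mulnA; apply: leq_trans (_ : D' ^ r.+1 <= _)%N; last by rewrite leq_pexp2l.
  by rewrite expnS ltn_mul2r expn_gt0 /= /D' ltnS leqnn.
have : order_ge D (\sum_a u a *: 'X_[box_mnm a]).
  have -> : \sum_a u a *: 'X_[box_mnm a] = \sum_a u a *: ('X_[box_mnm a] -
     \sum_a' \sum_b K a a' b *: ('X_[box_mnm a'] * \prod_j g j ^+ b j)).
    under [RHS]eq_bigr do rewrite scalerBr scaler_sumr.
    rewrite sumrB [X in _ - X](_ : _ = 0) ?subr0 //.
    rewrite exchange_big big1 //= => a' _; under eq_bigr do rewrite scaler_sumr.
    rewrite exchange_big big1 //= => b _; under eq_bigr do rewrite scalerA.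
    by rewrite -scaler_suml (uK (a', b)) scale0r.
  apply: (ideal_sum (order_ge_ideal n D)) => a _; rewrite -mul_mpolyC.
  by apply: (idealMl (order_ge_ideal n D)); apply: hK.
move/(_ (box_mnm a0)); rewrite mcoeff_box_sum => ua00.
case/eqP: ua0; apply: ua00; apply: leq_ltn_trans (mdeg_box _) _.
by rewrite /D ltn_mul2l (leq_ltn_trans (leq0n r) ltrn) /D' /= leqnn.
Qed.

End LocalParameters.

Section LocalRadical.
Variables (k : fieldType) (n : nat) (v : 'I_n -> k) (I : {mpoly k[n]} -> Prop).
Hypothesis idI : is_ideal I.

(* The radical of the extension of [I] to the local ring at [v]. *)
Definition local_radical (p : {mpoly k[n]}) : Prop :=
  exists e U, U.@[v] != 0 /\ I (U * p ^+ e).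

Lemma local_radical_ideal : is_ideal local_radical.
Proof.
split.
- by exists 1%N, 1; rewrite meval1 oner_neq0 expr1 mulr0; split=> //; apply: ideal0.
- move=> p q [a [U [U0 hU]]] [b [V [V0 hV]]]; exists (a + b)%N, (U * V).
  split; first by rewrite mevalM mulf_neq0.
  rewrite exprDn mulr_sumr; apply: ideal_sum => // i _.
  rewrite -mulrnAr; have [leb|ltb] := leqP b i.
    have -> : U * V * (p ^+ (a + b - i) * (q ^+ i *+ 'C(a + b, i)))
      = U * p ^+ (a + b - i) * (q ^+ (i - b)) *+ 'C(a + b, i) * (V * q ^+ b).
      have -> : q ^+ i = q ^+ (i - b) * q ^+ b by rewrite -exprD subnK.
      by rewrite !mulrnAr !mulrnAl; congr (_ *+ _); ring.
    exact: idealMl.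
  have lea : (a <= a + b - i)%N by lia.
  have -> : U * V * (p ^+ (a + b - i) * (q ^+ i *+ 'C(a + b, i)))
    = V * p ^+ (a + b - i - a) * (q ^+ i *+ 'C(a + b, i)) * (U * p ^+ a).
    have -> : p ^+ (a + b - i) = p ^+ (a + b - i - a) * p ^+ a by rewrite -exprD subnK.
    by ring.
  exact: idealMl.
- move=> a p [e [U [U0 hU]]]; exists e, U; split=> //.
  by rewrite exprMn mulrCA; apply: idealMl.
Qed.

Lemma local_radical_sub p : I p -> local_radical p.
Proof. by move=> Ip; exists 1%N, 1; rewrite meval1 oner_neq0 expr1 mul1r. Qed.

Lemma local_radicalX p e : local_radical (p ^+ e) -> local_radical p.
Proof. by move=> [a [U [U0 hU]]]; exists (e * a)%N, U; rewrite exprM. Qed.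

Lemma local_radicalM U p : U.@[v] != 0 -> local_radical (U * p) -> local_radical p.
Proof.
move=> U0 [a [V [V0 hV]]]; exists a, (V * U ^+ a); split.
  by rewrite mevalM rmorphXn mulf_neq0 ?expf_neq0.
by rewrite -mulrA -exprMn.
Qed.

End LocalRadical.

Lemma mcoeff0_meval (k : fieldType) n (p : {mpoly k[n]}) : p@_0 = p.@[fun=> 0].
Proof.
elim/mpoly_subring_ind: p => [c|i|p q hp hq|p q hp hq].
- by rewrite mevalC mcoeffC eqxx mulr1.
- by rewrite mevalXU mcoeffX mnm1_eq0.
- by rewrite mevalD mcoeffD hp hq.
- by rewrite mevalM -hp -hq; apply: (rmorphM (mcoeff 0%MM)).
Qed.

(* The nonisolation form of Krull's height theorem. *)
Lemma zero_not_isolated (k : fieldType) n (v : 'I_n -> k) (gs : seq {mpoly k[n]})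
    (S : {set 'I_n}) :
  (size gs < #|S|)%N -> (forall g, g \in gs -> g.@[v] = 0) ->
  (forall i, i \in S -> local_radical v
     (in_ideal k (gs ++ [seq 'X_j - (v j)%:MP | j <- enum (~: S)])) ('X_i - (v i)%:MP)) ->
  False.
Proof.
set G := gs ++ _ => ltS gs0 nilS.
(* Fixing a coordinate outside [S] costs one equation each, so the total stays below [n]. *)
have ltGn : (size G < n)%N.
  rewrite /G size_cat size_map -cardE -[X in (_ < X)%N](card_ord n) -(cardsC S).
  by rewrite ltn_add2r.
pose tau := [tuple 'X_i + (v i)%:MP_[n] | i < n].
have tauE p : (p \mPo tau).@[fun=> 0] = p.@[v].
  rewrite comp_mpoly_meval; apply: meval_eq => i.
  by rewrite tnth_mktuple mevalD mevalXU mevalC add0r.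
have G0 g : g \in G -> g.@[v] = 0.
  rewrite mem_cat => /orP[/gs0 //|/mapP [j _ ->]].
  by rewrite mevalB mevalXU mevalC subrr.
apply: (@origin_not_isolated k n (size G) (fun j => G`_j \mPo tau) ltGn).
  by move=> j; rewrite mcoeff0_meval tauE G0 // mem_nth.
move=> i.
have [e [U [U0 [c Uc]]]] : local_radical v (in_ideal k G) ('X_i - (v i)%:MP).
  have [/nilS //|iS] := boolP (i \in S).
  apply: local_radical_sub; apply: in_ideal_gen.
  by rewrite mem_cat; apply/orP; right; apply/mapP; exists i; rewrite // mem_enum inE.
exists e, (U \mPo tau), (fun j => c j \mPo tau); split.
  by rewrite mcoeff0_meval tauE.
have := congr1 (comp_mpoly tau) Uc; rewrite rmorphM rmorphXn rmorphB /= comp_mpolyC.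
rewrite comp_mpolyXU -tnth_nth tnth_mktuple addrK => ->.
by rewrite raddf_sum; apply: eq_bigr => j _; apply: rmorphM.
Qed.

(** * Irreducibility and dimension of closures of images *)

Section Dimension.
Variable k : closedFieldType.

Lemma irreducible_prime n (A : pt k n -> Prop) (P Q : {mpoly k[n]}) :
  irreducible k A -> (forall v, A v -> (P * Q).@[v] = 0) ->
  (forall v, A v -> P.@[v] = 0) \/ (forall v, A v -> Q.@[v] = 0).
Proof.
move=> [_ irrA] PQ.
have closed1 R : zclosed k (fun v : pt k n => R.@[v] = 0).
  by exists (fun p => p = R) => v; split=> [Rv p ->|]; [|apply].
apply: irrA => // v /PQ; rewrite mevalM => /eqP; rewrite mulf_eq0.
by case/orP => /eqP; [left|right].
Qed.

(* A polynomial vanishing on [c i] but not on [c i.+1] for each [i] yields an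
   algebraically independent family: in a relation, divide by the largest power of the
   last function and restrict to the previous member of the chain. *)
Lemma chain_independent n (A : pt k n -> Prop) e : has_chain k A e ->
  exists f : nat -> {mpoly k[n]}, forall Q : {mpoly k[e]},
    (forall v, A v -> Q.@[fun i => (f i).@[v]] = 0) -> Q = 0.
Proof.
move=> [c [hc hs]].
(* Independence is proved on the top member of the chain rather than on [A]: the induction step
   restricts a relation from [c e.+1] to [c e]. *)
suff [f hf] : exists f : nat -> {mpoly k[n]}, forall Q : {mpoly k[e]},
    (forall v, c e v -> Q.@[fun i => (f i).@[v]] = 0) -> Q = 0.
  exists f => Q QA; apply: hf => v cv; apply: QA.
  by have [_ _] := hc e (leqnn e); apply.
elim: e hc hs => [|e IHe] hc hs.
  exists (fun=> 0) => Q Q0; have [_ [[v cv] _] _] := hc 0%N isT.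
  by have := Q0 v cv; rewrite (nvar0_mpolyC Q) mevalC => ->; apply: mpolyC0.
have [||f hf] := IHe; [by move=> i ?; apply: hc; lia|by move=> i ?; apply: hs; lia|].
have [sub_c nsub_c] := hs e (ltnSn e).
have [_ irr_c _] := hc e.+1 (leqnn _); have [[T cT] _ _] := hc e (leqnSn _).
have [h [h0 h1]] : exists h : {mpoly k[n]},
    (forall v, c e v -> h.@[v] = 0) /\ exists2 v, c e.+1 v & h.@[v] != 0.
  apply: NNPP => nh; apply: nsub_c => v cv; apply/cT => p Tp.
  apply/eqP/negPn/negP => pv; apply: nh; exists p; split; last by exists v.
  by move=> w /cT; apply.
exists (fun i => if (i < e)%N then f i else h) => Q Q0.
apply: muni_eq0; apply/eqP/negPn/negP => mQ0.
have ext_w (w : pt k n) (R : {mpoly k[e]}) :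
    R.@[fun i => (if (widen_ord (leqnSn e) i < e)%N then f (widen_ord (leqnSn e) i) else h).@[w]]
    = (R \mPo [tuple f i | i < e]).@[w].
  by rewrite comp_mpoly_meval; apply: meval_eq => i; rewrite tnth_mktuple /= ltn_ord.
have [a [q [q0 Qq]]] : exists a (q : {poly {mpoly k[e]}}), q`_0 != 0 /\ muni Q = q * 'X^a.
  have [a [q q0 Qq]] := multiplicity_XsubC (muni Q) 0; exists a, q.
  by move: q0 Qq; rewrite mQ0 /= -horner_coef0 subr0.
pose R2 : {mpoly k[n]} := (map_poly (comp_mpoly [tuple f i | i < e]) q).[h].
have evalQ v : Q.@[fun i : 'I_e.+1 => (if (i < e)%N then f i else h).@[v]] = (R2 * h ^+ a).@[v].
  rewrite meval_muni Qq rmorphM /= map_polyXn hornerM hornerXn ltnn mevalM rmorphXn.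
  congr (_ * _); rewrite /R2 -horner_map -map_poly_comp /=; congr (_.[_]).
  by apply: eq_map_poly => R; rewrite /= -ext_w.
have [R20|ha0] : (forall v, c e.+1 v -> R2.@[v] = 0) \/ (forall v, c e.+1 v -> (h ^+ a).@[v] = 0).
  by apply: irreducible_prime => // v cv; rewrite -evalQ Q0.
  case/eqP: q0; apply: hf => v cv; rewrite -[RHS](R20 v (sub_c v cv)) /R2 -horner_map /= h0 //.
  rewrite horner_coef0 -map_poly_comp coef_map /= comp_mpoly_meval.
  by apply: meval_eq => i; rewrite tnth_mktuple.
have [v cv hv] := h1; have := ha0 v cv; rewrite rmorphXn /= => /eqP.
by rewrite expf_eq0 (negbTE hv) andbF.
Qed.

Definition image_closure n d (phi : 'I_n -> {mpoly k[d]}) (v : pt k n) : Prop :=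
  forall P : {mpoly k[n]}, (forall u, P.@[fun i => (phi i).@[u]] = 0) -> P.@[v] = 0.

Lemma image_closure_point n d (phi : 'I_n -> {mpoly k[d]}) u :
  image_closure phi (fun i => (phi i).@[u]).
Proof. by move=> P; apply. Qed.

Lemma image_closure_zclosed n d (phi : 'I_n -> {mpoly k[d]}) : zclosed k (image_closure phi).
Proof. by exists (fun P => forall u, P.@[fun i => (phi i).@[u]] = 0). Qed.

(** Equations that fail somewhere on the image pull back to nonzero polynomials in [d] variables;
    their product is nonzero, hence nonzero at some point, which lies in neither closed set. *)
Lemma image_closure_irreducible n d (phi : 'I_n -> {mpoly k[d]}) :
  irreducible k (image_closure phi).
Proof.
split; first by exists (fun i => (phi i).@[fun=> 0]); apply: image_closure_point.
move=> B C [TB hB] [TC hC] sub; apply: NNPP => /not_or_and [nB nC].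
have key T : ~ (forall v, image_closure phi v -> zeroset k T v) ->
    exists2 P, T P & P \mPo [tuple phi i | i < n] != 0.
  move=> nT; apply: NNPP => nP; apply: nT => v cv P TP; apply: cv => u.
  apply/eqP/negPn/negP => Pu; apply: nP; exists P => //; apply: contraNneq Pu => P0.
  have := congr1 (meval u) P0; rewrite comp_mpoly_meval meval0 => <-.
  by apply/eqP; apply: meval_eq => i; rewrite tnth_mktuple.
have [P TP P0] : exists2 P, TB P & P \mPo [tuple phi i | i < n] != 0.
  by apply: key => h; apply: nB => v /h /hB.
have [Q TQ Q0] : exists2 P, TC P & P \mPo [tuple phi i | i < n] != 0.
  by apply: key => h; apply: nC => v /h /hC.
have := mulf_neq0 P0 Q0; rewrite -rmorphM => /eqP; apply; apply: mpoly_vanish => u.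
rewrite comp_mpoly_meval (meval_eq (v2 := fun i => (phi i).@[u])); last first.
  by move=> i; rewrite tnth_mktuple.
rewrite mevalM; have [/hB h|/hC h] := sub _ (@image_closure_point n d phi u).
  by rewrite (h P TP) mul0r.
by rewrite (h Q TQ) mulr0.
Qed.

(** The test functions [p] make the coordinate flag strict after taking closures of images: [p i]
    vanishes on the image of the [i]-th subspace but not on that of the next one. For the upper
    bound, more than [d] functions on the image pull back to dependent polynomials. *)
Lemma image_closure_dim n d (phi : 'I_n -> {mpoly k[d]}) (p : 'I_d -> {mpoly k[n]}) :
  (forall (i : 'I_d) u, (forall j : 'I_d, (i <= j)%N -> u j = 0) -> (p i).@[fun l => (phi l).@[u]] = 0) ->
  (forall i : 'I_d, exists2 u, (forall j : 'I_d, (i < j)%N -> u j = 0) &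
     (p i).@[fun l => (phi l).@[u]] != 0) ->
  dim_eq k (image_closure phi) d.
Proof.
move=> p0 p1; pose tr i (u : 'I_d -> k) (l : 'I_d) := if (l < i)%N then u l else 0.
pose phi_ i l := phi l \mPo [tuple if (j < i)%N then 'X_j else 0 | j < d].
have phi_E i u l : (phi_ i l).@[u] = (phi l).@[tr i u].
  rewrite comp_mpoly_meval; apply: meval_eq => j; rewrite tnth_mktuple /tr.
  by case: ifP; rewrite ?mevalXU ?meval0.
have evE (P : {mpoly k[n]}) i u :
    P.@[fun l => (phi_ i l).@[u]] = P.@[fun l => (phi l).@[tr i u]].
  by apply: meval_eq => l; rewrite phi_E.
split.
  exists (fun i => image_closure (phi_ i)); split=> [i _|i lti]; split.
  - exact: image_closure_zclosed.
  - exact: image_closure_irreducible.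
  - by move=> v cv P P0; apply: cv => u; rewrite evE.
  - move=> v cv P P0; apply: cv => u; rewrite evE -(P0 (tr i u)) evE.
    apply: meval_eq => l; apply: meval_eq => j; rewrite /tr.
    by case: (ltnP j i) => lt_ji; [rewrite ltnS (ltnW lt_ji) | rewrite if_same].
  - move=> sub; have [u u0 pu] := p1 (Ordinal lti).
    have /sub := @image_closure_point n d (phi_ i.+1) u.
    move/(_ (p (Ordinal lti))) => h; case/eqP: pu.
    rewrite -[RHS]h => [|w].
      apply: meval_eq => l; rewrite phi_E; apply: meval_eq => j; rewrite /tr.
      by rewrite ltnS; case: leqP => // /u0.
    by rewrite evE; apply: p0 => j /= leij; rewrite /tr ltnNge leij.
move=> e /chain_independent [f hf]; rewrite leqNgt; apply/negP => ltde.
pose g (i : 'I_e) := f i \mPo [tuple phi l | l < n].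
have [Q [Q0 Qg]] := algebraic_dependence g ltde.
case/eqP: Q0; apply: hf => v cv.
have := cv (Q \mPo [tuple f i | i < e]).
rewrite comp_mpoly_meval (meval_eq (v2 := fun i => (f i).@[v])); last first.
  by move=> i; rewrite tnth_mktuple.
apply=> u; have := congr1 (meval u) Qg; rewrite !comp_mpoly_meval meval0 => <-.
apply: meval_eq => i; rewrite !tnth_mktuple comp_mpoly_meval; apply: meval_eq => l.
by rewrite tnth_mktuple.
Qed.

(** A form suited to charts, where some of the ambient variables act as parameters and the others
    are set to 0. As [h] comes first in the flag, it can be taken nonzero in every subspace past the
    origin; this is why the test functions need only be nonzero where [w h != 0]. *)
Lemma parametrized_dim n N (s : seq 'I_N) (h : 'I_N) (psi : 'I_n -> {mpoly k[N]})
    (p : 'I_N -> {mpoly k[n]}) (A : pt k n -> Prop) :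
  uniq (h :: s) ->
  (forall v, A v <-> forall P : {mpoly k[n]},
     (forall w, (forall i, i \notin h :: s -> w i = 0) ->
        P.@[fun i => (psi i).@[w]] = 0) -> P.@[v] = 0) ->
  (forall i w, i \in h :: s -> w i = 0 -> (p i).@[fun l => (psi l).@[w]] = 0) ->
  (forall i w, i \in h :: s -> w i != 0 -> w h != 0 -> (p i).@[fun l => (psi l).@[w]] != 0) ->
  irreducible k A /\ dim_eq k A (size s).+1.
Proof.
move=> uS hA p0 p1; set S := h :: s in uS hA p0 p1 *; pose d := (size s).+1.
pose phi l : {mpoly k[d]} := psi l \mPo [tuple if i \in S then 'X_(inord (index i S)) else 0 | i < N].
pose wu (u : 'I_d -> k) i := if i \in S then u (inord (index i S)) else 0.
have phiE u l : (phi l).@[u] = (psi l).@[wu u].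
  rewrite comp_mpoly_meval; apply: meval_eq => j; rewrite tnth_mktuple /wu.
  by case: ifP; rewrite ?mevalXU ?meval0.
have evE (P : {mpoly k[n]}) u :
    P.@[fun l => (phi l).@[u]] = P.@[fun l => (psi l).@[wu u]].
  by apply: meval_eq => l; rewrite phiE.
have AE v : A v <-> image_closure phi v.
  split=> [/hA Av P P0|cv]; last first.
    apply/hA => P P0; apply: cv => u; rewrite evE; apply: P0 => i iS.
    by rewrite /wu (negbTE iS).
  apply: Av => w w0; rewrite -[RHS](P0 (fun l : 'I_d => w (nth h S l))) evE.
  apply: meval_eq => l; apply: meval_eq => i; rewrite /wu.
  case: ifP => [iS|/negbT/w0 //]; rewrite inordK ?nth_index //.
  by rewrite -(index_mem i S) in iS.
have nthS (l : 'I_d) : nth h S l \in S by rewrite mem_nth.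
have wuS u (l : 'I_d) : wu u (nth h S l) = u l.
  by rewrite /wu nthS index_uniq // inord_val.
have [[v cv] irr] := image_closure_irreducible phi.
have [[c [hc1 hc2]] hle] : dim_eq k (image_closure phi) d.
  apply: (image_closure_dim (p := fun l => p (nth h S l))) => [i u u0|i].
    by rewrite evE p0 ?nthS // wuS u0.
  exists (fun j : 'I_d => (j <= i)%N%:R); first by move=> j ltij; rewrite leqNgt ltij.
  rewrite evE p1 ?nthS // ?wuS ?leqnn ?oner_neq0 //.
  by have -> : h = nth h S (@ord0 (size s)) by []; rewrite wuS /= oner_neq0.
split.
  split; first by exists v; apply/AE.
  move=> B C zB zC sub; have [|h1|h1] := irr B C zB zC; first by move=> w /AE /sub.
    by left=> w /AE /h1.
  by right=> w /AE /h1.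
split.
  exists c; split=> // i lei; have [h1 h2 h3] := hc1 i lei; split=> // w /h3 /AE //.
move=> e [c' [hc1' hc2']]; apply: hle; exists c'; split=> // i lei.
by have [h1 h2 h3] := hc1' i lei; split=> // w /h3 /AE.
Qed.

End Dimension.

(** * Coefficients of the cubic in two series, and triangularity of the odd equations *)

Definition char_two (A : nzRingType) : Prop := forall x : A, x + x = 0.

Section JetCoefficients.
Variable A : comNzRingType.
Implicit Types y z : nat -> A.

(* In characteristic 2, [gcoef j] is the coefficient of [t^j] in [y^2 z + y z^2]: the
   square of a series involves the squares of its coefficients only. *)
Definition gcoef j y z : A :=
  \sum_(i < (j./2).+1) (y i ^+ 2 * z (j - i.*2)%N + z i ^+ 2 * y (j - i.*2)%N).

Definition godd j y z : A := gcoef j.*2.+1 y z.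

Lemma eq_gcoef j y z y' z' :
  (forall i, (i <= j)%N -> y i = y' i) -> (forall i, (i <= j)%N -> z i = z' i) ->
  gcoef j y z = gcoef j y' z'.
Proof.
move=> ey ez; apply: eq_bigr => -[i /= lti] _.
have lei : (i <= j)%N by have := odd_double_half j; lia.
by rewrite !ey ?ez ?leq_subr.
Qed.

Lemma gcoefC j y z : gcoef j y z = gcoef j z y.
Proof. by apply: eq_bigr => i _; rewrite addrC. Qed.

Lemma gcoef_scale j h y z :
  gcoef j (fun i => h * y i) (fun i => h * z i) = h ^+ 3 * gcoef j y z.
Proof. by rewrite mulr_sumr; apply: eq_bigr => i _; ring. Qed.

(** The form being cubic, a factor [t ^ 2] in both series comes out as [t ^ 6]. *)
Lemma gcoef_shift j y z : (forall i, (i < 2)%N -> y i = 0) -> (forall i, (i < 2)%N -> z i = 0) ->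
  gcoef j.+4.+2 y z = gcoef j (fun i => y i.+2) (fun i => z i.+2).
Proof.
move=> y0 z0; rewrite /gcoef /= big_ord_recl big_ord_recl big_ord_recr /=.
have lt2 : (j.+2.+4 - (bump 0 (bump 0 j./2.+1)).*2 < 2)%N.
  by rewrite /bump /=; have := odd_double_half j; case: (odd j); lia.
rewrite (y0 _ lt2) (z0 _ lt2) (y0 0%N) // (z0 0%N) // (y0 (bump 0 0)) // (z0 (bump 0 0)) //.
rewrite !expr0n /= !mul0r !addr0 !add0r.
rewrite !mulr0 !addr0; apply: eq_bigr => i _ /=.
have le_i : (i.*2 <= j)%N by have := ltn_ord i; have := odd_double_half j; lia.
by have -> : (j.+4.+2 - (bump 0 (bump 0 i)).*2 = (j - i.*2).+2)%N by rewrite /bump /=; lia.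
Qed.

Lemma gcoef_low j y z : (forall i, (i < 2)%N -> y i = 0) -> (forall i, (i < 2)%N -> z i = 0) ->
  (j < 6)%N -> gcoef j y z = 0.
Proof.
move=> y0 z0 ltj; rewrite /gcoef big1 // => -[i /= lti] _.
have [lt2|le2] := ltnP i 2; first by rewrite (y0 i) // (z0 i) // expr0n !mul0r addr0.
have lt2 : (j - i.*2 < 2)%N by have := odd_double_half j; lia.
by rewrite (y0 _ lt2) (z0 _ lt2) !mulr0 addr0.
Qed.

Lemma godd0E y z : godd 0 y z = y 0%N ^+ 2 * z 1%N + z 0%N ^+ 2 * y 1%N.
Proof. by rewrite /godd /gcoef big_ord1. Qed.

Lemma godd1E y z : godd 1 y z = y 0%N ^+ 2 * z 3%N + z 0%N ^+ 2 * y 3%N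
  + (y 1%N ^+ 2 * z 1%N + z 1%N ^+ 2 * y 1%N).
Proof. by rewrite /godd /gcoef !big_ord_recr big_ord0 /= add0r. Qed.

Lemma godd2E y z : godd 2 y z = y 0%N ^+ 2 * z 5%N + z 0%N ^+ 2 * y 5%N
  + (y 1%N ^+ 2 * z 3%N + z 1%N ^+ 2 * y 3%N) + (y 2%N ^+ 2 * z 1%N + z 2%N ^+ 2 * y 1%N).
Proof. by rewrite /godd /gcoef !big_ord_recr big_ord0 /= add0r. Qed.

(** Triangularity: when [y] starts at order [s], the last new unknown in [godd (j + s)] is
    [z_{2j+1}], with coefficient [y_s ^ 2]. Working modulo an ideal covers points (the zero ideal),
    the ideals of the charts and local radicals alike. *)
Lemma godd_cong (I : A -> Prop) (idI : is_ideal I) s j y z y' z' :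
  (s <= 2)%N -> (s <= j.*2)%N -> (forall i, I (y' i - y i)) ->
  (forall i, (i < s)%N -> I (y i)) -> (forall i, (i < j.*2.+1)%N -> I (z' i - z i)) ->
  I (godd (j + s) y' z' - godd (j + s) y z - y s ^+ 2 * (z' j.*2.+1 - z j.*2.+1)).
Proof.
move=> s2 sj hy y0 hz; rewrite /godd /gcoef -sumrB.
have -> : ((j + s).*2.+1)./2.+1 = (j + s).+1 by rewrite /= uphalf_double.
have lts : (s < (j + s).+1)%N by rewrite ltnS leq_addl.
rewrite (bigD1 (Ordinal lts)) //= addrAC; apply: (idealD idI).
  have -> : ((j + s).*2.+1 - s.*2 = j.*2.+1)%N by lia.
  set c := j.*2.+1.
  have -> : y' s ^+ 2 * z' c + z' s ^+ 2 * y' c - (y s ^+ 2 * z c + z s ^+ 2 * y c)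
     - y s ^+ 2 * (z' c - z c)
     = (y' s ^+ 2 - y s ^+ 2) * z' c + (z' s ^+ 2 * y' c - z s ^+ 2 * y c) by ring.
  apply: (idealD idI); first by apply: (idealMr idI); apply: (ideal_congX idI).
  by apply: (ideal_congM idI) => //; apply: (ideal_congX idI); apply: hz; lia.
have y'0 i : (i < s)%N -> I (y' i) by move=> lti; apply: (idealBD idI (hy i)); apply: y0.
apply: (ideal_sum idI) => -[i /= lti] /eqP ne_i.
have {}ne_i : i <> s by move=> ei; apply: ne_i; apply: val_inj.
set a := (_ - i.*2)%N; rewrite opprD addrACA; apply: (idealD idI).
  have [lt_is|le_si] := ltnP i s.
    by apply: (idealB idI); apply: (idealMr idI); apply: (idealX idI); [apply: y'0|apply: y0].
  apply: (ideal_congM idI); first exact: (ideal_congX idI).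
  by apply: hz; rewrite /a; lia.
(* An uncontrolled [z_i], with [i > 2j], is multiplied by some [y_a] with [a < s]; this is where
   [s <= j.*2] is used. *)
have [lt_i|le_i] := ltnP i j.*2.+1.
  by apply: (ideal_congM idI) => //; apply: (ideal_congX idI); apply: hz.
have lt_a : (a < s)%N by rewrite /a; lia.
by apply: (idealB idI); apply: (idealMl idI); [apply: y'0|apply: y0].
Qed.

(* Indices [i] such that [z_i] is determined, on the chart [y_s <> 0] of the locus
   [y_i = 0] for [i < s], by the equation [godd (i./2 + s) = 0] with [i./2 + s < q]. *)
Definition solved s q i : bool := [&& odd i, (s < i)%N & (i./2 + s < q)%N].

Lemma solvedP s q i : solved s q i ->
  exists2 j, i = j.*2.+1 & (s <= j.*2)%N /\ (j + s < q)%N.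
Proof.
by case/and3P => oi lti ltq; exists i./2; have := odd_double_half i; rewrite oi; lia.
Qed.

Lemma solved_odd s q j : (s <= j.*2)%N -> (j + s < q)%N -> solved s q j.*2.+1.
Proof. by move=> h1 h2; rewrite /solved /= odd_double /= uphalf_double ltnS h1 h2. Qed.

Lemma chart_exists s q y c (z0 : nat -> A) : (s <= 2)%N ->
  (forall i, (i < s)%N -> y i = 0) -> y s ^+ 2 * c = 1 ->
  exists z, (forall i, ~~ solved s q i -> z i = z0 i) /\
    forall j, (s <= j.*2)%N -> (j + s < q)%N -> godd (j + s) y z = 0.
Proof.
move=> s2 y0 yc; elim: q => [|q [z [z_eq zG]]]; first by exists z0.
have diff := godd_cong (eq0_is_ideal A) (y' := y) s2.
have [lt_s|le_s] := ltnP q s.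
  exists z; split=> [i ni|j h1 h2]; last by lia.
  by apply: z_eq; move: ni; rewrite /solved; lia.
pose j0 := (q - s)%N; have ej0 : (j0 + s = q)%N by rewrite subnK.
have [lt_s2|le_s2] := ltnP j0.*2 s.
  exists z; split=> [i ni|j h1 h2]; last by apply: zG => //; lia.
  by apply: z_eq; apply: contra ni => /and3P[h1 h2 h3]; apply/and3P; split=> //; lia.
(* Only the coefficient governed by equation [q] is corrected, [c] being the inverse of [y_s ^ 2];
   by triangularity the earlier equations are unaffected. *)
pose z' i := if i == j0.*2.+1 then z i - c * godd q y z else z i.
exists z'; split=> [i ni|j h1 h2].
  rewrite /z'; case: eqP => [ei|_]; last first.
    by apply: z_eq; apply: contra ni => /and3P[g1 g2 g3]; apply/and3P; split=> //; lia.
  by case/negP: ni; rewrite ei solved_odd // ej0.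
have := diff j y z z' h1 (fun i => subrr _) y0; rewrite -/z'.
have [lt_j|ge_j] := ltnP j j0.
  have same i : (i < j.*2.+2)%N -> z' i = z i by rewrite /z'; case: eqP => //; lia.
  move=> /(_ (fun i lti => etrans (congr1 (fun x => x - z i) (same i (ltnW lti))) (subrr _))).
  by rewrite same // !subrr mulr0 subr0 zG ?subr0 //; lia.
have -> : j = j0 by lia.
move=> /(_ _); rewrite ej0 => h; move: h.
have same i : (i < j0.*2.+1)%N -> z' i = z i by rewrite /z'; case: eqP => //; lia.
move=> /(_ (fun i lti => etrans (congr1 (fun x => x - z i) (same i lti)) (subrr _))).
rewrite /z' eqxx; set g := godd q y z => h.
have -> : godd q y z' = (godd q y z' - g - y s ^+ 2 * (z j0.*2.+1 - c * g - z j0.*2.+1))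
   + (1 - y s ^+ 2 * c) * g by ring.
by rewrite /z' h yc subrr mul0r addr0.
Qed.

(** The abstract form of the fact that solved coefficients are rational in the free ones: [S] is
    closed under the ring operations and, modulo [I], under division by [y_s ^ 2]. *)
Lemma chart_closed (I S : A -> Prop) s q y z : is_ideal I -> (s <= 2)%N ->
  S 0 -> (forall a b, S a -> S b -> S (a + b)) -> (forall a b, S a -> S b -> S (a * b)) ->
  (forall a, S a -> S (- a)) ->
  (forall x r, I (y s ^+ 2 * x - r) -> S r -> S x) ->
  (forall i, S (y i)) -> (forall i, (i < s)%N -> I (y i)) ->
  (forall j, (j < q)%N -> I (godd j y z)) ->
  (forall i, ~~ solved s q i -> S (z i)) -> forall i, S (z i).
Proof.
move=> idI s2 S0 SD SM SN SI Sy Iy IG Sz i.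
elim/ltn_ind: i => i IHi; have [|/Sz //] := boolP (solved s q i).
case/solvedP => j ei [h1 h2]; rewrite ei.
(* Compared with its truncation below [i], the equation expresses [y_s ^ 2 * z_i] modulo [I] through
   earlier coefficients. *)
pose z' l := if (l < i)%N then z l else 0.
have Sz' l : S (z' l) by rewrite /z'; case: ifP => // /IHi.
have hz l : (l < j.*2.+1)%N -> I (z l - z' l).
  by rewrite /z' ei => ->; rewrite subrr; apply: (ideal0 idI).
have hy l : I (y l - y l) by rewrite subrr; apply: (ideal0 idI).
have := godd_cong idI s2 h1 hy Iy hz.
rewrite /z' ei ltnn subr0 -ei -/z' => h.
apply: (SI _ (- godd (j + s) y z')).
  rewrite opprK (_ : _ + _ = - (godd (j + s) y z - godd (j + s) y z'
     - y s ^+ 2 * z i) + godd (j + s) y z); last by rewrite ei; ring.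
  by apply: (idealD idI); [apply: (idealN idI) | apply: IG].
apply: (SN); apply: (big_ind S) => // l _.
by apply: (SD); apply: (SM); rewrite ?expr2 //; apply: (SM).
Qed.

End JetCoefficients.

Lemma chart_unique (k : fieldType) s q (y z z' : nat -> k) : (s <= 2)%N ->
  (forall i, (i < s)%N -> y i = 0) -> y s != 0 ->
  (forall j, (j < q)%N -> godd j y z = 0) -> (forall j, (j < q)%N -> godd j y z' = 0) ->
  (forall i, ~~ solved s q i -> z i = z' i) -> forall i, z i = z' i.
Proof.
move=> s2 y0 ys hz hz' heq; elim/ltn_ind => i IHi.
have [|/heq //] := boolP (solved s q i); case/solvedP => j ei [h1 h2].
have hzz l : (l < j.*2.+1)%N -> z' l - z l = 0.
  by move=> ltl; rewrite IHi ?subrr // ei.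
have := godd_cong (eq0_is_ideal k) (y' := y) s2 h1 (fun i => subrr _) y0 hzz.
rewrite hz // hz' // subrr sub0r => /eqP; rewrite oppr_eq0 mulf_eq0 expf_eq0 (negbTE ys) /=.
by rewrite subr_eq0 ei => /eqP ->.
Qed.

Section GcoefMorphism.
Variables (A B : comNzRingType) (f : {rmorphism A -> B}).

Lemma gcoef_rmorph j (y z : nat -> A) :
  f (gcoef j y z) = gcoef j (fun i => f (y i)) (fun i => f (z i)).
Proof. by rewrite rmorph_sum; apply: eq_bigr => i _; rewrite rmorphD (rmorphM f (y i ^+ 2)) (rmorphM f (z i ^+ 2)) !rmorphXn. Qed.

End GcoefMorphism.

Section CharTwo.
Variable A : comNzRingType.
Hypothesis A2 : char_two A.
Implicit Types y z : nat -> A.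

Lemma oppr_char_two (x : A) : - x = x.
Proof. by apply/eqP; rewrite -subr_eq0 -opprD A2 oppr0. Qed.

Lemma sqrD_char_two (a b : A) : (a + b) ^+ 2 = a ^+ 2 + b ^+ 2.
Proof. by rewrite sqrrD mulr2n A2 addr0. Qed.

(** Frobenius. It turns [x_i ^ 2 = g_{2i}(y, z)] into [x_i = g_{2i}(eta, zeta)] once [y], [z] are
    the squares of [eta], [zeta]. *)
Lemma gcoef_sqr j y z : gcoef j (fun i => y i ^+ 2) (fun i => z i ^+ 2) = gcoef j y z ^+ 2.
Proof.
rewrite /gcoef (big_morph _ sqrD_char_two (expr0n _ 2)); apply: eq_bigr => i _.
by rewrite sqrD_char_two !exprMn.
Qed.

(** The cubic is [y z (y + z)], and replacing [z] by [y + z] exchanges its last two factors in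
    characteristic 2. *)
Lemma gcoef_addr j y z : gcoef j y (fun i => y i + z i) = gcoef j y z.
Proof.
apply: eq_bigr => i _; rewrite sqrD_char_two.
set a := y i ^+ 2; set b := y (j - i.*2)%N.
have -> : a * (b + z (j - i.*2)%N) + (a + z i ^+ 2) * b
  = a * z (j - i.*2)%N + z i ^+ 2 * b + (a * b + a * b) by ring.
by rewrite A2 addr0.
Qed.

Lemma coef_sqr_char_two (p : {poly A}) j :
  (p ^+ 2)`_j = if odd j then 0 else p`_(j./2) ^+ 2.
Proof.
elim/poly_ind: p j => [|p c IHp] j.
  by rewrite !expr0n /= !coef0 expr0n /= if_same.
have -> : (p * 'X + c%:P) ^+ 2 = p ^+ 2 * 'X^2 + (c ^+ 2)%:P.
  rewrite sqrrD exprMn polyC_exp mulr2n.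
  set r := p * 'X * c%:P; have -> : r + r = 0 by apply/polyP => i; rewrite coefD A2 coef0.
  by rewrite addr0.
rewrite coefD coefMXn coefC coefD coefMX coefC.
case: j => [|[|j]] //=; first by rewrite !add0r.
rewrite subn2 /= IHp !addr0 negbK; case: (odd j) => //.
Qed.

Lemma sum_even n (F : nat -> A) :
  \sum_(i < n.+1) (if odd i then 0 else F i) = \sum_(i < n./2.+1) F i.*2.
Proof.
elim: n => [|n IHn]; first by rewrite !big_ord1.
rewrite big_ord_recr IHn /= uphalf_half; case on : (odd n) => /=.
  rewrite add1n [RHS]big_ord_recr; congr (_ + F _) => /=.
  by have := odd_double_half n; rewrite on; lia.
by rewrite addr0 add0n.
Qed.

Lemma coef_jet (X Y Z : {poly A}) j :
  (X ^+ 2 + Y ^+ 2 * Z + Y * Z ^+ 2)`_j =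
  (if odd j then 0 else X`_(j./2) ^+ 2) + gcoef j (nth 0 Y) (nth 0 Z).
Proof.
have coefM2 (P Q : {poly A}) : (P ^+ 2 * Q)`_j = \sum_(i < j./2.+1) P`_i ^+ 2 * Q`_(j - i.*2).
  rewrite coefM (eq_bigr (fun i : 'I_j.+1 =>
    if odd i then 0 else P`_(i./2) ^+ 2 * Q`_(j - i))); last first.
    by move=> i _; rewrite coef_sqr_char_two; case: ifP; rewrite ?mul0r.
  rewrite (sum_even j (fun i => P`_(i./2) ^+ 2 * Q`_(j - i))).
  by apply: eq_bigr => i _; rewrite doubleK.
rewrite !coefD coef_sqr_char_two -addrA [Y * _]mulrC !coefM2; congr (_ + _).
by rewrite -big_split.
Qed.

End CharTwo.

Lemma mpoly_char_two (k : fieldType) n : char_two k -> char_two {mpoly k[n]}.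
Proof. by move=> k2 p; apply/mpolyP => m; rewrite mcoeffD k2 mcoeff0. Qed.

(** * Elimination on a chart: an explicit Nullstellensatz *)

Section ChartCertificate.
Variables (k : closedFieldType) (n : nat) (I : {mpoly k[n]} -> Prop) (h : 'I_n).
Variable free : pred 'I_n.
Hypotheses (idI : is_ideal I) (free_h : free h).

Definition free_subst : n.-tuple {mpoly k[n]} := [tuple if free i then 'X_i else 0 | i < n].

(* Modulo [I] and after inverting ['X_h], [p] is a polynomial in the free variables. *)
Definition reducible_to_free (p : {mpoly k[n]}) : Prop :=
  exists N Q, I ('X_h ^+ N * p - (Q \mPo free_subst)).

Lemma free_substX i : free i -> 'X_i \mPo free_subst = 'X_i.
Proof. by move=> fi; rewrite comp_mpolyXU -tnth_nth tnth_mktuple fi. Qed.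

Lemma reducible_free i : free i -> reducible_to_free 'X_i.
Proof. by move=> fi; exists 0%N, 'X_i; rewrite free_substX // mul1r subrr; apply: ideal0. Qed.

Lemma reducibleC c : reducible_to_free c%:MP.
Proof. by exists 0%N, c%:MP; rewrite comp_mpolyC mul1r subrr; apply: ideal0. Qed.

Lemma reducibleI p : I p -> reducible_to_free p.
Proof. by move=> Ip; exists 0%N, 0; rewrite comp_mpoly0 mul1r subr0. Qed.

Lemma reducible0 : reducible_to_free 0.
Proof. by apply: reducibleI; apply: ideal0. Qed.

Lemma reducibleD p q : reducible_to_free p -> reducible_to_free q -> reducible_to_free (p + q).
Proof.
move=> [N [P hP]] [M [Q hQ]]; exists (N + M)%N, ('X_h ^+ M * P + 'X_h ^+ N * Q).
rewrite rmorphD (rmorphM (comp_mpoly _) ('X_h ^+ M)) (rmorphM (comp_mpoly _) ('X_h ^+ N)).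
rewrite !rmorphXn /= free_substX // exprD.
rewrite (_ : _ - _ = 'X_h ^+ M * ('X_h ^+ N * p - (P \mPo free_subst))
   + 'X_h ^+ N * ('X_h ^+ M * q - (Q \mPo free_subst))); last by ring.
by apply: idealD => //; apply: idealMl.
Qed.

Lemma reducibleM p q : reducible_to_free p -> reducible_to_free q -> reducible_to_free (p * q).
Proof.
move=> [N [P hP]] [M [Q hQ]]; exists (N + M)%N, (P * Q).
rewrite rmorphM exprD mulrACA; exact: ideal_congM.
Qed.

Lemma reducibleN p : reducible_to_free p -> reducible_to_free (- p).
Proof.
move=> [N [P hP]]; exists N, (- P).
by rewrite rmorphN /= mulrN -opprD; apply: idealN.
Qed.

Lemma reducible_div x r : I ('X_h ^+ 2 * x - r) -> reducible_to_free r -> reducible_to_free x.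
Proof.
move=> hx [N [P hP]]; exists (N + 2)%N, P; rewrite exprD.
rewrite (_ : _ - _ = 'X_h ^+ N * ('X_h ^+ 2 * x - r) + ('X_h ^+ N * r - (P \mPo free_subst)));
  last by ring.
by apply: idealD => //; apply: idealMl.
Qed.

(** Only squares of variables are assumed reducible, whence [P ^ 2], a polynomial in those squares.
    It reduces to some [Q] in the free variables. Every choice of these with [X_h] and [H] nonzero
    extends to a zero of [I] and [P], so [Q] times [X_h * H] vanishes everywhere, and [Q] is 0. *)
Lemma chart_certificate (H P : {mpoly k[n]}) : char_two k -> H != 0 ->
  (forall i, reducible_to_free ('X_i ^+ 2)) ->
  (forall w, w h != 0 -> H.@[w] != 0 -> exists v, [/\ forall i, free i -> v i = w i,
     forall p, I p -> p.@[v] = 0 & P.@[v] = 0]) ->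
  exists N, I ('X_h ^+ N * P ^+ 2).
Proof.
move=> k2 H0 redX ext.
have R2 := @mpoly_char_two k n k2.
have [N [Q hQ]] : reducible_to_free (P ^+ 2).
  elim/mpoly_subring_ind: P {ext} => [c|//|p q hp hq|p q hp hq].
  - by rewrite -rmorphXn; apply: reducibleC.
  - by rewrite sqrD_char_two //; apply: reducibleD.
  - by rewrite exprMn; apply: reducibleM.
exists N; suff Q0 : Q \mPo free_subst = 0 by rewrite Q0 subr0 in hQ.
suff : (Q \mPo free_subst) * ('X_h * H) = 0.
  move/eqP; rewrite !mulf_eq0 (negbTE H0) orbF => /orP[/eqP //|/eqP X0].
  by have /eqP := congr1 (mcoeff U_(h)) X0; rewrite mcoeffXU eqxx mcoeff0 oner_eq0.
apply: mpoly_vanish => w; rewrite !mevalM mevalXU.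
have [->|wh] := eqVneq (w h) 0; first by rewrite mul0r mulr0.
have [->|wH] := eqVneq H.@[w] 0; first by rewrite !mulr0.
have [v [vw Iv Pv]] := ext w wh wH.
have -> : (Q \mPo free_subst).@[w] = (Q \mPo free_subst).@[v].
  rewrite !comp_mpoly_meval; apply: meval_eq => i; rewrite tnth_mktuple.
  by case: ifP => fi; rewrite ?meval0 // !mevalXU vw.
have := Iv _ hQ; rewrite mevalB mevalM (rmorphXn (meval v) 2 P) /= Pv expr0n mulr0 sub0r.
by move/eqP; rewrite oppr_eq0 => /eqP ->; rewrite mul0r.
Qed.

End ChartCertificate.

Lemma mpoly_ext (k : closedFieldType) n (p q : {mpoly k[n]}) :
  (forall v, p.@[v] = q.@[v]) -> p = q.
Proof.
by move=> pq; apply/eqP; rewrite -subr_eq0; apply/eqP/mpoly_vanish => v; rewrite mevalB pq subrr.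
Qed.

Lemma card_ord_seq n (s : seq nat) : uniq s -> (forall i, i \in s -> (i < n)%N) ->
  #|[set i : 'I_n | (i : nat) \in s]| = size s.
Proof.
move=> us lts; rewrite cardE -(size_map val); apply: perm_size; apply: uniq_perm => //.
  by rewrite map_inj_uniq ?enum_uniq //; apply: val_inj.
move=> i; apply/mapP/idP => [[o]|si]; first by rewrite mem_enum inE => ? ->.
by exists (Ordinal (lts i si)); rewrite // mem_enum inE.
Qed.

(** * Pairs of truncated series, and the chart [y_0 <> 0] *)

Section PairVariables.
Variables (k : closedFieldType) (L : nat).
Implicit Types y z : nat -> k.

Definition pair_pt y z : 'I_(L + L) -> k := fun i => if (i < L)%N then y i else z (i - L)%N.
(** The value 0 beyond [L] makes the coordinates a sequence over [nat], as [gcoef] expects. *)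
Definition yvar i : {mpoly k[L + L]} := if insub i is Some o then 'X_(lshift L o) else 0.
Definition zvar i : {mpoly k[L + L]} := if insub i is Some o then 'X_(rshift L o) else 0.

Lemma yvarE i (lti : (i < L)%N) : yvar i = 'X_(lshift L (Ordinal lti)).
Proof. by rewrite /yvar insubT. Qed.
Lemma zvarE i (lti : (i < L)%N) : zvar i = 'X_(rshift L (Ordinal lti)).
Proof. by rewrite /zvar insubT. Qed.
Lemma yvar_out i : (L <= i)%N -> yvar i = 0.
Proof. by move=> lei; rewrite /yvar insubF // ltnNge lei. Qed.
Lemma zvar_out i : (L <= i)%N -> zvar i = 0.
Proof. by move=> lei; rewrite /zvar insubF // ltnNge lei. Qed.

Lemma yvar_pt y z i : (yvar i).@[pair_pt y z] = if (i < L)%N then y i else 0.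
Proof.
case: ltnP => lti; last by rewrite yvar_out ?meval0.
by rewrite yvarE mevalXU /pair_pt /= lti.
Qed.
Lemma zvar_pt y z i : (zvar i).@[pair_pt y z] = if (i < L)%N then z i else 0.
Proof.
case: ltnP => lti; last by rewrite zvar_out ?meval0.
by rewrite zvarE mevalXU /pair_pt /= ltnNge leq_addr addKn.
Qed.

Lemma pair_ptE (v : 'I_(L + L) -> k) :
  v =1 pair_pt (fun i => (yvar i).@[v]) (fun i => (zvar i).@[v]).
Proof.
move=> i; rewrite /pair_pt; case: ltnP => lti.
  by rewrite yvarE mevalXU; congr (v _); apply: val_inj.
have lti' : (i - L < L)%N by rewrite ltn_subLR.
by rewrite zvarE mevalXU; congr (v _); apply: val_inj; rewrite /= subnKC.
Qed.

Lemma pair_var (i : 'I_(L + L)) : 'X_i = if (i < L)%N then yvar i else zvar (i - L).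
Proof.
case: ltnP => lti; first by rewrite yvarE; congr 'X__; apply: val_inj.
have lti' : (i - L < L)%N by rewrite ltn_subLR.
by rewrite zvarE; congr 'X__; apply: val_inj; rewrite /= subnKC.
Qed.

Definition pair_subst (R : nzRingType) (f g : nat -> R) : (L + L).-tuple R :=
  [tuple if (i < L)%N then f i else g (i - L)%N | i < L + L].

End PairVariables.

Lemma pair_subst_eval (k : closedFieldType) L N (f g : nat -> {mpoly k[N]})
    (P : {mpoly k[L + L]}) v :
  (P \mPo pair_subst L f g).@[v]
  = P.@[pair_pt (L := L) (fun i => (f i).@[v]) (fun i => (g i).@[v])].
Proof.
rewrite comp_mpoly_meval; apply: meval_eq => i; rewrite tnth_mktuple /pair_pt.
by case: ifP.
Qed.

Definition jet_eqs (k : fieldType) q (y z : nat -> k) : Prop :=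
  forall j, (j < q)%N -> godd j y z = 0.

Lemma godd_eval (k : closedFieldType) L j (y z : nat -> k) : (j.*2.+1 < L)%N ->
  (godd j (yvar k L) (zvar k L)).@[pair_pt (L := L) y z] = godd j y z.
Proof.
move=> ltj; rewrite (gcoef_rmorph (meval _)); apply: eq_gcoef => i lei /=.
  by rewrite yvar_pt (leq_ltn_trans lei).
by rewrite zvar_pt (leq_ltn_trans lei).
Qed.

Definition godd_seq (k : closedFieldType) L q : seq {mpoly k[L + L]} :=
  [seq godd j (yvar k L) (zvar k L) | j <- iota 0 q].

(** This open condition is invariant under the permutations of [y], [z], [y + z], so vanishing on
    generic pairs is preserved by the symmetries. *)
Definition generic_pair (k : fieldType) (y z : nat -> k) : bool :=
  y 0%N * z 0%N * (y 0%N + z 0%N) != 0.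

Section PairCertificate.
Variables (k : closedFieldType) (k2 : char_two k) (L q : nat).
Hypotheses (L_gt0 : (0 < L)%N) (leqL : (q.*2 <= L)%N).
Local Notation ev P y z := (P.@[pair_pt (L := L) y z]).

Lemma godd_seq_eval y z : jet_eqs q y z ->
  forall p, in_ideal k (godd_seq k L q) p -> ev p y z = 0.
Proof.
move=> W; apply: in_ideal_eval => g /mapP [j]; rewrite mem_iota => /andP[_ ltj] ->.
by rewrite godd_eval ?W //; lia.
Qed.

Lemma eq_jet_eqs (y z y' z' : nat -> k) :
  (forall i, (i < L)%N -> y i = y' i) -> (forall i, (i < L)%N -> z i = z' i) ->
  jet_eqs q y z -> jet_eqs q y' z'.
Proof.
move=> ey ez W j ltj; rewrite -(W j ltj); apply/esym/eq_gcoef => i lei.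
  by apply: ey; lia.
by apply: ez; lia.
Qed.

Lemma yvar_certificate (P : {mpoly k[L + L]}) :
  (forall y z, jet_eqs q y z -> generic_pair y z -> ev P y z = 0) ->
  exists N, in_ideal k (godd_seq k L q) (yvar k L 0 ^+ N * P ^+ 2).
Proof.
move=> PW; set I := in_ideal k _; have idI : is_ideal I by apply: in_ideal_is_ideal.
pose free (i : 'I_(L + L)) := (i < L)%N || ~~ solved 0 q (i - L).
pose h := lshift L (Ordinal L_gt0); have free_h : free h by rewrite /free /= L_gt0.
(* On the chart [y_0 <> 0], the condition [H <> 0] is what remains of genericity. *)
rewrite yvarE -/h; pose H := zvar k L 0 * (yvar k L 0 + zvar k L 0).
have red_y i : reducible_to_free I h free (yvar k L i).
  have [lti|lei] := ltnP i L; last by rewrite yvar_out //; apply: reducible0.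
  by rewrite yvarE; apply: reducible_free => //; rewrite /free /= lti.
have IG j : (j < q)%N -> I (godd j (yvar k L) (zvar k L)).
  by move=> ltj; apply: in_ideal_gen; apply: map_f; rewrite mem_iota.
have red_z i : reducible_to_free I h free (zvar k L i).
  apply: (@chart_closed _ I (reducible_to_free I h free) 0 q (yvar k L) (zvar k L)) => //.
  - exact: reducible0.
  - exact: reducibleD.
  - exact: reducibleM.
  - exact: reducibleN.
  - by move=> x r; rewrite yvarE; apply: reducible_div.
  - move=> {}i si; have [lti|lei] := ltnP i L; last by rewrite zvar_out //; apply: reducible0.
    by rewrite zvarE; apply: reducible_free => //; rewrite /free /= addKn si orbT.
apply: (chart_certificate idI free_h k2 (H := H)).
- pose y (i : nat) : k := 0; pose z (i : nat) : k := 1; apply/eqP => H0.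
  have := congr1 (meval (pair_pt (L := L) y z)) H0.
  rewrite meval0 mevalM mevalD zvar_pt yvar_pt L_gt0 add0r mulr1 => /eqP.
  by rewrite oner_eq0.
- move=> i; rewrite expr2 pair_var; case: ifP => _; exact: reducibleM.
move=> w wh wH; pose y i := (yvar k L i).@[w]; pose z0 i := (zvar k L i).@[w].
have y0 : y 0%N != 0 by rewrite /y yvarE mevalXU.
have [z [z_eq zG]] := @chart_exists k 0 q y (y 0%N ^- 2) z0 isT (fun=> ltac:(by []))
  (mulfV (expf_neq0 2 y0)).
have W : jet_eqs q y z by move=> j ltj; rewrite -[j]addn0; apply: zG; rewrite ?addn0.
exists (pair_pt (L := L) y z); split.
- move=> i fi; rewrite [RHS](pair_ptE w) /pair_pt; case: ifP fi => // ni.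
  by rewrite /free ni /= => /z_eq.
- exact: godd_seq_eval.
- apply: PW => //; rewrite /generic_pair -mulrA mulf_neq0 //.
  by move: wH; rewrite /H mevalM mevalD -/(y 0%N) -/(z0 0%N) -z_eq.
Qed.

End PairCertificate.

(** * The symmetries of the cubic, acting on pairs *)

Section PairSymmetry.
Variables (k : closedFieldType) (k2 : char_two k) (L q : nat).
Hypotheses (leqL : (q.*2 <= L)%N).
Local Notation ev P y z := (P.@[pair_pt (L := L) y z]).
Local Notation yv := (yvar k L).
Local Notation zv := (zvar k L).

Lemma ev_ext (P : {mpoly k[L + L]}) y z y' z' :
  (forall i, (i < L)%N -> y i = y' i) -> (forall i, (i < L)%N -> z i = z' i) ->
  ev P y z = ev P y' z'.
Proof.
move=> ey ez; apply: meval_eq => i; rewrite /pair_pt; case: ltnP => lti; first exact: ey.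
by apply: ez; rewrite ltn_subLR.
Qed.

Lemma ev_swap (P : {mpoly k[L + L]}) y z : ev (P \mPo pair_subst L zv yv) y z = ev P z y.
Proof.
by rewrite pair_subst_eval; apply: ev_ext => i lti; rewrite ?yvar_pt ?zvar_pt lti.
Qed.

Lemma ev_shear (P : {mpoly k[L + L]}) y z :
  ev (P \mPo pair_subst L yv (fun i => yv i + zv i)) y z = ev P y (fun i => y i + z i).
Proof.
by rewrite pair_subst_eval; apply: ev_ext => i lti; rewrite ?mevalD ?yvar_pt ?zvar_pt lti.
Qed.

Lemma jet_eqs_swap (y z : nat -> k) : jet_eqs q y z -> jet_eqs q z y.
Proof. by move=> W j ltj; rewrite /godd gcoefC; apply: W. Qed.

Lemma jet_eqs_shear (y z : nat -> k) : jet_eqs q y z -> jet_eqs q y (fun i => y i + z i).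
Proof. by move=> W j ltj; rewrite /godd gcoef_addr //; apply: W. Qed.

Lemma generic_swap (y z : nat -> k) : generic_pair y z = generic_pair z y.
Proof. by rewrite /generic_pair [y 0%N * _]mulrC [y 0%N + _]addrC. Qed.

Lemma generic_shear (y z : nat -> k) :
  generic_pair y (fun i => y i + z i) = generic_pair y z.
Proof. by rewrite /generic_pair addrA k2 add0r mulrAC. Qed.

Lemma swapK (P : {mpoly k[L + L]}) : (P \mPo pair_subst L zv yv) \mPo pair_subst L zv yv = P.
Proof.
apply: mpoly_ext => v; rewrite (meval_eq (v2 := pair_pt (L := L) (fun i => (yv i).@[v]) (fun i => (zv i).@[v])));
  last exact: pair_ptE.
rewrite !ev_swap; apply: meval_eq => i; exact/esym/pair_ptE.
Qed.

End PairSymmetry.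

Section ZCertificate.
Variables (k : closedFieldType) (k2 : char_two k) (L q : nat).
Hypotheses (L_gt0 : (0 < L)%N) (leqL : (q.*2 <= L)%N).
Local Notation ev P y z := (P.@[pair_pt (L := L) y z]).
Local Notation yv := (yvar k L).
Local Notation zv := (zvar k L).

Lemma zvar_certificate (P : {mpoly k[L + L]}) :
  (forall y z, jet_eqs q y z -> generic_pair y z -> ev P y z = 0) ->
  exists N, in_ideal k (godd_seq k L q) (zv 0 ^+ N * P ^+ 2).
Proof.
move=> PW; pose sw := pair_subst L zv yv.
have [N hN] : exists N, in_ideal k (godd_seq k L q) (yv 0 ^+ N * (P \mPo sw) ^+ 2).
  apply: yvar_certificate => // y z W g; rewrite ev_swap; apply: PW.
    exact: jet_eqs_swap.
  by rewrite generic_swap.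
exists N; have -> : zv 0 ^+ N * P ^+ 2 = (yv 0 ^+ N * (P \mPo sw) ^+ 2) \mPo sw.
  rewrite rmorphM !rmorphXn /= swapK; congr (_ ^+ _ * _).
  by rewrite yvarE comp_mpolyXU -tnth_nth tnth_mktuple /= L_gt0.
apply: (in_ideal_min (I := fun p => in_ideal k (godd_seq k L q) (p \mPo sw))) hN.
  exact: (preim_ideal (comp_mpoly sw) (in_ideal_is_ideal _)).
move=> g /mapP [j]; rewrite mem_iota => /andP[_ ltj] ->; apply: in_ideal_gen.
apply/mapP; exists j; rewrite ?mem_iota //; apply: mpoly_ext => v.
rewrite (meval_eq (v2 := pair_pt (L := L) (fun i => (yv i).@[v]) (fun i => (zv i).@[v])));
  last exact: pair_ptE.
rewrite ev_swap godd_eval; last by lia.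
rewrite [RHS](meval_eq (v2 := pair_pt (L := L) (fun i => (yv i).@[v]) (fun i => (zv i).@[v])));
  last exact: pair_ptE.
by rewrite godd_eval /godd 1?gcoefC //; lia.
Qed.

End ZCertificate.

(** * Contradictions at a jet where [P] does not vanish *)

Section LocalAnalysis.
Variables (k : closedFieldType) (k2 : char_two k) (L q : nat).
Hypotheses (L_gt0 : (0 < L)%N) (leqL : (q.*2 <= L)%N).
Local Notation ev P y z := (P.@[pair_pt (L := L) y z]).
Local Notation yv := (yvar k L).
Local Notation zv := (zvar k L).

Variable P : {mpoly k[L + L]}.
Hypothesis PW : forall y z, jet_eqs q y z -> generic_pair y z -> ev P y z = 0.
Variables y z : nat -> k.
Hypotheses (yL : forall i, (L <= i)%N -> y i = 0) (zL : forall i, (L <= i)%N -> z i = 0).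
Hypotheses (W : jet_eqs q y z) (Pyz : ev P y z != 0).
Hypotheses (y0 : y 0%N = 0) (z0 : z 0%N = 0).

Definition section_set (s : seq nat) : {set 'I_(L + L)} := [set i : 'I_(L + L) | (i : nat) \in s].

(* The local radical at [(y, z)] of the equations together with the slice fixing the
   coordinates whose index is not in [s]. *)
Variant slice_radical (s : seq nat) (p : {mpoly k[L + L]}) : Prop :=
  SliceRadical of local_radical (pair_pt (L := L) y z) (in_ideal k (godd_seq k L q ++
    [seq 'X_j - (pair_pt (L := L) y z j)%:MP | j <- enum (~: section_set s)])) p.

Lemma slice_radical_ideal s : is_ideal (slice_radical s).
Proof.
have idR := local_radical_ideal (pair_pt (L := L) y z) (in_ideal_is_ideal (godd_seq k L q ++
    [seq 'X_j - (pair_pt (L := L) y z j)%:MP | j <- enum (~: section_set s)])).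
split; first by split; apply: (ideal0 idR).
  by move=> p r [hp] [hr]; split; apply: (idealD idR).
by move=> a p [hp]; split; apply: (idealMl idR).
Qed.

Lemma slice_radicalX s p e : slice_radical s (p ^+ e) -> slice_radical s p.
Proof. by case=> hp; split; apply: local_radicalX hp. Qed.

Lemma slice_radicalM s U p : U.@[pair_pt (L := L) y z] != 0 ->
  slice_radical s (U * p) -> slice_radical s p.
Proof. by move=> U0 [hp]; split; apply: local_radicalM U0 hp. Qed.

Lemma slice_radical_sub s p : in_ideal k (godd_seq k L q) p -> slice_radical s p.
Proof.
move=> hp; split; apply: local_radical_sub; apply: in_ideal_min hp => [|g gin].
  exact: in_ideal_is_ideal.
by apply: in_ideal_gen; rewrite mem_cat gin.
Qed.

Lemma slice_radical_godd s j : (j < q)%N -> slice_radical s (godd j yv zv).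
Proof.
by move=> ltj; apply: slice_radical_sub; apply: in_ideal_gen; apply: map_f; rewrite mem_iota.
Qed.

(** Here [P <> 0] at the jet is used: [P ^ 2] is a unit of the local ring, so the certificate puts a
    power of [y_0] into the ideal. *)
Lemma slice_radical_y0 s : slice_radical s (yv 0).
Proof.
have [N hN] := yvar_certificate k2 L_gt0 leqL PW.
apply: (@slice_radicalX _ _ N); apply: (@slice_radicalM _ (P ^+ 2)).
  by rewrite (rmorphXn (meval _)) /= expf_neq0.
by rewrite mulrC; apply: slice_radical_sub.
Qed.

Lemma slice_radical_z0 s : slice_radical s (zv 0).
Proof.
have [N hN] := zvar_certificate k2 L_gt0 leqL PW.
apply: (@slice_radicalX _ _ N); apply: (@slice_radicalM _ (P ^+ 2)).
  by rewrite (rmorphXn (meval _)) /= expf_neq0.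
by rewrite mulrC; apply: slice_radical_sub.
Qed.

Lemma slice_radical_y s i : i \notin s -> slice_radical s (yv i - (y i)%:MP).
Proof.
move=> si; have [lti|lei] := ltnP i L; last first.
  by rewrite yvar_out // yL // mpolyC0 subr0; apply: ideal0; apply: slice_radical_ideal.
split; apply: local_radical_sub; apply: in_ideal_gen; rewrite mem_cat; apply/orP; right.
apply/mapP; exists (lshift L (Ordinal lti)); first by rewrite mem_enum !inE.
by rewrite yvarE /pair_pt /= lti.
Qed.

Lemma slice_radical_z s i : (L + i)%N \notin s -> slice_radical s (zv i - (z i)%:MP).
Proof.
move=> si; have [lti|lei] := ltnP i L; last first.
  by rewrite zvar_out // zL // mpolyC0 subr0; apply: ideal0; apply: slice_radical_ideal.
split; apply: local_radical_sub; apply: in_ideal_gen; rewrite mem_cat; apply/orP; right.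
apply/mapP; exists (rshift L (Ordinal lti)); first by rewrite mem_enum !inE.
by rewrite zvarE /pair_pt /= ltnNge leq_addr addKn.
Qed.

Lemma slice_contradiction s : uniq s -> (forall i, i \in s -> (i < L + L)%N) -> (q < size s)%N ->
  (forall i, slice_radical s (yv i - (y i)%:MP)) ->
  (forall i, slice_radical s (zv i - (z i)%:MP)) -> False.
Proof.
move=> us lts ltq ry rz.
apply: (@zero_not_isolated k _ (pair_pt (L := L) y z) (godd_seq k L q) (section_set s)).
- by rewrite /section_set card_ord_seq // size_map size_iota.
- by move=> g gin; apply: (godd_seq_eval L_gt0 leqL W); apply: in_ideal_gen.
move=> i _; have -> : pair_pt (L := L) y z i = if (i < L)%N then y i else z (i - L)%N by [].
by rewrite pair_var; case: ifP => _; [have [] := ry i | have [] := rz (i - L)%N].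
Qed.

(** The slice moves only [y_0], or [y_0] and [z_0] (index [L]), all known to be nilpotent; it has
    [q + 1] coordinates. *)
Lemma small_contradiction : (q <= 1)%N -> False.
Proof.
move=> q1; pose s := if q == 0%N then [:: 0%N] else [:: 0%N; L].
apply: (@slice_contradiction s).
- by rewrite /s; case: ifP => //= _; rewrite inE andbT; lia.
- by rewrite /s => i; case: ifP => _; rewrite !inE; lia.
- by rewrite /s; case: ifP => //=; lia.
- case=> [|i]; first by rewrite y0 mpolyC0 subr0; apply: slice_radical_y0.
  have [lti|lei] := ltnP i.+1 L; first by apply: slice_radical_y; rewrite /s; case: ifP => _; rewrite !inE; lia.
  by rewrite yvar_out // yL // mpolyC0 subr0; apply: ideal0; apply: slice_radical_ideal.
- case=> [|i]; first by rewrite z0 mpolyC0 subr0; apply: slice_radical_z0.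
  by apply: slice_radical_z; rewrite /s; case: ifP => _; rewrite !inE; lia.
Qed.

(** The moving coordinates are the [y_i] with [i < s], then [z_0], [z_1], and the [z_{2j+1}] solved
    by the equations [godd (j + s)]. For [s < q] there are [s + 2 + (q - s - 1) = q + 1] of them,
    one more than the equations. *)
Definition chart_slice s : seq nat :=
  iota 0 s ++ [:: L; L.+1] ++ [seq (L + j.*2.+1)%N | j <- iota 1 (q - s.+1)].

(** Once the [y_i] below [s] and [z_0], [z_1] are nilpotent, triangularity and the unit [y_s] show
    by induction that each moving [z_{2j+1}] agrees with its value at the jet up to a nilpotent; the
    other coordinates are fixed by the slice. *)
Lemma chart_contradiction s : (0 < s <= 2)%N -> (s < q)%N ->
  (forall i, (i < s)%N -> y i = 0) -> z 1%N = 0 -> y s != 0 ->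
  (forall i, (i < s)%N -> slice_radical (chart_slice s) (yv i)) ->
  slice_radical (chart_slice s) (zv 1) -> False.
Proof.
move=> /andP[s_gt0 s2] ltsq ys0 z1 ys ry rz1; set S := chart_slice s in ry rz1.
have idR : is_ideal (slice_radical S) by apply: slice_radical_ideal.
have Ry i : slice_radical S (yv i - (y i)%:MP).
  have [lti|lei] := ltnP i s; first by rewrite ys0 // mpolyC0 subr0; apply: ry.
  have [ltL|leL] := ltnP i L; last first.
    by rewrite yvar_out // yL // mpolyC0 subr0; exact: (ideal0 idR).
  apply: slice_radical_y; rewrite /S /chart_slice !mem_cat mem_iota !inE.
  apply/negP => /or3P[|/orP[]|/mapP [j _]]; lia.
apply: (@slice_contradiction S) => //.
- rewrite /S /chart_slice cat_uniq iota_uniq /= map_inj_uniq ?iota_uniq; last by move=> a b; lia.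
  apply/andP; split; last (apply/andP; split; last (apply/andP; split)) => //.
  + rewrite !mem_iota; apply/norP; split; [lia|]; apply/norP; split; [lia|].
    by apply/hasPn => _ /mapP [j _ ->]; rewrite mem_iota; lia.
  + by rewrite inE; apply/norP; split; [lia|]; apply/mapP => -[j _]; lia.
  + by apply/mapP => -[j]; rewrite mem_iota; lia.
- move=> i; rewrite /S /chart_slice !mem_cat mem_iota !inE.
  by case/or3P => [|/orP[]|/mapP [j]]; rewrite ?mem_iota; lia.
- by rewrite /S /chart_slice !size_cat size_map !size_iota /=; lia.
elim/ltn_ind => i IHi.
have [ltL|leL] := ltnP i L; last by rewrite zvar_out // zL // mpolyC0 subr0; exact: (ideal0 idR).
case: i ltL IHi => [|[|i]] ltL IHi.
- by rewrite z0 mpolyC0 subr0; apply: slice_radical_z0.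
- by rewrite z1 mpolyC0 subr0.
have [/solvedP [j ei [h1 h2]]|ns] := boolP (solved s q i.+2); last first.
  apply: slice_radical_z; rewrite /S /chart_slice !mem_cat mem_iota !inE.
  apply/negP => /or3P[|/orP[]|/mapP [j]]; rewrite ?mem_iota; try lia.
  move=> hj ej; case/negP: ns; have -> : i.+2 = j.*2.+1 by lia.
  by apply: solved_odd; lia.
have hys l : (l < s)%N -> slice_radical S (y l)%:MP.
  by move=> ltl; rewrite ys0 // mpolyC0; exact: (ideal0 idR).
have hzs l : (l < j.*2.+1)%N -> slice_radical S (zv l - (z l)%:MP).
  by move=> ltl; apply: IHi; rewrite ei.
have := godd_cong (y := fun i => (y i)%:MP) (y' := yv) idR s2 h1 Ry hys hzs.
have -> : godd (j + s) (fun i => (y i)%:MP) (fun i => (z i)%:MP) = 0 :> {mpoly k[L + L]}.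
  have := W h2; rewrite /godd => /(congr1 (@mpolyC (L + L) k)).
  by rewrite (gcoef_rmorph (@mpolyC (L + L) k)) mpolyC0.
rewrite subr0 -ei => h; apply: (@slice_radicalM _ ((y s)%:MP ^+ 2)).
  by rewrite (rmorphXn (meval _)) /= mevalC expf_neq0.
by apply: (idealBD idR (idealBC idR h)); apply: slice_radical_godd.
Qed.

(** Modulo the nilpotents [y_0], [z_0], equation [godd 1] is [y_1 z_1 (y_1 + z_1)], in which
    [y_1 (y_1 + z_1)] is a unit at the jet; hence [z_1] is nilpotent. *)
Lemma first_order_contradiction : (1 < q)%N -> z 1%N = 0 -> y 1%N != 0 -> False.
Proof.
move=> q1 z1 y1; have idR := slice_radical_ideal (chart_slice 1).
apply: (@chart_contradiction 1) => //; first by case.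
  by case=> // _; apply: slice_radical_y0.
have := slice_radical_godd (chart_slice 1) q1; rewrite godd1E => h.
apply: (@slice_radicalM _ (yv 1 * (yv 1 + zv 1))).
  rewrite mevalM mevalD yvar_pt zvar_pt; have -> : (1 < L)%N by lia.
  by rewrite z1 addr0 mulf_neq0.
have -> : yv 1 * (yv 1 + zv 1) * zv 1 = yv 0 ^+ 2 * zv 3 + zv 0 ^+ 2 * yv 3
    + (yv 1 ^+ 2 * zv 1 + zv 1 ^+ 2 * yv 1) - (yv 0 ^+ 2 * zv 3 + zv 0 ^+ 2 * yv 3) by ring.
apply: (idealB idR) => //; apply: (idealD idR); apply: (idealMr idR); apply: (idealX idR).
  exact: slice_radical_y0.
exact: slice_radical_z0.
Qed.

(** Equation [godd 2] becomes [a z_1 + c y_1], with [a], [c] equal to [y_2 ^ 2], [z_2 ^ 2] at the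
    jet. Eliminating [z_1] from [y_1 z_1 (y_1 + z_1)] leaves [c (a + c) y_1 ^ 3], whose coefficient
    is a unit by genericity. So [y_1] is nilpotent, then [z_1], and the chart [s = 2] applies. *)
Lemma second_order_contradiction : (2 < q)%N -> y 1%N = 0 -> z 1%N = 0 ->
  generic_pair (fun i => y i.+2) (fun i => z i.+2) -> False.
Proof.
move=> q2 y1 z1; rewrite /generic_pair !mulf_eq0 !negb_or -!andbA => /and3P[y2 z2 yz2].
have [lt1 lt2 lt3] : [/\ (1 < L)%N, (2 < L)%N & (3 < L)%N] by split; lia.
set S := chart_slice 2; have idR : is_ideal (slice_radical S) by apply: slice_radical_ideal.
have Ry0 := slice_radical_y0 S; have Rz0 := slice_radical_z0 S.
have h1 := slice_radical_godd S (ltnW q2); have h2 := slice_radical_godd S q2.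
have {}h1 : slice_radical S (yv 1 ^+ 2 * zv 1 + zv 1 ^+ 2 * yv 1).
  move: h1; rewrite godd1E addrC => h1.
  apply: (idealDK idR h1).
  by apply: (idealD idR); apply: (idealMr idR); apply: (idealX idR).
pose a := yv 2 ^+ 2 + zv 1 * yv 3; pose c := zv 2 ^+ 2 + yv 1 * zv 3.
have {}h2 : slice_radical S (a * zv 1 + c * yv 1).
  rewrite (_ : _ + _ = godd 2 yv zv - (yv 0 ^+ 2 * zv 5 + zv 0 ^+ 2 * yv 5)).
    apply: (idealB idR); first exact: h2.
    by apply: (idealD idR); apply: (idealMr idR); apply: (idealX idR).
  by rewrite godd2E /a /c; ring.
have ea : a.@[pair_pt (L := L) y z] = y 2%N ^+ 2.
  by rewrite /a mevalD !mevalM !yvar_pt !zvar_pt lt1 lt2 lt3 z1 mul0r addr0.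
have ec : c.@[pair_pt (L := L) y z] = z 2%N ^+ 2.
  by rewrite /c mevalD !mevalM !yvar_pt !zvar_pt lt1 lt2 lt3 y1 mul0r addr0.
have R2 := @mpoly_char_two k (L + L) k2.
clearbody a c.
have Ry1 : slice_radical S (yv 1).
  apply: (@slice_radicalX _ _ 3); apply: (@slice_radicalM _ (c * (a + c))).
    by rewrite mevalM mevalD ea ec -sqrD_char_two // mulf_neq0 ?expf_neq0.
  have -> : c * (a + c) * yv 1 ^+ 3 =
    a ^+ 2 * (yv 1 ^+ 2 * zv 1 + zv 1 ^+ 2 * yv 1)
    - (a * zv 1 + c * yv 1) * (yv 1 * (a * zv 1 - c * yv 1) + a * yv 1 ^+ 2)
    + (a * c * yv 1 ^+ 3 + a * c * yv 1 ^+ 3) by ring.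
  rewrite R2 addr0; apply: (idealB idR); first exact: (idealMl idR).
  exact: (idealMr idR).
apply: (@chart_contradiction 2 isT q2 _ z1 y2).
- by case=> [|[|]].
- by case=> [|[|i]] lti; [exact: Ry0 | exact: Ry1 | by []].
apply: (@slice_radicalM _ a); first by rewrite ea expf_neq0.
by apply: (idealDK idR h2); apply: (idealMl idR).
Qed.

End LocalAnalysis.

(** * Density of the generic pairs *)

Section Density.
Variables (k : closedFieldType) (k2 : char_two k).

Definition vanishes_generically L q (P : {mpoly k[L + L]}) : Prop :=
  forall y z, jet_eqs q y z -> generic_pair y z -> P.@[pair_pt (L := L) y z] = 0.

(** The local analysis asks for sequences that are zero from [L] on; truncation changes neither
    evaluations nor the equations considered. *)
Definition truncated L (u : nat -> k) i := if (i < L)%N then u i else 0.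

Lemma truncated_out L u i : (L <= i)%N -> truncated L u i = 0.
Proof. by rewrite /truncated ltnNge => ->. Qed.

Lemma truncatedE L u i : (i < L)%N -> truncated L u i = u i.
Proof. by rewrite /truncated => ->. Qed.

Lemma truncated_eval L (P : {mpoly k[L + L]}) (y z : nat -> k) :
  P.@[pair_pt (L := L) (truncated L y) (truncated L z)] = P.@[pair_pt (L := L) y z].
Proof. by apply: ev_ext => i lti; rewrite truncatedE. Qed.

Lemma truncated_eqs L q y z : (0 < L)%N -> (q.*2 <= L)%N -> jet_eqs q y z ->
  jet_eqs q (truncated L y) (truncated L z).
Proof. by move=> L0 leqL; apply: (eq_jet_eqs L0 leqL) => i lti; rewrite truncatedE. Qed.

Lemma vanishes_nonzero L q (P : {mpoly k[L + L]}) y z : (0 < L)%N -> (q.*2 <= L)%N ->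
  vanishes_generically q P -> jet_eqs q y z -> (y 0%N != 0) || (z 0%N != 0) ->
  P.@[pair_pt (L := L) y z] = 0.
Proof.
move=> L0 leqL PW W.
have key (X : {mpoly k[L + L]}) : X.@[pair_pt (L := L) y z] != 0 ->
    (exists N, in_ideal k (godd_seq k L q) (X ^+ N * P ^+ 2)) -> P.@[pair_pt (L := L) y z] = 0.
  move=> X0 [N /(godd_seq_eval L0 leqL W)]; rewrite mevalM !(rmorphXn (meval _)) /=.
  by move/eqP; rewrite mulf_eq0 !expf_eq0 (negbTE X0) andbF => /eqP.
case/orP => [y0|z0]; [apply: (key (yvar k L 0)) | apply: (key (zvar k L 0))].
- by rewrite yvar_pt L0.
- exact: yvar_certificate.
- by rewrite zvar_pt L0.
- exact: zvar_certificate.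
Qed.

Section FixedDepth.
Variables (L q : nat).
Hypotheses (L_gt0 : (0 < L)%N) (leqL : (q.*2 <= L)%N).
Local Notation ev P y z := (P.@[pair_pt (L := L) y z]).

Lemma vanishes_small (P : {mpoly k[L + L]}) y z : (q <= 1)%N -> vanishes_generically q P ->
  jet_eqs q y z -> ev P y z = 0.
Proof.
move=> q1 PW W; have [/orP nz|] := boolP ((y 0%N != 0) || (z 0%N != 0)).
  by apply: vanishes_nonzero W _ => //; apply/orP.
rewrite negb_or !negbK => /andP[/eqP y0 /eqP z0].
apply/eqP/negPn/negP; rewrite -truncated_eval => Pyz.
apply: (small_contradiction k2 L_gt0 leqL PW _ _ (truncated_eqs L_gt0 leqL W) Pyz) => //;
  by [exact: truncated_out | rewrite /generic_pair ?truncatedE].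
Qed.

Lemma vanishes_first_order (P : {mpoly k[L + L]}) y z : (1 < q)%N -> vanishes_generically q P ->
  jet_eqs q y z -> y 0%N = 0 -> z 0%N = 0 -> z 1%N = 0 -> y 1%N != 0 -> ev P y z = 0.
Proof.
move=> q1 PW W y0 z0 z1 y1; apply/eqP/negPn/negP; rewrite -truncated_eval => Pyz.
have lt1 : (1 < L)%N by lia.
apply: (first_order_contradiction k2 L_gt0 leqL PW _ _ (truncated_eqs L_gt0 leqL W) Pyz) => //;
  by [exact: truncated_out | rewrite /generic_pair ?truncatedE].
Qed.

Lemma vanishes_second_order (P : {mpoly k[L + L]}) y z : (2 < q)%N -> vanishes_generically q P ->
  jet_eqs q y z -> y 0%N = 0 -> z 0%N = 0 -> y 1%N = 0 -> z 1%N = 0 ->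
  generic_pair (fun i => y i.+2) (fun i => z i.+2) -> ev P y z = 0.
Proof.
move=> q2 PW W y0 z0 y1 z1 g; apply/eqP/negPn/negP; rewrite -truncated_eval => Pyz.
have [lt1 lt2] : (1 < L)%N /\ (2 < L)%N by lia.
apply: (second_order_contradiction k2 L_gt0 leqL PW _ _ (truncated_eqs L_gt0 leqL W) Pyz) => //;
  by [exact: truncated_out | rewrite /generic_pair ?truncatedE].
Qed.

(** When [y_0 = z_0 = 0], equation [godd 1] says that [y_1], [z_1] or [y_1 + z_1] is 0, and a
    symmetry moves the jet to the case [z_1 = 0]. *)
Lemma vanishes_order_one (P : {mpoly k[L + L]}) y z : (1 < q)%N -> vanishes_generically q P ->
  jet_eqs q y z -> (y 1%N != 0) || (z 1%N != 0) -> ev P y z = 0.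
Proof.
move=> q1 PW W nz1; have [/orP nz|] := boolP ((y 0%N != 0) || (z 0%N != 0)).
  by apply: vanishes_nonzero W _ => //; apply/orP.
rewrite negb_or !negbK => /andP[/eqP y0 /eqP z0].
have := W 1%N q1; rewrite godd1E y0 z0 !expr0n /= !mul0r !add0r => /eqP.
have -> : y 1%N ^+ 2 * z 1%N + z 1%N ^+ 2 * y 1%N = y 1%N * z 1%N * (y 1%N + z 1%N) by ring.
rewrite !mulf_eq0 => /orP[/orP[]|] /eqP e1.
- rewrite -ev_swap; apply: vanishes_first_order => //.
  + by move=> y' z' W' g; rewrite ev_swap; apply: PW; [apply: jet_eqs_swap | rewrite generic_swap].
  + exact: jet_eqs_swap.
  + by move: nz1; rewrite e1 eqxx.
- by apply: vanishes_first_order => //; move: nz1; rewrite e1 eqxx orbF.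
have ez : z 1%N = y 1%N by rewrite -[z 1%N](oppr_char_two k2); apply/esym/eqP; rewrite -addr_eq0 e1.
have e : ev P y z = ev (P \mPo pair_subst L (yvar k L) (fun i => yvar k L i + zvar k L i)) y (fun i => y i + z i).
  by rewrite ev_shear; apply: ev_ext => // i _; rewrite addrA k2 add0r.
rewrite e; apply: vanishes_first_order => //.
- by move=> y' z' W' g; rewrite ev_shear; apply: PW; [apply: jet_eqs_shear | rewrite generic_shear].
- exact: jet_eqs_shear.
- by rewrite y0 z0 addr0.
- by move: nz1; rewrite ez orbb.
Qed.

End FixedDepth.

Lemma jet_eqs_shift q (y z : nat -> k) :
  (forall i, (i < 2)%N -> y i = 0) -> (forall i, (i < 2)%N -> z i = 0) ->
  jet_eqs q y z <-> jet_eqs (q - 3) (fun i => y i.+2) (fun i => z i.+2).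
Proof.
move=> y0 z0; split=> W j ltj.
  rewrite /godd -gcoef_shift //; have := W j.+3; rewrite /godd; apply; lia.
have [lt3|le3] := ltnP j 3; first by apply: gcoef_low => //; lia.
have := W (j - 3)%N; rewrite /godd -gcoef_shift //.
have -> : ((j - 3).*2.+1.+4.+2 = j.*2.+1)%N by lia.
by apply; lia.
Qed.

Lemma generic_dense q L (P : {mpoly k[L + L]}) : (0 < L)%N -> (q.*2 <= L)%N ->
  vanishes_generically q P -> forall y z, jet_eqs q y z -> P.@[pair_pt (L := L) y z] = 0.
Proof.
elim/ltn_ind: q L P => q IHq L P L0 leqL PW y z W.
have [q1|q1] := leqP q 1; first exact: (@vanishes_small L q).
have [/orP nz|] := boolP ((y 0%N != 0) || (z 0%N != 0)).
  by apply: (@vanishes_nonzero L q) => //; apply/orP.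
rewrite negb_or !negbK => /andP[/eqP y0 /eqP z0].
have [/orP nz|] := boolP ((y 1%N != 0) || (z 1%N != 0)).
  by apply: (@vanishes_order_one L q) => //; apply/orP.
rewrite negb_or !negbK => /andP[/eqP y1 /eqP z1].
have [q2|q2] := leqP q 2.
  (* The second-order argument needs a third equation. For [q = 2], the pairs with
     [y_0 = z_0 = z_1 = 0] all satisfy both equations and form an affine space, in which [y_1 <> 0]
     is dense. *)
  have eq2 : q = 2%N by lia.
  pose f i := if (i == 0)%N then 0 else yvar k L i.
  pose g i := if (i < 2)%N then 0 else zvar k L i.
  have PX : (P \mPo pair_subst L f g) * yvar k L 1 = 0.
    apply: mpoly_vanish => v; rewrite mevalM.
    have [->|nz] := eqVneq (yvar k L 1).@[v] 0; first by rewrite mulr0.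
    rewrite pair_subst_eval (@vanishes_order_one L q) ?mul0r //; last by rewrite /f /= nz.
    rewrite eq2 => -[|[|//]] _; rewrite ?godd0E ?godd1E /f /g /= !meval0 expr0n /=.
      by rewrite !mul0r addr0.
    by rewrite !mul0r mulr0 !addr0.
  have ltL1 : (1 < L)%N by lia.
  move/eqP: PX; rewrite mulf_eq0 => /orP[/eqP P0|/eqP y10]; last first.
    have := congr1 (meval (pair_pt (L := L) (fun=> 1) (fun=> 1))) y10.
    by rewrite yvar_pt ltL1 meval0 => /eqP; rewrite oner_eq0.
  have := congr1 (meval (pair_pt (L := L) y z)) P0; rewrite pair_subst_eval meval0 => <-.
  apply: ev_ext => i lti; rewrite /f /g.
    by case: eqP => [->|_]; rewrite ?meval0 // yvar_pt lti.
  case: ltnP => [|_]; last by rewrite zvar_pt lti.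
  by case: i {lti} => [|[|//]] _; rewrite meval0.
(* Composing with [f], [g] restricts [P] to pairs divisible by [t ^ 2]. Its vanishing at generic
   shifted pairs is the second-order case. *)
pose L' := (L - 2)%N; have L'0 : (0 < L')%N by rewrite /L'; lia.
have leqL' : ((q - 3).*2 <= L')%N by rewrite /L'; lia.
pose f i := if (i < 2)%N then 0 else yvar k L' (i - 2).
pose g i := if (i < 2)%N then 0 else zvar k L' (i - 2).
have fE y' z' i : (f i).@[pair_pt (L := L') y' z'] =
    if (i < 2)%N then 0 else if (i - 2 < L')%N then y' (i - 2)%N else 0.
  by rewrite /f; case: ifP; rewrite ?meval0 ?yvar_pt.
have gE y' z' i : (g i).@[pair_pt (L := L') y' z'] =
    if (i < 2)%N then 0 else if (i - 2 < L')%N then z' (i - 2)%N else 0.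
  by rewrite /g; case: ifP; rewrite ?meval0 ?zvar_pt.
have low (u : nat -> k) : u 0%N = 0 -> u 1%N = 0 -> forall i, (i < 2)%N -> u i = 0.
  by move=> u0 u1 [|[|]].
have W' : jet_eqs (q - 3) (fun i => y i.+2) (fun i => z i.+2).
  by have sh := jet_eqs_shift q (low y y0 y1) (low z z0 z1); apply/sh.
have := IHq (q - 3)%N _ L' (P \mPo pair_subst L f g) L'0 leqL' _ _ _ W'.
rewrite pair_subst_eval => h; rewrite -[RHS]h.
- apply: ev_ext => i lti; rewrite ?fE ?gE; case: i lti => [|[|i]] lti //=.
    by rewrite subn2 /= ifT // /L'; lia.
  by rewrite subn2 /= ifT // /L'; lia.
- lia.
move=> y' z' {}W' gen; rewrite pair_subst_eval.
pose yy i := if (i < 2)%N then 0 else y' (i - 2)%N.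
pose zz i := if (i < 2)%N then 0 else z' (i - 2)%N.
have -> : P.@[pair_pt (L := L) (fun i => (f i).@[pair_pt (L := L') y' z'])
     (fun i => (g i).@[pair_pt (L := L') y' z'])] = P.@[pair_pt (L := L) yy zz].
  apply: ev_ext => i lti; rewrite ?fE ?gE /yy /zz; case: ifP => // ge2;
    by rewrite ifT // /L'; lia.
apply: (@vanishes_second_order L q) => //.
- apply/jet_eqs_shift; [by case=> [|[|]] | by case=> [|[|]] |].
  move=> j ltj; rewrite -[RHS](W' j ltj); apply: eq_gcoef => i _; rewrite /yy /zz /=;
    by rewrite subn2.
Qed.

End Density.

(** * The jet space in coordinates *)

Lemma closed_sqrt_exists (k : closedFieldType) (a : k) : exists x, x ^+ 2 == a.
Proof.
have [x] := solve_monicpoly (fun i => if i == 0%N then a else 0) (isT : (0 < 2)%N).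
by rewrite big_ord_recr big_ord1 /= mulr1 mul0r addr0 => /eqP; exists x.
Qed.

Definition closed_sqrt (k : closedFieldType) (a : k) : k := xchoose (closed_sqrt_exists a).

Lemma closed_sqrtK (k : closedFieldType) (a : k) : closed_sqrt a ^+ 2 = a.
Proof. exact/eqP/(xchooseP (closed_sqrt_exists a)). Qed.

Lemma char_two_sqr_inj (k : fieldType) : char_two k -> injective (fun x : k => x ^+ 2).
Proof.
move=> k2 a b /= ab; apply/eqP; rewrite -subr_eq0 (oppr_char_two k2) -[_ == 0](sqrf_eq0 (a + b)).
by rewrite sqrD_char_two // ab k2.
Qed.

(* Locked, lest unification compare the polynomials [Yt] and [Zt]. *)
HB.lock Definition jx (k : closedFieldType) (m i : nat) : Rm k m := (Xt k m)`_i.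
HB.lock Definition jy (k : closedFieldType) (m i : nat) : Rm k m := (Yt k m)`_i.
HB.lock Definition jz (k : closedFieldType) (m i : nat) : Rm k m := (Zt k m)`_i.

Section JetSpace.
Variables (k : closedFieldType) (m : nat).
Local Notation N := (nv m).
Local Notation jx := (jx k m). Local Notation jy := (jy k m). Local Notation jz := (jz k m).

Lemma coef_sum_monomials (R : nzRingType) (u : nat -> R) i :
  (\sum_(j < m.+1) (u j)%:P * 'X^j)`_i = if (i <= m)%N then u i else 0.
Proof.
rewrite coef_sum; case: leqP => [lei|lti]; last first.
  rewrite big1 // => j _; rewrite coefCM coefXn; case: eqP => [e|]; last by rewrite mulr0.
  by have := ltn_ord j; rewrite -e; lia.
have lti : (i < m.+1)%N by [].
rewrite (bigD1 (Ordinal lti)) //= coefCM coefXn eqxx mulr1 big1 ?addr0 // => j ne_j.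
rewrite coefCM coefXn; case: eqP => [e|]; last by rewrite mulr0.
by case/eqP: ne_j; apply: val_inj.
Qed.

Lemma jxE i : jx i = if (i <= m)%N then xv k m i else 0.
Proof. by rewrite jx.unlock; apply: (coef_sum_monomials (xv k m)). Qed.
Lemma jyE i : jy i = if (i <= m)%N then yv k m i else 0.
Proof. by rewrite jy.unlock; apply: (coef_sum_monomials (yv k m)). Qed.
Lemma jzE i : jz i = if (i <= m)%N then zv k m i else 0.
Proof. by rewrite jz.unlock; apply: (coef_sum_monomials (zv k m)). Qed.

Lemma fjetE : char_two k -> forall j,
  fjet k m j = (if odd j then 0 else jx j./2 ^+ 2) + gcoef j jy jz.
Proof.
move=> k2 j; rewrite /fjet coef_jet; last exact: mpoly_char_two.
by congr (_ + _); [rewrite jx.unlock | apply: eq_gcoef => i _; rewrite ?jy.unlock ?jz.unlock].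
Qed.

Definition jet_fn (T : Type) (x y z : nat -> T) (i : 'I_N) : T :=
  if (i < m.+1)%N then x i
  else if (i < m.+1 + m.+1)%N then y (i - m.+1)%N else z (i - (m.+1 + m.+1))%N.

Lemma nv_lt i : (i < N)%N = (i < m.+1 + m.+1 + m.+1)%N.
Proof. by rewrite /nv; apply/idP/idP; lia. Qed.

Section Pointwise.
Variable T : Type.
Implicit Types x y z : nat -> T.

Lemma jet_fn_x x y z i : (i <= m)%N -> jet_fn x y z (inord i) = x i.
Proof. by move=> lei; rewrite /jet_fn inordK ?ltnS ?lei // /nv; lia. Qed.
Lemma jet_fn_y x y z i : (i <= m)%N -> jet_fn x y z (inord (m.+1 + i)) = y i.
Proof.
move=> lei; rewrite /jet_fn inordK ?nv_lt; last by lia.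
by rewrite ltnNge leq_addr /= ltn_add2l ltnS lei addKn.
Qed.
Lemma jet_fn_z x y z i : (i <= m)%N -> jet_fn x y z (inord (m.+1 + m.+1 + i)) = z i.
Proof.
move=> lei; rewrite /jet_fn inordK ?nv_lt; last by lia.
rewrite ifF; last by lia.
by rewrite ifF ?addKn //; lia.
Qed.

Lemma jet_fn_split (P : 'I_N -> Prop) :
  (forall i, (i <= m)%N -> P (inord i)) -> (forall i, (i <= m)%N -> P (inord (m.+1 + i))) ->
  (forall i, (i <= m)%N -> P (inord (m.+1 + m.+1 + i))) -> forall i, P i.
Proof.
move=> Px Py Pz i; have lti := ltn_ord i; rewrite nv_lt in lti; rewrite -(inord_val i).
have [lt1|le1] := ltnP i m.+1; first exact: Px.
have [lt2|le2] := ltnP i (m.+1 + m.+1).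
  by rewrite -(subnKC le1); apply: Py; lia.
by rewrite -(subnKC le2); apply: Pz; lia.
Qed.

Lemma eq_jet_fn x y z x' y' z' : (forall i, (i <= m)%N -> x i = x' i) ->
  (forall i, (i <= m)%N -> y i = y' i) -> (forall i, (i <= m)%N -> z i = z' i) ->
  jet_fn x y z =1 jet_fn x' y' z'.
Proof.
move=> ex ey ez; apply: jet_fn_split => i lei.
- by rewrite !jet_fn_x // ex.
- by rewrite !jet_fn_y // ey.
- by rewrite !jet_fn_z // ez.
Qed.

End Pointwise.

Lemma jx_eval x y z i : (jx i).@[jet_fn x y z] = if (i <= m)%N then x i else 0.
Proof.
by rewrite jxE; case: ifP => lei; rewrite ?meval0 // /xv mevalXU jet_fn_x.
Qed.
Lemma jy_eval x y z i : (jy i).@[jet_fn x y z] = if (i <= m)%N then y i else 0.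
Proof. by rewrite jyE; case: ifP => lei; rewrite ?meval0 // /yv mevalXU jet_fn_y. Qed.
Lemma jz_eval x y z i : (jz i).@[jet_fn x y z] = if (i <= m)%N then z i else 0.
Proof. by rewrite jzE; case: ifP => lei; rewrite ?meval0 // /zv mevalXU jet_fn_z. Qed.

Lemma jet_fnE (v : pt k N) :
  v =1 jet_fn (fun i => (jx i).@[v]) (fun i => (jy i).@[v]) (fun i => (jz i).@[v]).
Proof.
apply: jet_fn_split => i lei.
- by rewrite jet_fn_x // jxE lei mevalXU.
- by rewrite jet_fn_y // jyE lei mevalXU.
- by rewrite jet_fn_z // jzE lei mevalXU.
Qed.

Lemma jet_fn_meval n (x y z : nat -> {mpoly k[n]}) w i :
  (jet_fn x y z i).@[w] = jet_fn (fun i => (x i).@[w]) (fun i => (y i).@[w]) (fun i => (z i).@[w]) i.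
Proof. by rewrite /jet_fn; case: ifP => // _; case: ifP. Qed.

Definition is_jet (v : pt k N) : Prop := forall j, (j <= m)%N -> (fjet k m j).@[v] = 0.

Lemma fjets_eval (v : pt k N) : is_jet v <-> forall g, g \in fjets k m -> g.@[v] = 0.
Proof.
split=> [jv g /mapP [j]|h j lej]; first by rewrite mem_iota => /andP[_ ltj] ->; apply: jv.
by apply: h; apply: map_f; rewrite mem_iota.
Qed.

Hypothesis k2 : char_two k.

(** The odd indices up to [m] number [(m.+1)./2]: this is the [q] of the charts. *)
Lemma is_jetP (v : pt k N) : is_jet v <->
  jet_eqs (m.+1)./2 (fun i => (jy i).@[v]) (fun i => (jz i).@[v]) /\
  forall i, (i <= m./2)%N -> (jx i).@[v] ^+ 2
    = gcoef i.*2 (fun i => (jy i).@[v]) (fun i => (jz i).@[v]).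
Proof.
have e j : (fjet k m j).@[v] = (if odd j then 0 else (jx j./2).@[v] ^+ 2)
    + gcoef j (fun i => (jy i).@[v]) (fun i => (jz i).@[v]).
  rewrite fjetE // mevalD (gcoef_rmorph (meval v)); congr (_ + _).
  by case: (odd j); rewrite ?meval0 ?(rmorphXn (meval v)).
have hm := odd_double_half m; have hm1 := odd_double_half m.+1.
split=> [jv|[W hx] j lej].
  split=> [j ltj|i lei].
    have := jv j.*2.+1; rewrite e /= odd_double /= add0r; apply; lia.
  have := jv i.*2; rewrite e odd_double doubleK => h; apply/eqP.
  by rewrite -subr_eq0 (oppr_char_two k2) h //; lia.
rewrite e; have := odd_double_half j; case: (odd j) => /= ej.
  by rewrite add0r -ej; apply: W; lia.
rewrite add0n in ej; rewrite hx; last by lia.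
by rewrite ej k2.
Qed.

End JetSpace.

(** On the chart the equations of index at most [s] are identities, so only those solved for some
    [z_{2j+1}] remain. *)
Lemma godd_low (A : comNzRingType) s j (y z : nat -> A) : (0 < s <= 2)%N ->
  (forall i, (i < s)%N -> y i = 0) -> z 0%N = 0 -> z 1%N = 0 -> (j <= s)%N -> godd j y z = 0.
Proof.
move=> /andP[s0 s2] y0 z0 z1 lej; have [|] := leqP j 1; first case: j lej => [|[|//]] lej _.
- by rewrite godd0E z1 z0 expr0n /= mul0r mulr0 addr0.
- by rewrite godd1E z1 z0 y0 // expr0n /= !mul0r mulr0 !addr0.
move=> lt1; have -> : j = 2%N by lia.
by rewrite godd2E z1 z0 (y0 0%N) // (y0 1%N) ?expr0n /= ?mul0r ?mulr0 ?addr0 //; lia.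
Qed.

Lemma godd_chart_all (A : comNzRingType) s q (y z : nat -> A) : (0 < s <= 2)%N ->
  (forall i, (i < s)%N -> y i = 0) -> z 0%N = 0 -> z 1%N = 0 ->
  (forall j, (s <= j.*2)%N -> (j + s < q)%N -> godd (j + s) y z = 0) ->
  forall j, (j < q)%N -> godd j y z = 0.
Proof.
move=> s02 y0 z0 z1 h j ltj; have [lej|ltsj] := leqP j s; first exact: (@godd_low _ s).
by rewrite -(subnK (ltnW ltsj)); apply: h; lia.
Qed.

(** For [m >= 5] there are at least three odd equations, as the count of free variables for [s = 2]
    requires. *)
Lemma half_succ m : (5 <= m)%N ->
  (m.+1./2 + m./2 = m)%N /\ (m.+1./2 <= m)%N /\ (m.+1./2.*2 <= m.+1)%N /\ (2 < m.+1./2)%N.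
Proof.
move=> hm; have := odd_double_half m; have := odd_double_half m.+1.
by rewrite /=; case: (odd m) => /=; lia.
Qed.

(** * Polynomial parametrization of the charts *)

Section ChartParametrization.
Variables (k : closedFieldType) (k2 : char_two k) (m s : nat).
Hypotheses (hm : (5 <= m)%N) (s02 : (0 < s <= 2)%N).
Local Notation N := (nv m).
Local Notation q := (m.+1)./2.
Local Notation jx := (jx k m). Local Notation jy := (jy k m). Local Notation jz := (jz k m).

(** It is the zero set of [J2] for [s = 1] and that of [I0] for [s = 2]. *)
Definition chart_locus (v : pt k N) : Prop :=
  [/\ is_jet v, forall i, (i < s)%N -> (jy i).@[v] = 0, (jz 0).@[v] = 0 & (jz 1).@[v] = 0].

(** With [U s = 1] the system is solved over the polynomial ring itself; scaling by a variable
    recovers arbitrary [y_s], the equations being homogeneous. *)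
Lemma chart_family : exists U V : nat -> Rm k m,
  [/\ forall i, U i = if (i < s)%N then 0 else if i == s then 1 else jy i,
      forall i, ~~ solved s q i -> V i = if (i <= 1)%N then 0 else jz i
    & forall j, (j < q)%N -> godd j U V = 0].
Proof.
pose U i : Rm k m := if (i < s)%N then 0 else if i == s then 1 else jy i.
pose V0 i : Rm k m := if (i <= 1)%N then 0 else jz i.
have U0 i : (i < s)%N -> U i = 0 by rewrite /U => ->.
have Us : U s = 1 by rewrite /U ltnn eqxx.
have s2 : (s <= 2)%N by case/andP: s02.
have [|V [V_eq VG]] := @chart_exists _ s q U 1 V0 s2 U0; first by rewrite Us expr1n mulr1.
exists U, V; split=> //; apply: (godd_chart_all s02 U0) => //; rewrite V_eq //.
by rewrite /solved; lia.
Qed.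

(** The free parameters besides [y_s]: the [x_i] missing from the even equations, the later [y_i],
    and the unsolved [z_i]. Their number [(m - m./2) + (m - s) + (m - 1 - (q - s - 1))] is [2 m] for
    both values of [s], since [q + m./2 = m]. *)
Definition free_rest : seq nat :=
  iota (m./2).+1 (m - m./2) ++ [seq (m.+1 + i)%N | i <- iota s.+1 (m - s)] ++
  [seq (m.+1 + m.+1 + i)%N | i <- [seq i <- iota 2 m.-1 | ~~ solved s q i]].

Lemma size_free_rest : size free_rest = (2 * m)%N.
Proof.
have [h1 [h2 [h3 h4]]] := half_succ hm.
rewrite /free_rest !size_cat !size_map !size_iota.
have e : size [seq i <- iota 2 m.-1 | solved s q i] = (q - s.+1)%N.
  rewrite -[RHS](size_iota 1) -[RHS](size_map (fun j => j.*2.+1)); apply: perm_size.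
  apply: uniq_perm; first by rewrite filter_uniq // iota_uniq.
    by rewrite map_inj_uniq ?iota_uniq // => a b; lia.
  move=> i; rewrite mem_filter mem_iota; apply/idP/mapP => [/andP[/solvedP [j -> [g1 g2]] lti]|[j]].
    by exists j => //; rewrite mem_iota; lia.
  by rewrite mem_iota => hj ->; rewrite solved_odd; lia.
have := count_predC (solved s q) (iota 2 m.-1); rewrite -!size_filter e size_iota => e2.
rewrite (_ : size [seq i <- iota 2 m.-1 | ~~ solved s q i] = m.-1 - (q - s.+1))%N; last first.
  rewrite -[in RHS]e2 addKn //.
lia.
Qed.

Lemma free_uniq : uniq ((m.+1 + s)%N :: free_rest).
Proof.
have [h1 [h2 [h3 h4]]] := half_succ hm.
rewrite /free_rest /= !cat_uniq iota_uniq !map_inj_uniq ?filter_uniq ?iota_uniq /=;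
  try by move=> a b; lia.
rewrite !mem_cat mem_iota !negb_or andbT; apply/and3P; split.
- apply/and3P; split; first by lia.
    by apply/mapP => -[i]; rewrite mem_iota; lia.
  by apply/mapP => -[i _]; lia.
- apply/hasPn => i; rewrite mem_cat mem_iota => /orP[] /mapP [j]; rewrite ?mem_filter !mem_iota; lia.
- by apply/hasPn => i /mapP [j _ ->]; apply/mapP => -[l]; rewrite mem_iota; lia.
- by [].
Qed.

Lemma free_lt i : i \in (m.+1 + s)%N :: free_rest -> (i < N)%N.
Proof.
have [h1 [h2 [h3 h4]]] := half_succ hm.
rewrite nv_lt inE /free_rest !mem_cat mem_iota => /or4P[/eqP ->||/mapP [j]|/mapP [j]]; try lia.
- by rewrite mem_iota; lia.
- by rewrite mem_filter mem_iota; lia.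
Qed.

Lemma free_x i : (i <= m)%N -> (i \in (m.+1 + s)%N :: free_rest) = (m./2 < i)%N.
Proof.
have [h1 [h2 [h3 h4]]] := half_succ hm.
move=> lei; rewrite inE /free_rest !mem_cat mem_iota; apply/idP/idP.
  case/or4P => [/eqP ->||/mapP [j _ ->]|/mapP [j _ ->]]; lia.
by move=> lti; apply/orP; right; apply/orP; left; lia.
Qed.

Lemma free_y i : (i <= m)%N -> ((m.+1 + i)%N \in (m.+1 + s)%N :: free_rest) = (s <= i)%N.
Proof.
have [h1 [h2 [h3 h4]]] := half_succ hm.
move=> lei; rewrite inE /free_rest !mem_cat mem_iota; apply/idP/idP.
  case/or4P => [/eqP||/mapP [j]|/mapP [j]]; rewrite ?mem_iota; lia.
rewrite leq_eqVlt => /orP[/eqP ->|lti]; first by rewrite eqxx.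
by apply/or4P; apply: Or43; apply/mapP; exists i => //; rewrite mem_iota; lia.
Qed.

Lemma free_z i : (i <= m)%N ->
  ((m.+1 + m.+1 + i)%N \in (m.+1 + s)%N :: free_rest) = (1 < i)%N && ~~ solved s q i.
Proof.
have [h1 [h2 [h3 h4]]] := half_succ hm.
move=> lei; rewrite inE /free_rest !mem_cat mem_iota; apply/idP/idP.
  case/or4P => [/eqP||/mapP [j]|/mapP [j]]; rewrite ?mem_filter ?mem_iota; try lia.
  move=> /andP[ns hj] e; have -> : i = j by lia.
  by rewrite ns andbT; lia.
move=> /andP[lt1 ns]; apply/or4P; apply: Or44; apply/mapP; exists i => //.
by rewrite mem_filter mem_iota ns; lia.
Qed.

Lemma mem_map_inord (l : seq nat) (i : nat) : (forall j, j \in l -> (j < N)%N) -> (i < N)%N ->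
  ((inord i : 'I_N) \in [seq (inord j : 'I_N) | j <- l]) = (i \in l).
Proof.
move=> lN iN; apply/mapP/idP => [[j jl e]|il]; last by exists i.
have /(congr1 val) := e; rewrite /= !inordK => [->//||//]; exact: lN.
Qed.

Lemma chart_dim (A : pt k N -> Prop) :
  (forall v, A v <-> forall P : Rm k m,
     (forall u, chart_locus u -> (jy s).@[u] != 0 -> P.@[u] = 0) -> P.@[v] = 0) ->
  irreducible k A /\ dim_eq k A (2 * m + 1).
Proof.
move=> hA; have [h1 [h2 [h3 h4]]] := half_succ hm; have [s0 s2] := andP s02.
have sm : (s <= m)%N by lia.
have [U [V [UE VE UV]]] := chart_family.
pose h : 'I_N := inord (m.+1 + s).
(* These are square roots of the coordinates [y], [z]; in particular [y_s] is the square of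
   ['X_h]. *)
pose eta i := 'X_h * U i; pose zeta i := 'X_h * V i.
have eta_zeta j : (j < q)%N -> godd j eta zeta = 0.
  by move=> ltj; rewrite /godd gcoef_scale -/(godd j U V) UV // mulr0.
pose xi i := if (i <= m./2)%N then gcoef i.*2 eta zeta else jx i.
pose psi := jet_fn (m := m) xi (fun i => eta i ^+ 2) (fun i => zeta i ^+ 2).
pose S := [seq (inord j : 'I_N) | j <- free_rest].
have SE i : (i < N)%N -> ((inord i : 'I_N) \in h :: S) = (i \in (m.+1 + s)%N :: free_rest).
  by move=> lti; rewrite -(mem_map_inord free_lt).
have nsolved i : (m < i)%N -> ~~ solved s q i.
  by move=> lti; apply/negP => /solvedP [j ej []]; lia.
have jx_out i : (m < i)%N -> jx i = 0 by rewrite jxE ltnNge => /negbTE ->.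
have jy_out i : (m < i)%N -> jy i = 0 by rewrite jyE ltnNge => /negbTE ->.
have jz_out i : (m < i)%N -> jz i = 0 by rewrite jzE ltnNge => /negbTE ->.
have eta_out i : (m < i)%N -> eta i = 0.
  by move=> lti; rewrite /eta UE jy_out // ifF ?ifF ?mulr0 //; lia.
have zeta_out i : (m < i)%N -> zeta i = 0.
  by move=> lti; rewrite /zeta VE ?nsolved // jz_out // if_same mulr0.
have ev_psi (P : Rm k m) w : P.@[fun i => (psi i).@[w]] =
    P.@[jet_fn (fun i => (xi i).@[w]) (fun i => (eta i).@[w] ^+ 2) (fun i => (zeta i).@[w] ^+ 2)].
  apply: meval_eq => i; rewrite jet_fn_meval; apply: eq_jet_fn => // l _;
    exact: (rmorphXn (meval w)).
have psi_y w i : (jy i).@[fun i => (psi i).@[w]] = (eta i).@[w] ^+ 2.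
  by rewrite ev_psi jy_eval; case: leqP => // lti; rewrite eta_out // meval0 expr0n.
have psi_z w i : (jz i).@[fun i => (psi i).@[w]] = (zeta i).@[w] ^+ 2.
  by rewrite ev_psi jz_eval; case: leqP => // lti; rewrite zeta_out // meval0 expr0n.
have psi_x w i : (i <= m)%N -> (jx i).@[fun i => (psi i).@[w]] = (xi i).@[w].
  by move=> lei; rewrite ev_psi jx_eval lei.
have psi_g w j : gcoef j (fun i => (jy i).@[fun i => (psi i).@[w]])
    (fun i => (jz i).@[fun i => (psi i).@[w]]) = (gcoef j eta zeta).@[w] ^+ 2.
  rewrite (gcoef_rmorph (meval w)) -(gcoef_sqr k2).
  by apply: eq_gcoef => l _; [exact: psi_y | exact: psi_z].
have psi_locus w : chart_locus (fun i => (psi i).@[w]).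
  split.
  - apply/(is_jetP k2); split=> [j ltj|i lei].
      by rewrite /godd psi_g -/(godd j eta zeta) (eta_zeta j ltj) meval0 expr0n.
    rewrite psi_x; last by lia.
    by rewrite psi_g /xi lei.
  - by move=> i lti; rewrite psi_y /eta UE lti mulr0 meval0 expr0n.
  - by rewrite psi_z /zeta VE ?mulr0 ?meval0 ?expr0n.
  - by rewrite psi_z /zeta VE ?mulr0 ?meval0 ?expr0n // /solved; lia.
(* Every jet of the open chart is attained: take square roots of its [y] and [z], and divide by that
   of [y_s]. *)
have surj v : chart_locus v -> (jy s).@[v] != 0 -> exists2 w,
    (forall i, i \notin h :: S -> w i = 0) & (fun i => (psi i).@[w]) =1 v.
  move=> [jv y0 z0 z1] ys; have [W hx] := (is_jetP k2 v).1 jv.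
  have [y yK] : exists y : nat -> k, forall i, y i ^+ 2 = (jy i).@[v].
    by exists (fun i => closed_sqrt (jy i).@[v]) => i; apply: closed_sqrtK.
  have [z zK] : exists z : nat -> k, forall i, z i ^+ 2 = (jz i).@[v].
    by exists (fun i => closed_sqrt (jz i).@[v]) => i; apply: closed_sqrtK.
  have sq0 a : a ^+ 2 = 0 -> a = 0 :> k by move/eqP; rewrite sqrf_eq0 => /eqP.
  have yz_jet j : (j < q)%N -> godd j y z = 0.
    move=> ltj; apply: sq0; rewrite /godd -(gcoef_sqr k2) -[RHS](W j ltj).
    by apply: eq_gcoef => i _; [exact: yK | exact: zK].
  have ys0 : y s != 0 by apply: contraNneq ys => ys0; rewrite -yK ys0 expr0n.
  pose w := jet_fn (m := m) (fun i => if (i <= m./2)%N then 0 else (jx i).@[v])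
     (fun i => if (i < s)%N then 0 else if i == s then y s else y i / y s)
     (fun i => if (1 < i)%N && ~~ solved s q i then z i / y s else 0).
  have wh : w h = y s by rewrite /w /h jet_fn_y // ltnn eqxx.
  have y_out i : (m < i)%N -> y i = 0.
    by move=> lti; apply: sq0; rewrite yK jy_out // meval0.
  have z_out i : (m < i)%N -> z i = 0.
    by move=> lti; apply: sq0; rewrite zK jz_out // meval0.
  have y_low i : (i < s)%N -> y i = 0 by move=> lti; apply: sq0; rewrite yK y0.
  have Uw i : (U i).@[w] = y i / y s.
    rewrite UE; case: ltnP => [lti|le_si]; first by rewrite meval0 y_low // mul0r.
    case: eqP => [->|ne_i]; first by rewrite meval1 mulfV.
    rewrite jy_eval; case: (leqP i m) => [_|lti]; last by rewrite (y_out i lti) mul0r.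
    by rewrite ltnNge le_si /=; case: eqP.
  have Vw i : (V i).@[w] = z i / y s.
    (* Both sequences solve the same triangular system with the same free coefficients. *)
    apply: (@chart_unique k s q (fun i => y i / y s) (fun i => (V i).@[w]) (fun i => z i / y s) s2).
    - by move=> l ltl; rewrite y_low // mul0r.
    - by rewrite mulfV // oner_neq0.
    - move=> j ltj; have := congr1 (meval w) (UV j ltj).
      rewrite /godd (gcoef_rmorph (meval w)) meval0 => e; rewrite -[RHS]e.
      by apply: eq_gcoef => l _; [exact: esym (Uw l) | exact: erefl].
    - move=> j ltj; rewrite /godd (eq_gcoef (y' := fun i => (y s)^-1 * y i) (z' := fun i => (y s)^-1 * z i));
        try by move=> l _; rewrite mulrC.
      by rewrite gcoef_scale -/(godd j y z) yz_jet // mulr0.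
    move=> l nl; rewrite VE //; case: leqP => [lel|ltl].
      rewrite meval0; have -> : z l = 0; last by rewrite mul0r.
      apply: sq0; rewrite zK; have [->|->] : l = 0%N \/ l = 1%N by lia.
        exact: z0.
      exact: z1.
    by rewrite jz_eval ltl nl /=; case: (leqP l m) => // ltm; rewrite (z_out l ltm) mul0r.
  have w0 : forall i, i \notin h :: S -> w i = 0.
    apply: jet_fn_split => i lei; rewrite SE ?nv_lt; try lia.
    - by rewrite free_x // -leqNgt /w jet_fn_x // => ->.
    - by rewrite free_y // -ltnNge /w jet_fn_y // => ->.
    - by rewrite free_z // /w jet_fn_z // => /negbTE ->.
  have wx l : (l <= m)%N -> (m./2 < l)%N -> (jx l).@[w] = (jx l).@[v].
    by move=> lel ltl; rewrite jx_eval lel leqNgt ltl.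
  clearbody w; exists w => //.
  have etaw i : (eta i).@[w] = y i by rewrite /eta mevalM mevalXU wh Uw mulrC divfK.
  have zetaw i : (zeta i).@[w] = z i by rewrite /zeta mevalM mevalXU wh Vw mulrC divfK.
  move=> i; rewrite [RHS](jet_fnE v) /psi jet_fn_meval; apply: eq_jet_fn => l lel.
  - rewrite /xi; case: leqP => lem; last exact: wx.
    apply: (char_two_sqr_inj k2) => /=; rewrite hx // (gcoef_rmorph (meval w)) -(gcoef_sqr k2).
    by apply: eq_gcoef => a _; [rewrite /= etaw; exact: yK | rewrite /= zetaw; exact: zK].
  - exact: etrans (rmorphXn (meval w) 2 (eta l)) (etrans (congr1 (fun x => x ^+ 2) (etaw l)) (yK l)).
  - exact: etrans (rmorphXn (meval w) 2 (zeta l)) (etrans (congr1 (fun x => x ^+ 2) (zetaw l)) (zK l)).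
have eS : (2 * m + 1 = (size S).+1)%N by rewrite size_map size_free_rest addn1.
(* The coordinates serve as test functions: at a free index, coordinate [i] of [psi] is the
   parameter itself, its square (for [h]), or the square of its product with ['X_h]. *)
rewrite eS; apply: (@parametrized_dim k N N S h psi (fun i => 'X_i) A).
- rewrite -[h :: S]/([seq (inord j : 'I_N) | j <- (m.+1 + s)%N :: free_rest]) map_inj_in_uniq ?free_uniq //.
  by move=> a b /free_lt lta /free_lt ltb /(congr1 val) /=; rewrite !inordK.
- move=> v; rewrite hA; split=> h0 P hP; apply: h0.
    move=> u lu yu; have [w w0 wE] := surj u lu yu.
    by rewrite -[RHS](hP w w0); apply: meval_eq => i; rewrite wE.
  move=> w _; have [wh|wh] := eqVneq (w h) 0; last first.
    by apply: hP => //; rewrite psi_y /eta UE ltnn eqxx mulr1 mevalXU expf_neq0.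
  (* Parameters with [w h = 0] leave the open chart; they are reached because [P] composed with
     [psi] becomes 0 after multiplication by ['X_h]. *)
  suff P0 : P \mPo [tuple psi i | i < N] = 0.
    have := congr1 (meval w) P0; rewrite meval0 comp_mpoly_meval => <-.
    by apply: meval_eq => i; rewrite tnth_mktuple.
  suff : (P \mPo [tuple psi i | i < N]) * 'X_h = 0.
    move/eqP; rewrite mulf_eq0 => /orP[/eqP //|/eqP X0].
    by have /eqP := congr1 (mcoeff U_(h)) X0; rewrite mcoeffXU eqxx mcoeff0 oner_eq0.
  apply: mpoly_vanish => w'; rewrite mevalM mevalXU comp_mpoly_meval.
  have [->|wh'] := eqVneq (w' h) 0; first by rewrite mulr0.
  rewrite (meval_eq (v2 := fun i => (psi i).@[w'])); last by move=> i; rewrite tnth_mktuple.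
  rewrite hP ?mul0r //.
  by rewrite psi_y /eta UE ltnn eqxx mulr1 mevalXU expf_neq0.
- move=> i w iS w0; rewrite mevalXU; move: i iS w0; apply: jet_fn_split => i lei; rewrite SE ?nv_lt; try lia.
  + by rewrite free_x // => lti w0; rewrite /psi jet_fn_x // /xi leqNgt lti /= jxE lei mevalXU.
  + rewrite free_y // => le_si w0; rewrite /psi jet_fn_y // (rmorphXn (meval w)) /= /eta mevalM mevalXU.
    rewrite UE ltnNge le_si /=; case: eqP => [e|_]; first by rewrite /h -e w0 mul0r expr0n.
    by rewrite jyE lei mevalXU w0 mulr0 expr0n.
  + rewrite free_z // => /andP[lti ns] w0; rewrite /psi jet_fn_z // (rmorphXn (meval w)) /= /zeta mevalM mevalXU.
    by rewrite VE // leqNgt lti /= jzE lei mevalXU w0 mulr0 expr0n.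
- move=> i w iS wi wh; rewrite mevalXU; move: i iS wi; apply: jet_fn_split => i lei; rewrite SE ?nv_lt; try lia.
  + by rewrite free_x // => lti w0; rewrite /psi jet_fn_x // /xi leqNgt lti /= jxE lei mevalXU.
  + rewrite free_y // => le_si w0; rewrite /psi jet_fn_y // (rmorphXn (meval w)) /= /eta mevalM mevalXU.
    rewrite expf_neq0 // mulf_neq0 // UE ltnNge le_si /=; have [_|_] := eqVneq i s;
      first by rewrite meval1 oner_neq0.
    by rewrite jyE lei mevalXU.
  + rewrite free_z // => /andP[lti ns] w0; rewrite /psi jet_fn_z // (rmorphXn (meval w)) /= /zeta mevalM mevalXU.
    by rewrite expf_neq0 // mulf_neq0 // VE // leqNgt lti /= jzE lei mevalXU.
Qed.

End ChartParametrization.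

Lemma zeroset_gen (k : fieldType) n (gs : seq {mpoly k[n]}) v :
  zeroset k (in_ideal k gs) v <-> forall g, g \in gs -> g.@[v] = 0.
Proof.
split=> [h g gin|h p]; first by apply: h; apply: in_ideal_gen.
exact: in_ideal_eval.
Qed.

Lemma mem_seq5 (T : eqType) (a b c d e g : T) : g \in [:: a; b; c; d; e] <->
  [\/ g = a, g = b | [\/ g = c, g = d | g = e]].
Proof.
rewrite !inE; split.
  case/orP => [/eqP|/orP[/eqP|/orP[/eqP|/orP[/eqP|/eqP]]]] ->.
  - by constructor 1. - by constructor 2.
  - by apply/Or33/Or31. - by apply/Or33/Or32.
  - by apply/Or33/Or33.
by case=> [->|->|[->|->|->]]; rewrite eqxx ?orbT.
Qed.

(** * The components of [I0] and [I2] *)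

Section Components.
Variables (k : closedFieldType) (k2 : char_two k) (m : nat).
Hypothesis hm : (5 <= m)%N.
Local Notation N := (nv m).
Local Notation q := (m.+1)./2.
Local Notation jx := (jx k m). Local Notation jy := (jy k m). Local Notation jz := (jz k m).

Lemma xv_jx i : (i <= m)%N -> xv k m i = jx i. Proof. by move=> lei; rewrite jxE lei. Qed.
Lemma yv_jy i : (i <= m)%N -> yv k m i = jy i. Proof. by move=> lei; rewrite jyE lei. Qed.
Lemma zv_jz i : (i <= m)%N -> zv k m i = jz i. Proof. by move=> lei; rewrite jzE lei. Qed.

Lemma is_jet_fn (x y z : nat -> k) : jet_eqs q y z ->
  (forall i, (i <= m./2)%N -> x i ^+ 2 = gcoef i.*2 y z) -> is_jet (jet_fn (m := m) x y z).
Proof.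
have [h1 [h2 [h3 h4]]] := half_succ hm; move=> W hx.
have e j : (j <= m)%N -> gcoef j (fun i => (jy i).@[jet_fn (m := m) x y z])
    (fun i => (jz i).@[jet_fn (m := m) x y z]) = gcoef j y z.
  by move=> lej; apply: eq_gcoef => i lei; rewrite ?jy_eval ?jz_eval (leq_trans lei).
apply/(is_jetP k2); split=> [j ltj|i lei]; first by rewrite /godd e; [apply: W | lia].
rewrite e; last by lia.
by rewrite jx_eval ifT ?hx //; lia.
Qed.

Lemma jet_x_zero (v : pt k N) i : is_jet v -> (i <= m./2)%N ->
  gcoef i.*2 (fun i => (jy i).@[v]) (fun i => (jz i).@[v]) = 0 -> (jx i).@[v] = 0.
Proof.
move=> /(is_jetP k2) [_ hx] lei g0; apply/eqP.
by rewrite -sqrf_eq0 hx // g0.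
Qed.

Lemma gcoef_zero0 (y z : nat -> k) : y 0%N = 0 -> gcoef 0 y z = 0.
Proof. by move=> y0; rewrite /gcoef big_ord1 /= y0 expr0n /= mul0r mulr0 addr0. Qed.

Lemma gcoef_zero2 (y z : nat -> k) : y 0%N = 0 -> z 0%N = 0 -> gcoef 2 y z = 0.
Proof.
move=> y0 z0; rewrite /gcoef !big_ord_recr big_ord0 /= y0 z0.
by rewrite expr0n /= !mul0r !mulr0 !addr0.
Qed.

(** The vanishing of [x_0], [x_1], [x_2] is automatic: their squares are coefficients of index below
    6 of a series divisible by [t ^ 6]. *)
Lemma zeroset_I0 v : zeroset k (I0 k m) v <-> chart_locus 2 v.
Proof.
have [h1 [h2 [h3 h4]]] := half_succ hm.
have e g : g \in [:: xv k m 0; xv k m 1; xv k m 2; yv k m 0; yv k m 1; zv k m 0; zv k m 1]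
   <-> g = jx 0 \/ g = jx 1 \/ [\/ g = jx 2, g = jy 0 | [\/ g = jy 1, g = jz 0 | g = jz 1]].
  rewrite !xv_jx ?yv_jy ?zv_jz; try lia.
  rewrite in_cons; split=> [/predU1P [->|]|[->|h]]; [by left | | by rewrite eqxx | ].
    rewrite in_cons => /predU1P [->|/mem_seq5 h]; [by right; left | by right; right].
  apply/predU1P; right; rewrite in_cons; apply/predU1P.
  by case: h => [->|h]; [left | right; apply/mem_seq5].
rewrite /I0 zeroset_gen; split=> [h|[jv y0 z0 z1] g].
  have hv g : [\/ g = jx 2, g = jy 0 | [\/ g = jy 1, g = jz 0 | g = jz 1]] -> g.@[v] = 0.
    by move=> hg; apply: h; rewrite mem_cat; apply/orP; left; apply/e; right; right.
  split.
  - by apply/fjets_eval => g hg; apply: h; rewrite mem_cat hg orbT.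
  - case=> [|[|//]] _; apply: hv; [exact: Or32 | exact/Or33/Or31].
  - exact/hv/Or33/Or32.
  - exact/hv/Or33/Or33.
have z01 i : (i < 2)%N -> (jz i).@[v] = 0 by case: i => [|[|//]] _.
have x0 i : (i <= 2)%N -> (jx i).@[v] = 0.
  by move=> lei; apply: jet_x_zero => //; [lia | apply: gcoef_low => //; lia].
rewrite mem_cat => /orP[/e [->|[->|[->|->|[->|->|->]]]]|hg].
- exact: x0.
- exact: x0.
- exact: x0.
- exact: y0.
- exact: y0.
- exact: z0.
- exact: z1.
by move/fjets_eval: jv; apply.
Qed.

Lemma zeroset_I0_dim :
  irreducible k (zeroset k (I0 k m)) /\ dim_eq k (zeroset k (I0 k m)) (2 * m + 1).
Proof.
have [h1 [h2 [h3 h4]]] := half_succ hm.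
apply: (@chart_dim k k2 m 2 hm isT) => v; split=> [/zeroset_I0 [jv y0 z0 z1] P hP|h]; last first.
  by move=> p Ip; apply: h => u /zeroset_I0 hu _; apply: hu.
have z01 i : (i < 2)%N -> (jz i).@[v] = 0 by case: i => [|[|//]] _.
(* There are [m - 1] coefficients of index 2 to [m]. The polynomial [P] is pulled back to shifted
   square roots of [y], [z], with the free [x_i] frozen at their values at [v], so that density of
   generic pairs for [q - 3] equations applies. *)
pose L := m.-1; pose sh (u : nat -> k) i := if (i < 2)%N then 0 else if (i - 2 < L)%N then u (i - 2)%N else 0.
pose pnt (y z : nat -> k) := jet_fn (m := m)
  (fun i => if (i <= m./2)%N then gcoef i.*2 y z else (jx i).@[v])
  (fun i => y i ^+ 2) (fun i => z i ^+ 2).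
pose eta i : {mpoly k[L + L]} := if (i < 2)%N then 0 else yvar k L (i - 2).
pose zeta i : {mpoly k[L + L]} := if (i < 2)%N then 0 else zvar k L (i - 2).
pose xi i := if (i <= m./2)%N then gcoef i.*2 eta zeta else ((jx i).@[v])%:MP.
pose P' : {mpoly k[L + L]} :=
  P \mPo [tuple jet_fn (m := m) xi (fun i => eta i ^+ 2) (fun i => zeta i ^+ 2) i | i < N].
have etaE y' z' i : (eta i).@[pair_pt (L := L) y' z'] = sh y' i.
  by rewrite /eta /sh; case: ifP; rewrite ?meval0 ?yvar_pt.
have zetaE y' z' i : (zeta i).@[pair_pt (L := L) y' z'] = sh z' i.
  by rewrite /zeta /sh; case: ifP; rewrite ?meval0 ?zvar_pt.
have P'E y' z' : P'.@[pair_pt (L := L) y' z'] = P.@[pnt (sh y') (sh z')].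
  rewrite comp_mpoly_meval; apply: meval_eq => i; rewrite tnth_mktuple jet_fn_meval.
  apply: eq_jet_fn => l lel.
  - rewrite /xi; case: ifP => _; last by rewrite mevalC.
    rewrite (gcoef_rmorph (meval _)).
    by apply: eq_gcoef => a _; [exact: etaE | exact: zetaE].
  - by rewrite (rmorphXn (meval _)) /= etaE.
  - by rewrite (rmorphXn (meval _)) /= zetaE.
have sh0 u i : (i < 2)%N -> sh u i = 0 by rewrite /sh => ->.
have [y yK] : exists y : nat -> k, forall i, y i ^+ 2 = (jy i).@[v].
  by exists (fun i => closed_sqrt (jy i).@[v]) => i; apply: closed_sqrtK.
have [z zK] : exists z : nat -> k, forall i, z i ^+ 2 = (jz i).@[v].
  by exists (fun i => closed_sqrt (jz i).@[v]) => i; apply: closed_sqrtK.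
have sq0 a : a ^+ 2 = 0 -> a = 0 :> k by move/eqP; rewrite sqrf_eq0 => /eqP.
have yl i : (i < 2)%N -> y i = 0 by move=> lti; apply: sq0; rewrite yK y0.
have zl i : (i < 2)%N -> z i = 0 by move=> lti; apply: sq0; rewrite zK z01.
have [W hx] := (is_jetP k2 v).1 jv.
have gE j : gcoef j y z ^+ 2 = gcoef j (fun i => (jy i).@[v]) (fun i => (jz i).@[v]).
  by rewrite -(gcoef_sqr k2); apply: eq_gcoef => a _; [exact: yK | exact: zK].
have Wyz : jet_eqs q y z by move=> j ltj; apply: sq0; rewrite /godd gE; apply: W.
have := generic_dense k2 (q := q - 3) (P := P') _ _ _ (proj1 (jet_eqs_shift q yl zl) Wyz).
rewrite P'E => h; rewrite -[RHS]h.
- apply: meval_eq => i; rewrite [LHS](jet_fnE v) /pnt.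
  have shE u l : (forall l, (l < 2)%N -> u l = 0) -> (l <= m)%N -> sh (fun i => u i.+2) l = u l.
    move=> u0 lel; rewrite /sh; case: ltnP => lt2; first by rewrite u0.
    by rewrite ifT; [congr (u _) | rewrite /L]; lia.
  apply: eq_jet_fn => l lel.
  - case: leqP => // lem; apply: (char_two_sqr_inj k2) => /=; rewrite hx // -gE.
    congr (_ ^+ 2); apply: eq_gcoef => a lea; rewrite shE //; lia.
  - by rewrite shE // yK.
  - by rewrite shE // zK.
- by rewrite /L; lia.
- by rewrite /L; lia.
move=> y' z' W' g; rewrite P'E; apply: hP.
  split.
  - apply: is_jet_fn.
      move=> j ltj; rewrite /godd (gcoef_sqr k2); apply/eqP; rewrite sqrf_eq0; apply/eqP.
      apply: (proj2 (jet_eqs_shift q (sh0 y') (sh0 z'))) ltj => j' ltj'.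
      rewrite -[RHS](W' j' ltj'); apply: eq_gcoef => a lea;
        by rewrite /sh /= subn2 /= ifT // /L; lia.
    by move=> i lei; rewrite lei -(gcoef_sqr k2).
  - by move=> i lti; rewrite jy_eval sh0 // expr0n /= if_same.
  - by rewrite jz_eval sh0 // expr0n /= ?if_same.
  - by rewrite jz_eval sh0 // expr0n /= ?if_same.
rewrite jy_eval ifT; last by lia.
rewrite expf_neq0 // /sh /= subnn ifT; last by rewrite /L; lia.
by move: g; rewrite /generic_pair !mulf_eq0 !negb_or => /andP[/andP[]].
Qed.

Lemma mem_J2 g : g \in [:: xv k m 0; xv k m 1; yv k m 0; zv k m 0; zv k m 1] <->
  [\/ g = jx 0, g = jx 1 | [\/ g = jy 0, g = jz 0 | g = jz 1]].
Proof.
by rewrite !xv_jx ?yv_jy ?zv_jz; try lia; apply: mem_seq5.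
Qed.

Lemma J2_gen g : [\/ g = jx 0, g = jx 1 | [\/ g = jy 0, g = jz 0 | g = jz 1]] -> J2 k m g.
Proof. by move=> /mem_J2 hg; apply: in_ideal_gen; rewrite mem_cat hg. Qed.

Lemma zeroset_J2 v : zeroset k (J2 k m) v <-> chart_locus 1 v.
Proof.
have [h1 [h2 [h3 h4]]] := half_succ hm.
split=> [h|[jv y0 z0 z1]].
  split.
  - by apply/fjets_eval => g hg; apply: h; apply: in_ideal_gen; rewrite mem_cat hg orbT.
  - by case=> // _; apply/h/J2_gen; apply/Or33/Or31.
  - by apply/h/J2_gen; apply/Or33/Or32.
  - by apply/h/J2_gen; apply/Or33/Or33.
have y00 : (jy 0).@[v] = 0 by apply: y0.
apply/zeroset_gen => g; rewrite mem_cat => /orP[/mem_J2 [->|->|[->|->|->]]|hg] //.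
- by apply: jet_x_zero => //; apply: gcoef_zero0.
- by apply: jet_x_zero => //; [lia | apply: gcoef_zero2].
by move/fjets_eval: jv; apply.
Qed.

(** This links the open chart to the saturation: it puts [P ^ 2] into [I2], so [P] vanishes on its
    zero set. *)
Lemma J2_certificate (P : Rm k m) :
  (forall u, chart_locus 1 u -> (jy 1).@[u] != 0 -> P.@[u] = 0) ->
  exists n, J2 k m (yv k m 1 ^+ n * P ^+ 2).
Proof.
have [h1 [h2 [h3 h4]]] := half_succ hm; move=> hP.
have idJ : is_ideal (J2 k m) by apply: in_ideal_is_ideal.
pose h : 'I_N := inord (m.+1 + 1).
pose free (i : 'I_N) := (i : nat) \in (m.+1 + 1)%N :: free_rest m 1.
have hN : (m.+1 + 1 < N)%N by rewrite nv_lt; lia.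
have free_h : free h by rewrite /free /h inordK // mem_head.
have jy1 : jy 1 = 'X_h by rewrite -yv_jy //; lia.
have red_y i : reducible_to_free (J2 k m) h free (jy i).
  have [->|i0] := eqVneq i 0%N.
    by apply: reducibleI => //; apply: J2_gen; apply/Or33/Or31.
  rewrite jyE; case: leqP => lei; last exact: reducible0.
  apply: reducible_free => //; rewrite /free inordK ?nv_lt; last by lia.
  by rewrite free_y //; lia.
have JG j : (j < q)%N -> J2 k m (godd j jy jz).
  move=> ltj; have -> : godd j jy jz = fjet k m j.*2.+1.
    by rewrite fjetE //= odd_double add0r.
  by apply: in_ideal_gen; rewrite mem_cat; apply/orP; right; apply: map_f; rewrite mem_iota; lia.
have Jz01 i : (i <= 1)%N -> J2 k m (jz i).
  case: i => [|[|//]] _; apply: J2_gen; [exact/Or33/Or32 | exact/Or33/Or33].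
have red_z i : reducible_to_free (J2 k m) h free (jz i).
  apply: (@chart_closed _ (J2 k m) (reducible_to_free (J2 k m) h free) 1 q jy jz) => //.
  - exact: reducible0.
  - exact: reducibleD.
  - exact: reducibleM.
  - exact: reducibleN.
  - by move=> x r; rewrite jy1; apply: reducible_div.
  - by case=> // _; apply: J2_gen; apply/Or33/Or31.
  move=> {}i ns; have [le1|lt1] := leqP i 1; first by apply: reducibleI => //; apply: Jz01.
  rewrite jzE; case: leqP => lei; last exact: reducible0.
  apply: reducible_free => //; rewrite /free inordK ?nv_lt; last by lia.
  by rewrite free_z // lt1 ns.
(* For [i <= m./2] the even equations give only [x_i ^ 2], not [x_i]. *)
have red_x i : (i <= m)%N -> reducible_to_free (J2 k m) h free (jx i ^+ 2).
  move=> lei; have [le2|lt2] := leqP i m./2; last first.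
    rewrite expr2; suff: reducible_to_free (J2 k m) h free (jx i) by move=> hx; apply: reducibleM.
    rewrite jxE lei; apply: reducible_free => //; rewrite /free inordK ?nv_lt; last by lia.
    by rewrite free_x.
  have -> : jx i ^+ 2 = fjet k m i.*2 - gcoef i.*2 jy jz.
    by rewrite fjetE // odd_double doubleK addrK.
  apply: reducibleD => //.
    apply: reducibleI => //; apply: in_ideal_gen; rewrite mem_cat; apply/orP; right.
    by apply: map_f; rewrite mem_iota; lia.
  apply: (reducibleN idJ); rewrite /gcoef; apply: (big_ind (reducible_to_free (J2 k m) h free)) => //.
  - exact: reducible0.
  - by move=> a b; apply: reducibleD.
  move=> l _; apply: reducibleD => //; apply: reducibleM => //; rewrite expr2; exact: reducibleM.
apply: (chart_certificate idJ free_h k2 (H := 1)); first exact: oner_neq0.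
- apply: jet_fn_split => i lei.
  + by rewrite -[X in X ^+ 2]/(xv k m i) xv_jx //; apply: red_x.
  + by rewrite -[X in X ^+ 2]/(yv k m i) yv_jy // expr2; apply: reducibleM.
  + by rewrite -[X in X ^+ 2]/(zv k m i) zv_jz // expr2; apply: reducibleM.
move=> w wh _; pose y i := if i == 0%N then 0 else (jy i).@[w].
pose z0 i := if (i <= 1)%N then 0 else (jz i).@[w].
have y1 : y 1%N != 0 by rewrite /y /= jy1 mevalXU.
have y0 i : (i < 1)%N -> y i = 0 by case: i.
have [|z [z_eq zG]] := @chart_exists k 1 q y (y 1%N ^- 2) z0 isT y0; first by rewrite mulfV ?expf_neq0.
have zz0 : z 0%N = 0 by rewrite z_eq.
have zz1 : z 1%N = 0 by rewrite z_eq.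
have W : jet_eqs q y z by apply: (godd_chart_all (s := 1)).
pose x i := if (i <= m./2)%N then closed_sqrt (gcoef i.*2 y z) else (jx i).@[w].
have locus : chart_locus 1 (jet_fn (m := m) x y z).
  split.
  - by apply: is_jet_fn => // i lei; rewrite /x lei closed_sqrtK.
  - by case=> // _; rewrite jy_eval y0 // if_same.
  - by rewrite jz_eval zz0 ?if_same.
  - by rewrite jz_eval zz1 if_same.
exists (jet_fn (m := m) x y z); split.
- apply: jet_fn_split => i lei; rewrite /free inordK ?nv_lt; try lia.
  + by rewrite free_x // => lti; rewrite jet_fn_x // /x leqNgt lti /= jxE lei mevalXU.
  + rewrite free_y // => le1; rewrite jet_fn_y // /y; case: eqP => [e|_]; first by rewrite e in le1.
    by rewrite jyE lei mevalXU.
  + rewrite free_z // => /andP[lt1 ns]; rewrite jet_fn_z // z_eq // /z0 leqNgt lt1 /=.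
    by rewrite jzE lei mevalXU.
- by apply/zeroset_J2.
apply: hP => //; rewrite jy_eval ifT //; lia.
Qed.

Lemma zeroset_I2_dim :
  irreducible k (zeroset k (I2 k m)) /\ dim_eq k (zeroset k (I2 k m)) (2 * m + 1).
Proof.
have m1 : (1 <= m)%N by lia.
apply: (@chart_dim k k2 m 1 hm isT) => v; split=> [Zv P hP|h p [e Jp]].
  have [n hn] := J2_certificate hP.
  have /eqP := Zv (P ^+ 2) (ex_intro _ n hn).
  by rewrite (rmorphXn (meval v)) sqrf_eq0 => /eqP.
apply: h => u /zeroset_J2 hu yu; have /eqP := hu _ Jp.
rewrite mevalM (rmorphXn (meval u)) /= mulf_eq0 expf_eq0 yv_jy //.
by rewrite (negbTE yu) andbF => /eqP.
Qed.

End Components.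

(** * Transport of closed sets along an involution of the ring *)

Section Involution.
Variables (k : closedFieldType) (n : nat) (tau : n.-tuple {mpoly k[n]}).
Hypothesis tauK : forall p, (p \mPo tau) \mPo tau = p.

Definition act_pt (v : pt k n) : pt k n := fun i => (tnth tau i).@[v].

(** An equality of functions, by extensionality, so that it rewrites under arbitrary predicates on
    points. *)
Lemma act_ptK v : act_pt (act_pt v) = v.
Proof.
apply: functional_extensionality => i; rewrite /act_pt.
have := congr1 (meval v) (tauK 'X_i); rewrite !comp_mpoly_meval !mevalXU => h.
by rewrite -[RHS]h.
Qed.

Lemma zclosed_act (C : pt k n -> Prop) : zclosed k C -> zclosed k (fun v => C (act_pt v)).
Proof.
move=> [T hT]; exists (fun p => exists2 r, T r & p = r \mPo tau) => v; rewrite hT.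
split=> [h p [r Tr ->]|h r Tr]; first by rewrite comp_mpoly_meval; apply: h.
by have := h _ (ex_intro2 _ _ r Tr erefl); rewrite comp_mpoly_meval.
Qed.

Lemma irreducible_act (C : pt k n -> Prop) :
  irreducible k C -> irreducible k (fun v => C (act_pt v)).
Proof.
move=> [[v Cv] irr]; split; first by exists (act_pt v); rewrite act_ptK.
move=> B D /zclosed_act zB /zclosed_act zD sub.
have [|h|h] := irr _ _ zB zD.
- by move=> w Cw; have := sub (act_pt w); rewrite act_ptK; apply.
- by left=> w /h; rewrite act_ptK.
- by right=> w /h; rewrite act_ptK.
Qed.

Lemma has_chain_act (A B : pt k n -> Prop) e :
  (forall v, A (act_pt v) -> B v) -> has_chain k A e -> has_chain k B e.
Proof.
move=> AB [c [hc hs]]; exists (fun i v => c i (act_pt v)); split=> i lei.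
  have [h1 h2 h3] := hc i lei; split; [exact: zclosed_act | exact: irreducible_act |].
  by move=> v cv; apply: AB; apply: h3.
have [h1 h2] := hs i lei; split=> [v|sub]; first exact: h1.
by apply: h2 => v cv; have := sub (act_pt v); rewrite act_ptK; apply.
Qed.

Lemma irreducible_dim_act (A B : pt k n -> Prop) d : (forall v, B v <-> A (act_pt v)) ->
  irreducible k A /\ dim_eq k A d -> irreducible k B /\ dim_eq k B d.
Proof.
move=> AB [irrA [chA leA]]; split.
  have [[v Av] irr] := irreducible_act irrA; split; first by exists v; apply/AB.
  move=> C D zC zD sub; have [|h|h] := irr C D zC zD; first by move=> w /AB; apply: sub.
    by left=> w /AB; apply: h.
  by right=> w /AB; apply: h.
split; first by apply: has_chain_act chA => v /AB.
move=> e chB; apply: leA; apply: has_chain_act chB => v /AB; by rewrite act_ptK.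
Qed.

Lemma zeroset_saturate_act (gs gs' : seq {mpoly k[n]}) h h' v :
  (forall g, g \in gs -> in_ideal k gs' (g \mPo tau)) ->
  (forall g, g \in gs' -> in_ideal k gs (g \mPo tau)) ->
  h \mPo tau = h' ->
  zeroset k (saturate k (in_ideal k gs) h) v <->
  zeroset k (saturate k (in_ideal k gs') h') (act_pt v).
Proof.
move=> s1 s2 eh; have eh' : h' \mPo tau = h by rewrite -eh tauK.
have key gs1 gs2 h1 h2 (t12 : forall g, g \in gs1 -> in_ideal k gs2 (g \mPo tau)) p :
    h1 \mPo tau = h2 -> saturate k (in_ideal k gs1) h1 p -> saturate k (in_ideal k gs2) h2 (p \mPo tau).
  move=> e12 [e he]; exists e.
  have -> : h2 ^+ e * (p \mPo tau) = (h1 ^+ e * p) \mPo tau by rewrite rmorphM rmorphXn /= e12.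
  apply: (in_ideal_min (I := fun p => in_ideal k gs2 (p \mPo tau))) he => //.
  exact: (preim_ideal (comp_mpoly tau) (in_ideal_is_ideal _)).
split=> hv p hp.
  by have := hv _ (key _ _ _ _ s2 p eh' hp); rewrite comp_mpoly_meval.
have := hv _ (key _ _ _ _ s1 p eh hp); rewrite comp_mpoly_meval => <-.
by have := act_ptK v; rewrite /act_pt => {1}<-.
Qed.

End Involution.

(** * The remaining components, the decomposition, and its irredundancy *)

Section Decomposition.
Variables (k : closedFieldType) (k2 : char_two k) (m : nat).
Hypothesis hm : (5 <= m)%N.
Local Notation N := (nv m).
Local Notation q := (m.+1)./2.
Local Notation jx := (jx k m). Local Notation jy := (jy k m). Local Notation jz := (jz k m).

Lemma jx_comp n (x y z : nat -> {mpoly k[n]}) i :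
  jx i \mPo [tuple jet_fn (m := m) x y z i | i < N] = if (i <= m)%N then x i else 0.
Proof.
rewrite jxE; case: ifP => lei; last exact: comp_mpoly0.
by rewrite /xv comp_mpolyXU -tnth_nth tnth_mktuple jet_fn_x.
Qed.
Lemma jy_comp n (x y z : nat -> {mpoly k[n]}) i :
  jy i \mPo [tuple jet_fn (m := m) x y z i | i < N] = if (i <= m)%N then y i else 0.
Proof.
rewrite jyE; case: ifP => lei; last exact: comp_mpoly0.
by rewrite /yv comp_mpolyXU -tnth_nth tnth_mktuple jet_fn_y.
Qed.
Lemma jz_comp n (x y z : nat -> {mpoly k[n]}) i :
  jz i \mPo [tuple jet_fn (m := m) x y z i | i < N] = if (i <= m)%N then z i else 0.
Proof.
rewrite jzE; case: ifP => lei; last exact: comp_mpoly0.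
by rewrite /zv comp_mpolyXU -tnth_nth tnth_mktuple jet_fn_z.
Qed.

Definition swap_tuple : N.-tuple (Rm k m) := [tuple jet_fn (m := m) jx jz jy i | i < N].
Definition shear_tuple : N.-tuple (Rm k m) :=
  [tuple jet_fn (m := m) jx jy (fun i => jy i + jz i) i | i < N].

Lemma swap_tupleK p : (p \mPo swap_tuple) \mPo swap_tuple = p.
Proof.
apply: mpoly_ext => v; rewrite !comp_mpoly_meval; apply: meval_eq.
apply: jet_fn_split => i lei; rewrite tnth_mktuple.
- by rewrite jet_fn_x // -comp_mpoly_meval jx_comp lei jxE lei mevalXU.
- by rewrite jet_fn_y // -comp_mpoly_meval jz_comp lei jyE lei mevalXU.
- by rewrite jet_fn_z // -comp_mpoly_meval jy_comp lei jzE lei mevalXU.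
Qed.

Lemma shear_tupleK p : (p \mPo shear_tuple) \mPo shear_tuple = p.
Proof.
have R2 := @mpoly_char_two k N k2.
apply: mpoly_ext => v; rewrite !comp_mpoly_meval; apply: meval_eq.
apply: jet_fn_split => i lei; rewrite tnth_mktuple.
- by rewrite jet_fn_x // -comp_mpoly_meval jx_comp lei jxE lei mevalXU.
- by rewrite jet_fn_y // -comp_mpoly_meval jy_comp lei jyE lei mevalXU.
- rewrite jet_fn_z // -comp_mpoly_meval comp_mpolyD jy_comp jz_comp lei addrA R2 add0r.
  by rewrite jzE lei mevalXU.
Qed.

Lemma gcoef_cutoff j (y z : nat -> Rm k m) : (j <= m)%N ->
  gcoef j (fun i => if (i <= m)%N then y i else 0) (fun i => if (i <= m)%N then z i else 0)
  = gcoef j y z.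
Proof. by move=> lej; apply: eq_gcoef => i lei; rewrite (leq_trans lei lej). Qed.

Lemma fjet_comp n (x y z : nat -> {mpoly k[n]}) j :
  fjet k m j \mPo [tuple jet_fn (m := m) x y z i | i < N] =
  (if odd j then 0 else (if (j./2 <= m)%N then x j./2 else 0) ^+ 2) +
  gcoef j (fun i => if (i <= m)%N then y i else 0) (fun i => if (i <= m)%N then z i else 0).
Proof.
rewrite fjetE // rmorphD (gcoef_rmorph (comp_mpoly _)); congr (_ + _).
  by case: (odd j); rewrite ?rmorph0 // rmorphXn /= jx_comp.
by apply: eq_gcoef => i _; [exact: jy_comp | exact: jz_comp].
Qed.

Lemma fjet_swap j : (j <= m)%N -> fjet k m j \mPo swap_tuple = fjet k m j.
Proof.
move=> lej; rewrite fjet_comp fjetE // gcoef_cutoff // gcoefC; congr (_ + _).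
by case: (odd j) => //; case: leqP => //; have := odd_double_half j; lia.
Qed.

Lemma fjet_shear j : (j <= m)%N -> fjet k m j \mPo shear_tuple = fjet k m j.
Proof.
move=> lej; rewrite fjet_comp fjetE // gcoef_cutoff // gcoef_addr; last exact: mpoly_char_two.
by congr (_ + _); case: (odd j) => //; case: leqP => //; have := odd_double_half j; lia.
Qed.

Lemma fjets_mem g : g \in fjets k m -> exists2 j, (j <= m)%N & g = fjet k m j.
Proof. by case/mapP => j; rewrite mem_iota => /andP[_ ltj] ->; exists j. Qed.

Lemma mem_J1 g : g \in [:: xv k m 0; xv k m 1; yv k m 0; yv k m 1; zv k m 0] <->
  [\/ g = jx 0, g = jx 1 | [\/ g = jy 0, g = jy 1 | g = jz 0]].
Proof. by rewrite !xv_jx ?yv_jy ?zv_jz; try lia; apply: mem_seq5. Qed.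

Lemma mem_J3 g : g \in [:: xv k m 0; xv k m 1; yv k m 0; zv k m 0; yv k m 1 + zv k m 1] <->
  [\/ g = jx 0, g = jx 1 | [\/ g = jy 0, g = jz 0 | g = jy 1 + jz 1]].
Proof. by rewrite !xv_jx ?yv_jy ?zv_jz; try lia; apply: mem_seq5. Qed.

Lemma fjet_in (l : seq (Rm k m)) j : (j <= m)%N -> in_ideal k (l ++ fjets k m) (fjet k m j).
Proof.
move=> lej; apply: in_ideal_gen; rewrite mem_cat; apply/orP; right.
by apply: map_f; rewrite mem_iota.
Qed.

Lemma gen_in (l l' : seq (Rm k m)) g : g \in l -> in_ideal k (l ++ l') g.
Proof. by move=> hg; apply: in_ideal_gen; rewrite mem_cat hg. Qed.

Lemma zeroset_I1_act v : zeroset k (I1 k m) v <-> zeroset k (I2 k m) (act_pt swap_tuple v).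
Proof.
have lem : (0 <= m)%N /\ (1 <= m)%N by lia.
case: lem => le0 le1; apply: zeroset_saturate_act.
- exact: swap_tupleK.
- move=> g; rewrite mem_cat => /orP[/mem_J1 hg|/fjets_mem [j lej ->]]; last first.
    by rewrite fjet_swap //; apply: fjet_in.
  apply: gen_in; apply/(mem_J2 hm).
  by case: hg => [->|->|[->|->|->]]; rewrite /swap_tuple ?jx_comp ?jy_comp ?jz_comp ?le1 /=;
    [exact: Or31 | exact: Or32 | exact/Or33/Or32 | exact/Or33/Or33 | exact/Or33/Or31].
- move=> g; rewrite mem_cat => /orP[/(mem_J2 hm) hg|/fjets_mem [j lej ->]]; last first.
    by rewrite fjet_swap //; apply: fjet_in.
  apply: gen_in; apply/mem_J1.
  by case: hg => [->|->|[->|->|->]]; rewrite /swap_tuple ?jx_comp ?jy_comp ?jz_comp ?le1 /=;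
    [exact: Or31 | exact: Or32 | exact/Or33/Or33 | exact/Or33/Or31 | exact/Or33/Or32].
- by rewrite zv_jz // yv_jy // /swap_tuple jz_comp le1.
Qed.

Lemma zeroset_I3_act v : zeroset k (I3 k m) v <-> zeroset k (I2 k m) (act_pt shear_tuple v).
Proof.
have R2 := @mpoly_char_two k N k2.
have lem : (0 <= m)%N /\ (1 <= m)%N by lia.
case: lem => le0 le1; apply: zeroset_saturate_act.
- exact: shear_tupleK.
- move=> g; rewrite mem_cat => /orP[/mem_J3 hg|/fjets_mem [j lej ->]]; last first.
    by rewrite fjet_shear //; apply: fjet_in.
  case: hg => [->|->|[->|->|->]];
    rewrite ?comp_mpolyD /shear_tuple ?jx_comp ?jy_comp ?jz_comp ?le1 ?leq0n.
  + exact/gen_in/(mem_J2 hm)/Or31.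
  + exact/gen_in/(mem_J2 hm)/Or32.
  + exact/gen_in/(mem_J2 hm)/Or33/Or31.
  + apply: idealD; [exact: in_ideal_is_ideal | exact/gen_in/(mem_J2 hm)/Or33/Or31 |].
    exact/gen_in/(mem_J2 hm)/Or33/Or32.
  + by rewrite addrA R2 add0r; apply/gen_in/(mem_J2 hm)/Or33/Or33.
- move=> g; rewrite mem_cat => /orP[/(mem_J2 hm) hg|/fjets_mem [j lej ->]]; last first.
    by rewrite fjet_shear //; apply: fjet_in.
  case: hg => [->|->|[->|->|->]]; rewrite /shear_tuple ?jx_comp ?jy_comp ?jz_comp ?le1 ?leq0n.
  + exact/gen_in/mem_J3/Or31.
  + exact/gen_in/mem_J3/Or32.
  + exact/gen_in/mem_J3/Or33/Or31.
  + apply: idealD; [exact: in_ideal_is_ideal | exact/gen_in/mem_J3/Or33/Or31 |].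
    exact/gen_in/mem_J3/Or33/Or32.
  + exact/gen_in/mem_J3/Or33/Or33.
- by rewrite yv_jy // /shear_tuple jy_comp le1.
Qed.

Lemma zeroset_Im_dim i :
  irreducible k (zeroset k (Im k m i)) /\ dim_eq k (zeroset k (Im k m i)) (2 * m + 1).
Proof.
case: i => [|[|[|i]]].
- exact: zeroset_I0_dim.
- exact: (irreducible_dim_act swap_tupleK zeroset_I1_act (zeroset_I2_dim k2 hm)).
- exact: zeroset_I2_dim.
- exact: (irreducible_dim_act shear_tupleK zeroset_I3_act (zeroset_I2_dim k2 hm)).
Qed.

Lemma zeroset_saturate n (gs : seq {mpoly k[n]}) h v :
  (forall g, g \in gs -> g.@[v] = 0) -> h.@[v] != 0 ->
  zeroset k (saturate k (in_ideal k gs) h) v.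
Proof.
move=> gv hv p [e /(in_ideal_eval gv)]; rewrite mevalM (rmorphXn (meval v)) /=.
by move/eqP; rewrite mulf_eq0 expf_eq0 (negbTE hv) andbF => /eqP.
Qed.

Lemma saturate_sub n (gs : seq {mpoly k[n]}) h g : in_ideal k gs g -> saturate k (in_ideal k gs) h g.
Proof. by move=> hg; exists 0%N; rewrite mul1r. Qed.

Lemma zeroset_Ifib v : zeroset k (Ifib k m) v <->
  [/\ is_jet v, (jx 0).@[v] = 0, (jy 0).@[v] = 0 & (jz 0).@[v] = 0].
Proof.
rewrite /Ifib zeroset_gen !xv_jx // yv_jy // zv_jz //; split=> [h|[jv x0 y0 z0] g].
  split.
  - by apply/fjets_eval => g hg; apply: h; rewrite mem_cat hg orbT.
  - by apply: h; rewrite mem_cat !inE eqxx.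
  - by apply: h; rewrite mem_cat !inE eqxx orbT.
  - by apply: h; rewrite mem_cat !inE eqxx !orbT.
rewrite mem_cat !inE => /orP[/orP[/eqP ->|/orP[/eqP ->|/eqP ->]]|hg] //.
by move/fjets_eval: jv; apply.
Qed.

(** Over the origin the equation of index 3 is [y_1 z_1 (y_1 + z_1) = 0]. If [y_1 = z_1 = 0] the jet
    lies in the component of [I0]; otherwise exactly one factor vanishes and the variable inverted
    in the corresponding ideal is nonzero. *)
Lemma decomposition v : zeroset k (Ifib k m) v <->
  [\/ zeroset k (Im k m 0) v, zeroset k (Im k m 1) v, zeroset k (Im k m 2) v | zeroset k (Im k m 3) v].
Proof.
have [h1 [h2 [h3 h4]]] := half_succ hm.
have [le0 le1] : (0 <= m)%N /\ (1 <= m)%N by lia.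
rewrite zeroset_Ifib; split=> [[jv x0 y0 z0]|].
  have x1 : (jx 1).@[v] = 0 by apply: (jet_x_zero k2) => //; [lia | apply: gcoef_zero2].
  have [W _] := (is_jetP k2 v).1 jv.
  have := W 1%N (ltnW h4); rewrite godd1E y0 z0 expr0n /= !mul0r !add0r => /eqP.
  set a := (jy 1).@[v]; set b := (jz 1).@[v].
  have -> : a ^+ 2 * b + b ^+ 2 * a = a * b * (a + b) by ring.
  have [a0|a0] := eqVneq a 0; have [b0|b0] := eqVneq b 0.
  - move=> _; apply: Or41; apply/(zeroset_I0 k2 hm); split=> //.
    by case=> [|[|//]] _.
  - move=> _; apply: Or42; apply: zeroset_saturate; last by rewrite zv_jz.
    move=> g; rewrite mem_cat => /orP[/mem_J1 [->|->|[->|->|->]]|hg] //.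
    by move/fjets_eval: jv; apply.
  - move=> _; apply: Or43; apply: zeroset_saturate; last by rewrite yv_jy.
    move=> g; rewrite mem_cat => /orP[/(mem_J2 hm) [->|->|[->|->|->]]|hg] //.
    by move/fjets_eval: jv; apply.
  rewrite !mulf_eq0 (negbTE a0) (negbTE b0) /= => /eqP ab.
  apply: Or44; apply: zeroset_saturate; last by rewrite yv_jy.
  move=> g; rewrite mem_cat => /orP[/mem_J3 [->|->|[->|->|->]]|hg] //.
    by rewrite mevalD.
  by move/fjets_eval: jv; apply.
have sat (gs : seq (Rm k m)) h : zeroset k (saturate k (in_ideal k (gs ++ fjets k m)) h) v ->
    jx 0 \in gs -> jy 0 \in gs -> jz 0 \in gs ->
    [/\ is_jet v, (jx 0).@[v] = 0, (jy 0).@[v] = 0 & (jz 0).@[v] = 0].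
  move=> hv g1 g2 g3; split; try by apply/hv/saturate_sub/gen_in.
  by move=> j lej; apply/hv/saturate_sub/fjet_in.
case.
- move=> /(zeroset_I0 k2 hm) [jv y0 z0 z1]; have y00 : (jy 0).@[v] = 0 by apply: y0.
  by split=> //; apply: (jet_x_zero k2) => //; apply: gcoef_zero0.
- move/sat; apply; apply/mem_J1; [exact: Or31 | exact/Or33/Or31 | exact/Or33/Or33].
- move/sat; apply; apply/(mem_J2 hm); [exact: Or31 | exact/Or33/Or31 | exact/Or33/Or32].
- move/sat; apply; apply/mem_J3; [exact: Or31 | exact/Or33/Or31 | exact/Or33/Or32].
Qed.

Lemma Im1_yz v : zeroset k (Im k m 1) v -> (jy 1).@[v] = 0.
Proof. by move=> hv; apply/hv/saturate_sub/gen_in/mem_J1/Or33/Or32. Qed.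
Lemma Im2_yz v : zeroset k (Im k m 2) v -> (jz 1).@[v] = 0.
Proof. by move=> hv; apply/hv/saturate_sub/gen_in/(mem_J2 hm)/Or33/Or33. Qed.
Lemma Im3_yz v : zeroset k (Im k m 3) v -> (jy 1).@[v] + (jz 1).@[v] = 0.
Proof. by move=> hv; rewrite -mevalD; apply/hv/saturate_sub/gen_in/mem_J3/Or33/Or33. Qed.

(** The arcs [(0, a t, b t)] lie on the surface when [a b (a + b) = 0]; the pairs [(0, 1)],
    [(1, 0)], [(1, 1)] give a jet in exactly one component each. *)
Definition linear_jet (a b : k) : pt k N :=
  jet_fn (m := m) (fun=> 0) (fun i => if i == 1%N then a else 0) (fun i => if i == 1%N then b else 0).

Lemma linear_jet_y a b i : (jy i).@[linear_jet a b] = if i == 1%N then a else 0.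
Proof. by rewrite jy_eval; case: leqP => // lti; case: eqP => // ei; lia. Qed.
Lemma linear_jet_z a b i : (jz i).@[linear_jet a b] = if i == 1%N then b else 0.
Proof. by rewrite jz_eval; case: leqP => // lti; case: eqP => // ei; lia. Qed.

Lemma linear_jet_is_jet a b : a * b * (a + b) = 0 -> is_jet (linear_jet a b).
Proof.
move=> ab; have g0 j : gcoef j (fun i => if i == 1%N then a else 0) (fun i => if i == 1%N then b else 0) = 0.
  rewrite /gcoef big1 // => i _; case: eqP => _; last by rewrite expr0n !mul0r addr0.
  case: eqP => _; last by rewrite !mulr0 addr0.
  by rewrite -[RHS]ab; ring.
by apply: (is_jet_fn k2 hm) => [j ltj|i lei]; rewrite ?/godd g0 // expr0n.
Qed.

Lemma linear_jet_component a b i : a * b * (a + b) = 0 -> (0 < i <= 3)%N ->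
  (if i == 1%N then (a == 0) && (b != 0) else if i == 2%N then (b == 0) && (a != 0)
   else (a + b == 0) && (a != 0)) -> zeroset k (Im k m i) (linear_jet a b).
Proof.
have [le0 le1] : (0 <= m)%N /\ (1 <= m)%N by lia.
move=> /linear_jet_is_jet jv; have x0 l : (jx l).@[linear_jet a b] = 0 by rewrite jx_eval if_same.
have jf g : g \in fjets k m -> g.@[linear_jet a b] = 0 by move/fjets_eval: jv; apply.
case: i => [|[|[|[|i]]]] //= _ /andP[/eqP h1 h2]; apply: zeroset_saturate.
- move=> g; rewrite mem_cat => /orP[/mem_J1|/jf //].
  by case=> [->|->|[->|->|->]]; rewrite ?linear_jet_y ?linear_jet_z.
- by rewrite zv_jz // linear_jet_z.
- move=> g; rewrite mem_cat => /orP[/(mem_J2 hm)|/jf //].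
  by case=> [->|->|[->|->|->]]; rewrite ?linear_jet_y ?linear_jet_z.
- by rewrite yv_jy // linear_jet_y.
- move=> g; rewrite mem_cat => /orP[/mem_J3|/jf //].
  by case=> [->|->|[->|->|->]]; rewrite ?mevalD ?linear_jet_y ?linear_jet_z.
- by rewrite yv_jy // linear_jet_y.
Qed.

Lemma noninclusion i j : (i <= 3)%N -> (j <= 3)%N -> i <> j ->
  ~ zsubset k (zeroset k (Im k m i)) (zeroset k (Im k m j)).
Proof.
have key (a b : k) i' j' : a * b * (a + b) = 0 -> (0 < i' <= 3)%N -> (j' <= 3)%N -> i' <> j' ->
  (if i' == 1%N then (a == 0) && (b != 0) else if i' == 2%N then (b == 0) && (a != 0)
   else (a + b == 0) && (a != 0)) ->
  zsubset k (zeroset k (Im k m i')) (zeroset k (Im k m j')) -> False.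
  move=> ab hi hj ne hab /(_ _ (linear_jet_component ab hi hab)).
  case: j' hj ne => [|[|[|[|j']]]] //= _ ne.
  - move/(zeroset_I0 k2 hm) => [_ /(_ 1%N isT) + _]; rewrite linear_jet_y linear_jet_z /= => a0 b0.
    by move: hab; rewrite a0 b0 eqxx !andbF !if_same.
  - move/Im1_yz; rewrite linear_jet_y /= => a0; move: hab; rewrite a0 eqxx !andbF.
    by case: eqP => // _; rewrite if_same.
  - move/Im2_yz; rewrite linear_jet_z /= => b0; move: hab; rewrite b0 eqxx addr0 !andbF.
    by case: (i' =P 1%N) => // _; case: (i' =P 2%N) => // _ /andP[/eqP ->]; rewrite eqxx.
  move/Im3_yz; rewrite linear_jet_y linear_jet_z /= => ab0; move: hab.
  case: (i' =P 1%N) => [_ /andP[/eqP a0]|n1]; first by rewrite a0 add0r in ab0; rewrite ab0 eqxx.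
  case: (i' =P 2%N) => [_ /andP[/eqP b0]|n2]; first by rewrite b0 addr0 in ab0; rewrite ab0 eqxx.
  by move=> _; lia.
have key' i' j' : (0 < i' <= 3)%N -> (j' <= 3)%N -> i' <> j' ->
    ~ zsubset k (zeroset k (Im k m i')) (zeroset k (Im k m j')).
  move=> hi hj ne; case: (i' =P 1%N) => [e|n1].
    by apply: (key 0 1 i' j' _ hi hj ne); [rewrite !mul0r | rewrite e /= eqxx oner_neq0].
  case: (i' =P 2%N) => [e|n2].
    by apply: (key 1 0 i' j' _ hi hj ne); [rewrite mulr0 mul0r | rewrite e /= eqxx oner_neq0].
  apply: (key 1 1 i' j' _ hi hj ne); first by rewrite k2 mulr0.
  by rewrite (negbTE (introN eqP n1)) (negbTE (introN eqP n2)) k2 eqxx oner_neq0.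
move=> hi hj ne; have [i0|i0] := posnP i; last by apply: key' => //; rewrite i0.
have j0 : (0 < j)%N by lia.
(* For [i = 0] no jet is exhibited: if the component of [I0] lay in another one, which is not
   contained in it, a maximal chain would extend by one step and exceed the dimension [2 m + 1]. *)
move=> sub; have [_ [[c [hc hs]] _]] := zeroset_Im_dim i.
have [irr [_ le]] := zeroset_Im_dim j.
have : has_chain k (zeroset k (Im k m j)) (2 * m + 1).+1.
  exists (fun l => if (l <= 2 * m + 1)%N then c l else zeroset k (Im k m j)); split=> l lel.
    case: leqP => [le_l|_]; last by split=> //; exists (Im k m j).
    by have [g1 g2 g3] := hc l le_l; split=> // v /g3 /sub.
  rewrite -ltnS lel; case: ltnP => [lt_l|ge_l]; first exact: hs.
  have -> : l = (2 * m + 1)%N by lia.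
  have [g1 g2 g3] := hc _ (leqnn (2 * m + 1)); split=> [v /g3 /sub //|sub'].
  apply: (@key' j i) => //; first by rewrite j0.
  - by move=> e; apply: ne.
  by move=> v /sub' /g3.
by move/le; rewrite ltnn.
Qed.

End Decomposition.

(** * The component of [I0] as a product with a jet scheme *)

Section ProductStructure.
Variables (k : closedFieldType) (k2 : char_two k) (m : nat).
Hypothesis hm : (6 <= m)%N.
Local Notation m' := (m - 6)%N.
Local Notation N := (nv m).
Local Notation N' := (nv m').
Local Notation R' := {mpoly k[N' + 11]}.

Definition base_var i : R' := 'X_(lshift 11 (inord i : 'I_N')).
Definition extra_var j : R' := 'X_(rshift N' (inord j : 'I_11)).

(* The coefficients of [x], [y], [z] below [t^3], [t^2], [t^2] are sent to [0], the next
   [m' + 1] of each to the coordinates of the jet space of order [m'], and the remaining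
   [3 + 4 + 4] to the coordinates of the affine factor. *)
Definition shift_x i : R' := if (i < 3)%N then 0
  else if (i - 3 <= m')%N then base_var (i - 3) else extra_var (i - 3 - m'.+1).
Definition shift_y i : R' := if (i < 2)%N then 0
  else if (i - 2 <= m')%N then base_var (m'.+1 + (i - 2)) else extra_var (3 + (i - 2 - m'.+1)).
Definition shift_z i : R' := if (i < 2)%N then 0
  else if (i - 2 <= m')%N then base_var (m'.+1 + m'.+1 + (i - 2))
  else extra_var (7 + (i - 2 - m'.+1)).

Definition shift_tuple : N.-tuple R' := [tuple jet_fn (m := m) shift_x shift_y shift_z i | i < N].

Definition unshift_tuple : (N' + 11).-tuple (Rm k m) :=
  [tuple match split i with
    | inl o => jet_fn (m := m') (fun i => xv k m (i + 3)) (fun i => yv k m (i + 2))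
                 (fun i => zv k m (i + 2)) o
    | inr j => if (j < 3)%N then xv k m (j + m'.+1 + 3)
               else if (j < 7)%N then yv k m (j - 3 + m'.+1 + 2) else zv k m (j - 7 + m'.+1 + 2)
    end | i < N' + 11].

Lemma unshift_base i : base_var i \mPo unshift_tuple =
  jet_fn (m := m') (fun i => xv k m (i + 3)) (fun i => yv k m (i + 2)) (fun i => zv k m (i + 2)) (inord i).
Proof. by rewrite comp_mpolyXU -tnth_nth tnth_mktuple (unsplitK (inl _ _)). Qed.

Lemma unshift_extra j : (j < 11)%N -> extra_var j \mPo unshift_tuple =
  if (j < 3)%N then xv k m (j + m'.+1 + 3)
  else if (j < 7)%N then yv k m (j - 3 + m'.+1 + 2) else zv k m (j - 7 + m'.+1 + 2).
Proof.
by move=> ltj; rewrite comp_mpolyXU -tnth_nth tnth_mktuple (unsplitK (inr _ _)) inordK.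
Qed.

Lemma shift_xK i : (3 <= i <= m)%N -> shift_x i \mPo unshift_tuple = xv k m i.
Proof.
move=> /andP[le3 lei]; rewrite /shift_x ltnNge le3 /=; case: leqP => h.
  by rewrite unshift_base jet_fn_x // subnK.
rewrite unshift_extra; last by lia.
by rewrite ifT; [congr (xv k m _) |]; lia.
Qed.

Lemma shift_yK i : (2 <= i <= m)%N -> shift_y i \mPo unshift_tuple = yv k m i.
Proof.
move=> /andP[le2 lei]; rewrite /shift_y ltnNge le2 /=; case: leqP => h.
  by rewrite unshift_base jet_fn_y // subnK.
have : (3 <= 3 + (i - 2 - m'.+1) < 7)%N /\ (3 + (i - 2 - m'.+1) - 3 + m'.+1 + 2 = i)%N by lia.
move: (3 + _)%N => j [/andP[le3 lt7] e]; rewrite unshift_extra; last by lia.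
by rewrite ltnNge le3 lt7 e.
Qed.

Lemma shift_zK i : (2 <= i <= m)%N -> shift_z i \mPo unshift_tuple = zv k m i.
Proof.
move=> /andP[le2 lei]; rewrite /shift_z ltnNge le2 /=; case: leqP => h.
  by rewrite unshift_base jet_fn_z // subnK.
have : (7 <= 7 + (i - 2 - m'.+1) < 11)%N /\ (7 + (i - 2 - m'.+1) - 7 + m'.+1 + 2 = i)%N by lia.
move: (7 + _)%N => j [/andP[le7 lt11] e]; rewrite unshift_extra //.
by rewrite ifF ?ifF ?e //; lia.
Qed.

Lemma unshift_shift p : I0 k m ((p \mPo shift_tuple) \mPo unshift_tuple - p).
Proof.
have idI : is_ideal (I0 k m) by apply: in_ideal_is_ideal.
have gen g : g \in [:: xv k m 0; xv k m 1; xv k m 2; yv k m 0; yv k m 1; zv k m 0; zv k m 1] ->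
    I0 k m (0 - g).
  by move=> hg; rewrite sub0r; apply: (idealN idI); apply: in_ideal_gen; rewrite mem_cat hg.
elim/mpoly_subring_ind: p => [c|i|p r hp hr|p r hp hr].
- by rewrite !comp_mpolyC subrr; apply: (ideal0 idI).
- rewrite comp_mpolyXU -tnth_nth tnth_mktuple.
  move: i; apply: jet_fn_split => i lei.
  + rewrite jet_fn_x //; have [lt3|le3] := ltnP i 3.
      rewrite /shift_x lt3 comp_mpoly0; apply: gen.
      by case: i lt3 {lei} => [|[|[|//]]] _; rewrite !inE eqxx ?orbT.
    by rewrite shift_xK ?le3 // subrr; apply: (ideal0 idI).
  + rewrite jet_fn_y //; have [lt2|le2] := ltnP i 2.
      rewrite /shift_y lt2 comp_mpoly0; apply: gen.
      by case: i lt2 {lei} => [|[|//]] _; rewrite !inE eqxx ?orbT.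
    by rewrite shift_yK ?le2 // subrr; apply: (ideal0 idI).
  + rewrite jet_fn_z //; have [lt2|le2] := ltnP i 2.
      rewrite /shift_z lt2 comp_mpoly0; apply: gen.
      by case: i lt2 {lei} => [|[|//]] _; rewrite !inE eqxx ?orbT.
    by rewrite shift_zK ?le2 // subrr; apply: (ideal0 idI).
- by rewrite !comp_mpolyD; apply: (ideal_congD idI).
- by rewrite !rmorphM /=; apply: (ideal_congM idI).
Qed.

Lemma xv_shift i : (i <= m)%N -> xv k m i \mPo shift_tuple = shift_x i.
Proof. by move=> lei; rewrite comp_mpolyXU -tnth_nth tnth_mktuple jet_fn_x. Qed.
Lemma yv_shift i : (i <= m)%N -> yv k m i \mPo shift_tuple = shift_y i.
Proof. by move=> lei; rewrite comp_mpolyXU -tnth_nth tnth_mktuple jet_fn_y. Qed.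
Lemma zv_shift i : (i <= m)%N -> zv k m i \mPo shift_tuple = shift_z i.
Proof. by move=> lei; rewrite comp_mpolyXU -tnth_nth tnth_mktuple jet_fn_z. Qed.

Lemma shift_unshift p : (p \mPo unshift_tuple) \mPo shift_tuple = p.
Proof.
apply: mpoly_ext => v; rewrite !comp_mpoly_meval; apply: meval_eq => i.
rewrite -comp_mpoly_meval -[RHS](mevalXU v); congr (_.@[v]).
rewrite tnth_mktuple; case: splitP => [o ei|j ej].
  have -> : 'X_i = base_var o by congr 'X__; apply: val_inj; rewrite /= inord_val.
  move: o {i ei}; apply: jet_fn_split => i lei.
  - rewrite jet_fn_x // xv_shift /shift_x; last by lia.
    by rewrite addnK lei ifF ?inordK ?nv_lt //; lia.
  - rewrite jet_fn_y // yv_shift /shift_y; last by lia.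
    by rewrite addnK lei ifF ?inordK ?nv_lt //; lia.
  - rewrite jet_fn_z // zv_shift /shift_z; last by lia.
    by rewrite addnK lei ifF ?inordK ?nv_lt //; lia.
have -> : 'X_i = extra_var j by congr 'X__; apply: val_inj; rewrite /= inord_val.
have ltj := ltn_ord j.
case: ltnP => h3; [|case: ltnP => h7].
- rewrite xv_shift /shift_x; last by lia.
  by rewrite ifF ?ifF; [congr extra_var | |]; lia.
- rewrite yv_shift /shift_y; last by lia.
  by rewrite ifF ?ifF; [congr extra_var | |]; lia.
- rewrite zv_shift /shift_z; last by lia.
  by rewrite ifF ?ifF; [congr extra_var | |]; lia.
Qed.

Lemma fjet_shift_low j : (j < 6)%N -> fjet k m j \mPo shift_tuple = 0.
Proof.
move=> ltj; rewrite fjet_comp // gcoef_low ?addr0 //.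
- case oj : (odd j) => //; rewrite /shift_x ifT; last by lia.
  by rewrite ifT ?expr0n //; have := odd_double_half j; rewrite oj; lia.
- by move=> i lti; rewrite /shift_y lti if_same.
- by move=> i lti; rewrite /shift_z lti if_same.
Qed.

(** The polynomial [f] is homogeneous of degree 6 for the weights 3, 2, 2, so the substitution by
    [t ^ 3 x], [t ^ 2 y], [t ^ 2 z] shifts the jet equations by 6. Up to index [m'] the extra
    variables do not enter. *)
Lemma fjet_shift j : (j <= m')%N -> fjet k m j.+4.+2 \mPo shift_tuple =
  fjet k m' j \mPo [tuple ('X_(lshift 11 i) : R') | i < N'].
Proof.
move=> lej; rewrite fjet_comp // gcoef_shift; first last.
- by move=> i lti; rewrite /shift_z lti if_same.
- by move=> i lti; rewrite /shift_y lti if_same.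
have -> : [tuple ('X_(lshift 11 i) : R') | i < N'] = [tuple jet_fn (m := m') base_var
    (fun i => base_var (m'.+1 + i)) (fun i => base_var (m'.+1 + m'.+1 + i)) i | i < N'].
  apply: eq_from_tnth => i; rewrite !tnth_mktuple; move: i; apply: jet_fn_split => i lei.
  - by rewrite jet_fn_x.
  - by rewrite jet_fn_y.
  - by rewrite jet_fn_z.
have le2 : (j./2 <= m')%N by have := odd_double_half j; lia.
rewrite fjet_comp //= negbK; congr (_ + _).
  case: (odd j) => //; rewrite le2 ifT; last by lia.
  have e3 : (j./2.+3 - 3 = j./2)%N by lia.
  by rewrite /shift_x e3 le2.
apply: eq_gcoef => i lei; have lei' : (i <= m')%N by lia.
  by rewrite lei' ifT /shift_y /= ?subn2 /= ?lei' //; lia.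
by rewrite lei' ifT /shift_z /= ?subn2 /= ?lei' //; lia.
Qed.

Lemma I0_quot_iso : quot_iso k (I0 k m) (Iprod k 11 m').
Proof.
have idP : is_ideal (Iprod k 11 m') by apply: in_ideal_is_ideal.
have idI : is_ideal (I0 k m) by apply: in_ideal_is_ideal.
exists shift_tuple, unshift_tuple; split.
- apply: (in_ideal_min (I := fun p => Iprod k 11 m' (p \mPo shift_tuple))).
    exact: (preim_ideal (comp_mpoly shift_tuple) idP).
  move=> g; rewrite mem_cat => /orP[hg|/fjets_mem [j lej ->]].
    suff -> : g \mPo shift_tuple = 0 by apply: (ideal0 idP).
    have [h0 [h1 h2]] : (0 <= m)%N /\ (1 <= m)%N /\ (2 <= m)%N by lia.
    move: hg; rewrite in_cons => /predU1P [->|]; first by rewrite (xv_shift h0).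
    rewrite in_cons => /predU1P [->|]; first by rewrite (xv_shift h1).
    move/mem_seq5 => [->|->|[->|->|->]].
    - by rewrite (xv_shift h2).
    - by rewrite (yv_shift h0).
    - by rewrite (yv_shift h1).
    - by rewrite (zv_shift h0).
    - by rewrite (zv_shift h1).
  have [lt6|le6] := ltnP j 6; first by rewrite fjet_shift_low //; apply: (ideal0 idP).
  have -> : j = (j - 6).+4.+2 by lia.
  rewrite fjet_shift; last by lia.
  by apply: in_ideal_gen; apply: map_f; apply: map_f; rewrite mem_iota; lia.
- apply: (in_ideal_min (I := fun p => I0 k m (p \mPo unshift_tuple))).
    exact: (preim_ideal (comp_mpoly unshift_tuple) idI).
  (* A generator is the shift of an equation of index [j + 6]; unshifting returns that equation
     modulo [I0], to which it belongs. *)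
  move=> g /mapP [f /fjets_mem [j lej ->] ->]; rewrite -fjet_shift //.
  apply: (idealBD idI (unshift_shift _)); apply: in_ideal_gen; rewrite mem_cat.
  by apply/orP; right; apply: map_f; rewrite mem_iota; lia.
- exact: unshift_shift.
- by move=> p; rewrite shift_unshift subrr; apply: (ideal0 idP).
Qed.

End ProductStructure.

Theorem theorem3p6 (k : closedFieldType) (chark : (2 \in [pchar k])%N) (m : nat)
  (hm : (5 <= m)%N) :
  (forall i : nat, (i <= 3)%N ->
     irreducible k (zeroset k (Im k m i)) /\ dim_eq k (zeroset k (Im k m i)) (2 * m + 1))
  /\ (forall v : pt k (nv m),
        zeroset k (Ifib k m) v <->
        [\/ zeroset k (Im k m 0) v, zeroset k (Im k m 1) v,
            zeroset k (Im k m 2) v | zeroset k (Im k m 3) v])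
  /\ (forall i j : nat, (i <= 3)%N -> (j <= 3)%N -> i <> j ->
        ~ zsubset k (zeroset k (Im k m i)) (zeroset k (Im k m j)))
  /\ ((6 <= m)%N -> quot_iso k (I0 k m) (Iprod k 11 (m - 6))).
Proof.
have k2 : char_two k by move=> x; apply: addrr_pchar2.
split; first by move=> i _; apply: zeroset_Im_dim.
split; first exact: decomposition.
split; first exact: noninclusion.
exact: I0_quot_iso.
Qed.
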